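(* Fix $0<p<\tfrac12$, let $q=1-p$ and $m_p=\lfloor 1/\log_2(1/q)\rfloor$. Let $r\ge1$ and let $H_1,\dots,H_r$ be pairwise non-ambient-isomorphic connected cube subgraphs, each with at most $m_p$ vertices. Let $t=\min_i v(H_i)$ and let $s$ be the maximum span of a graph $H_i$ with $v(H_i)=t$. For each $i$, let $Y_i=Y_i(d)$ be the number of components of $Q_p^d$ ambient-isomorphic to $H_i$; let $Y=\sum_iY_i$ and $\lambda=\mathbb{E}[Y]$. Let $I^*=\{i\in[r]: v(H_i)=t,\ \mathrm{span}(H_i)=s\}$, and for $i\in I^*$ let $\beta_i=\frac{1}{2^s s!}\left(\frac{p}{q^2}\right)^{e(H_i)}\left(\frac1q\right)^{e'(H_i)}$, and $c=\sum_{i\in I^*}\beta_i$. Then as $d\to\infty$: (a) $\lambda=(1+O(1/d))\,c\,(d)_s\,(2q^t)^d$; if $t\in\{1,2,3\}$ then $s=t-1$ and the error term $O(1/d)$ may be replaced by $O(dq^d)$. Also $\mathrm{Var}(Y)=(1+O(d^tq^{td}))\,\lambda$. (b) For each $\varepsilon>0$, $|Y-\lambda|<\varepsilon\sqrt{d\lambda}$ with very high probability, and also $|Y-\lambda|<\varepsilon\lambda$ with very high probability. (c) $d_{TV}(Y,\mathrm{Po}(\lambda))=O(d^tq^{td})$, and $Y^*=(Y-\lambda)/\sqrt{\mathrm{Var}(Y)}$ converges in distribution to a standard normal random variable.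
   Context: $Q^d$ is the hypercube on $\{0,1\}^d$; $Q_p^d$ is its random spanning subgraph keeping each edge independently with probability $p$. A cube subgraph is a subgraph of $Q^d$ for some $d$. For a connected cube subgraph $H\subseteq Q^d$, its support $S(H)$ is the set of indices $i$ such that some edge $xy$ of $H$ has $x_i=0,y_i=1$; $\mathrm{span}(H)=|S(H)|$. The canonical copy of $H$: if $H$ is a single vertex, it is $Q^0$; otherwise with $s=\mathrm{span}(H)$ and $\phi:[s]\to[d]$ the increasing injection with image $S(H)$, map $x\mapsto(x_{\phi(1)},\dots,x_{\phi(s)})\in\{0,1\}^s$, and the canonical copy is the image of $H$ (vertices and edges) in $Q^s$. Connected cube subgraphs are ambient-isomorphic if they have the same canonical copy. $v(H)$, $e(H)$ are the numbers of vertices and edges of $H$; $e'(H)$ is the number of edges of the hypercube not in $H$ but with both endpoints in $V(H)$. $(d)_s=d(d-1)\cdots(d-s+1)$. ''With very high probability'' means probability $1-e^{-\Omega(d)}$. $d_{TV}(Y,Y')=\frac12\sum_k|\mathbb{P}(Y=k)-\mathbb{P}(Y'=k)|$; $\mathrm{Po}(\lambda)$ is Poisson with mean $\lambda$. *)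

(* Defs.v *)
From mathcomp Require Import all_boot all_order all_algebra.
From mathcomp Require Import all_classical all_reals all_analysis.
Import Order.TTheory GRing.Theory Num.Theory.
Import numFieldNormedType.Exports.

Set Implicit Arguments.
Unset Strict Implicit.
Unset Printing Implicit Defensive.

Local Open Scope ring_scope.

Definition vertex (d : nat) : finType := {ffun 'I_d -> bool}.

Definition cube_adj d (x y : vertex d) : bool := #|[set i | x i != y i]| == 1%N.

(* The edge joining x and y is the two-element set [set x; y]. *)
Definition cube_edges d : {set {set vertex d}} :=
  [set e : {set vertex d} | [exists x : vertex d, exists y : vertex d,
     cube_adj x y && (e == [set x; y])]].

(* A pair (vertex set, edge set); that it is a subgraph of Q^d is the separate
   predicate cube_subgraph. *)
Definition cgraph (d : nat) : finType :=
  ({set vertex d} * {set {set vertex d}})%type.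

Definition verts d (H : cgraph d) : {set vertex d} := H.1.
Definition edges d (H : cgraph d) : {set {set vertex d}} := H.2.

Definition cube_subgraph d (H : cgraph d) : bool :=
  (edges H \subset cube_edges d) && [forall e in edges H, e \subset verts H].

Definition gadj d (H : cgraph d) : rel (vertex d) :=
  fun x y => [set x; y] \in edges H.

(* For a cube subgraph H, gadj H only relates vertices of H, so the paths
   considered by connect stay in H.  The empty graph is not connected. *)
Definition gconnected d (H : cgraph d) : bool :=
  (verts H != finset.set0) &&
  [forall x in verts H, forall y in verts H, connect (gadj H) x y].

Definition nverts d (H : cgraph d) : nat := #|verts H|.
Definition nedges d (H : cgraph d) : nat := #|edges H|.
(* Written e'(H) in the formula for beta. *)
Definition nmissing d (H : cgraph d) : nat :=
  #|[set e in cube_edges d | (e \subset verts H) && (e \notin edges H)]|.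

Definition cube_support d (H : cgraph d) : {set 'I_d} :=
  [set i | [exists x : vertex d, exists y : vertex d,
              [&& [set x; y] \in edges H, ~~ x i & y i]]].

Definition cube_span d (H : cgraph d) : nat := #|cube_support H|.

(* [enum_val : 'I_#|S| -> 'I_d] is the increasing injection with image S. *)
Definition proj_on d (S : {set 'I_d}) (x : vertex d) : vertex #|S| :=
  [ffun k : 'I_#|S| => x (enum_val k)].

(* The dimension of the canonical copy is part of the data.  A single vertex
   has empty support, so that its image here is Q^0. *)
Definition canonical_copy d (H : cgraph d) : {s : nat & cgraph s} :=
  Tagged cgraph
    (proj_on (cube_support H) @: verts H,
     [set proj_on (cube_support H) @: (e : {set vertex d}) | e in edges H]
       : {set {set vertex (cube_span H)}}).

Definition ambient_iso d d' (H : cgraph d) (K : cgraph d') : bool :=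
  canonical_copy H == canonical_copy K.

Definition gcomponent d (G : cgraph d) (x : vertex d) : cgraph d :=
  let C := [set y in verts G | connect (gadj G) x y] in
  (C, [set e in edges G | e \subset C]).

Definition components d (G : cgraph d) : {set cgraph d} :=
  [set gcomponent G x | x in verts G].

Definition spanning d (F : {set {set vertex d}}) : cgraph d :=
  ([set: vertex d]%SET, F).

Definition comp_count n (H : cgraph n) d (F : {set {set vertex d}}) : nat :=
  #|[set C in components (spanning F) | ambient_iso C H]|.

Section random_subgraph.
Variables (R : realType) (p : R) (d : nat).

(* Q_p^d is represented by its edge set F, a random subset of cube_edges d in
   which each edge is kept independently with probability p. *)
Definition weight (F : {set {set vertex d}}) : R :=
  p ^+ #|F| * (1 - p) ^+ #|cube_edges d :\: F|.

Definition Pr (A : pred {set {set vertex d}}) : R :=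
  \sum_(F in powerset (cube_edges d) | A F) weight F.

Definition Ex (X : {set {set vertex d}} -> R) : R :=
  \sum_(F in powerset (cube_edges d)) weight F * X F.

Definition Var (X : {set {set vertex d}} -> R) : R :=
  Ex (fun F => (X F - Ex X) ^+ 2).

End random_subgraph.

Local Open Scope classical_set_scope.

(* Probability 1 - e^{-Omega(d)}. *)
Definition wvhp (R : realType) (p : R)
    (A : forall d, pred {set {set vertex d}}) : Prop :=
  exists2 k : R, 0 < k &
    \forall d \near \oo, 1 - expR (- k * d%:R) <= Pr p (A d).

(* u = (1 + O(f)) v *)
Definition eq_factor_bigO (R : realType) (f u v : nat -> R) : Prop :=
  exists2 e : nat -> R, (e =O_\oo f) &
    \forall d \near \oo, u d = (1 + e d) * v d.

Definition dTV (R : realType) (P Q : nat -> R) : \bar R :=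
  ((2^-1)%:E * \sum_(0 <= k <oo) `|P k - Q k|%:E)%E.

Definition normal_cdf (R : realType) (x : R) : R :=
  fine (normal_prob 0 1 [set y : R | y <= x]).

(* Convergence in distribution, in terms of distribution functions. *)
Definition cvg_in_distribution (R : realType) (F : nat -> R -> R) (G : R -> R)
    : Prop :=
  forall x : R, {for x, continuous G} ->
    F n x @[n --> \oo] --> G x.

(* m_p, using log_2 x = ln x / ln 2 *)
Definition max_order (R : realType) (p : R) : int :=
  Num.floor (1 / (ln (1 / (1 - p)) / ln 2) : R).

Definition beta_coef (R : realType) (p : R) (s d : nat) (H : cgraph d) : R :=
  1 / (2 ^ s * s`!)%:R * (p / (1 - p) ^+ 2) ^+ nedges H
    * (1 / (1 - p)) ^+ nmissing H.

(* Main.v *)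
(** Write the count Y as a sum of indicators I_K over the copies K of the H_i in
    Q^d, where I_K says that K is a component: the random edge set meets the
    edges incident to V(K) exactly in E(K).  A copy is given by its support and
    by the values of the other coordinates, so E[Y] is an explicit sum.  I_K and
    I_K' are independent unless V(K) and V(K') are within distance one of each
    other, and the expected number of copies that are components and lie so
    close to a given K is O(d^t q^(td)).  The local form of the Chen-Stein
    method then bounds both |Var(Y) - lambda| / lambda and
    d_TV(Y, Po(lambda)) by O(d^t q^(td)), which is exponentially small; hence
    the concentration of Y and its asymptotic normality reduce to those of
    Po(lambda), where lambda grows at least linearly in d. *)

From HB Require Import structures.
From mathcomp Require Import all_boot all_order all_algebra.
From mathcomp Require Import all_classical all_reals all_analysis.
From mathcomp Require Import ring lra zify.
Require Import Defs.
(* [finset] is imported again because [classical_sets] shadows many of its names. *)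
Import mathcomp.boot.fintype mathcomp.boot.finset.
Import Order.TTheory GRing.Theory Num.Theory.
Import numFieldNormedType.Exports.

Set Implicit Arguments.
Unset Strict Implicit.
Unset Printing Implicit Defensive.

Local Open Scope ring_scope.

(** * Random subsets *)

(** Close pairs are controlled by a correlation bound. Distinct components share no vertex, and
    vertex-disjoint copies have at most v(K) v(K') incident edges in common; since p <= q, each of
    these edges costs a factor of at most 1/p. So E[I_K I_K'] is at most a constant times P(I_K)
    P(I_K'). The rate comes from span(H) < v(H): the copies close to a given one number O(d^(span +
    1)) = O(d^v), each is isolated with probability of order q^(vd), and for large d the power (d
    q^d)^v is largest at v = t. The bound v <= m_p amounts to 2 q^t >= 1; together with p < 1/2 in
    the case of single vertices it forces lambda >= kappa d. This keeps the Chernoff parameter, of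
    order sqrt (d / lambda), bounded in the concentration estimate. Stein's equation is solved only
    for bounded sets of values, so that every sum is finite; nothing is lost, because Y is bounded
    for each d. *)

Section random_subset.
Variables (R : realType) (T : finType) (p : R).
Implicit Types (A B D E F : {set T}) (u v : {set T} -> R).

Definition subset_weight E F : R := p ^+ #|F| * (1 - p) ^+ #|E :\: F|.

Definition subset_mean E u : R :=
  \sum_(F in powerset E) subset_weight E F * u F.

Lemma sum_powersetU D E u : D \subset E ->
  \sum_(F in powerset E) u F =
  \sum_(A in powerset D) \sum_(B in powerset (E :\: D)) u (A :|: B).
Proof.
move=> sDE; rewrite pair_big_dep /=.
rewrite (reindex_onto (fun AB : {set T} * {set T} => AB.1 :|: AB.2)
  (fun F => (F :&: D, F :\: D))) /=; last by move=> F _; exact: setID.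
apply: eq_bigl => -[A B] /=; rewrite !powersetE.
apply/andP/andP => [[sABE /eqP[E1 E2]]|[sAD sBED]].
  by split; [rewrite -E1 subsetIr | rewrite -E2 setSD].
split.
  by rewrite subUset (subset_trans sAD sDE) (subset_trans sBED (subsetDl _ _)).
have AD : A :&: D = A by apply/setIidPl.
have /disjoint_setI0 BD0 : [disjoint B & D].
  by move: sBED; rewrite subsetD => /andP[].
rewrite setIUl BD0 setU0 AD setDUl.
have -> : A :\: D = set0 by apply/eqP; rewrite setD_eq0.
by rewrite set0U; apply/eqP; congr (_, _); rewrite setDE; apply/setIidPl;
   rewrite -disjoints_subset -setI_eq0 BD0.
Qed.

Lemma subset_weightU D E A B : D \subset E -> A \subset D ->
  B \subset E :\: D ->
  subset_weight E (A :|: B) = subset_weight D A * subset_weight (E :\: D) B.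
Proof.
move=> sDE sAD; rewrite subsetD => /andP[sBE dBD].
have dAB : [disjoint A & B] by rewrite disjoint_sym; apply: disjointWr dBD.
have cU : #|A :|: B| = (#|A| + #|B|)%N by apply/eqP; rewrite (leq_card_setU A B).
have cD : #|E :\: (A :|: B)| = (#|D :\: A| + #|E :\: D :\: B|)%N.
  have -> : E :\: (A :|: B) = (D :\: A) :|: (E :\: D :\: B).
    apply/setP => x; rewrite !inE.
    have := subsetP sDE x; have := subsetP sAD x.
    have : x \in B -> x \notin D by move/(disjointFr dBD) => ->.
    by case: (x \in A); case: (x \in B); case: (x \in D); case: (x \in E) => //=;
      try (by move=> ? ? /(_ isT)); try (by move=> ? /(_ isT)); by move=> /(_ isT).
  apply/eqP; rewrite (leq_card_setU (D :\: A) _) -setI_eq0.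
  apply/eqP/setP => x; rewrite !inE; case: (x \in D); rewrite ?andbF //.
by rewrite /subset_weight cU cD !exprD mulrACA.
Qed.

Lemma sum_subset_weight E : \sum_(F in powerset E) subset_weight E F = 1.
Proof.
elim: #|E| {-2}E (erefl #|E|) => [|n IH] {}E cE.
  move/eqP: cE; rewrite cards_eq0 => /eqP ->.
  by rewrite powerset0 big_set1 /subset_weight set0D cards0 mul1r.
have [x xE] : exists x, x \in E by apply/card_gt0P; rewrite cE.
rewrite (@sum_powersetU [set x] E) ?sub1set //.
transitivity (\sum_(A in powerset [set x]) subset_weight [set x] A).
  apply: eq_bigr => A; rewrite powersetE => AD.
  rewrite -[RHS]mulr1 -(IH (E :\: [set x])); last first.
    by have := cardsD1 x E; rewrite xE cE => -[].
  rewrite big_distrr; apply: eq_bigr => B; rewrite powersetE => BE.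
  by rewrite (@subset_weightU [set x]) ?sub1set.
have -> : powerset [set x] = [set set0; [set x]].
  by apply/setP => A; rewrite powersetE subset1 !inE orbC.
rewrite big_setU1 ?big_set1 /=; last first.
  by rewrite inE eq_sym -cards_eq0 cards1.
rewrite /subset_weight setD0 setDv cards0 cards1 !expr0 !expr1; ring.
Qed.

Lemma subset_mean_prod D E u v : D \subset E ->
  subset_mean E (fun F => u (F :&: D) * v (F :\: D)) =
  subset_mean D u * subset_mean (E :\: D) v.
Proof.
move=> sDE; rewrite /subset_mean (sum_powersetU _ sDE) big_distrl /=.
apply: eq_bigr => A; rewrite powersetE => sAD; rewrite big_distrr /=.
apply: eq_bigr => B; rewrite powersetE => sB.
rewrite (subset_weightU sDE sAD sB); move: sB; rewrite subsetD => /andP[sBE dBD].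
rewrite setIUl setDUl (setIidPl sAD) (disjoint_setI0 dBD) setU0.
by rewrite (eqP (_ : A :\: D == set0)) ?setD_eq0 // set0U (setDidPl dBD); ring.
Qed.

(** Dependence on disjoint sets of edges is expressed by invariance under restriction, for every F.
    The means over D and E :\: D given by the product formula become means over E on replacing the
    other function by 1. *)
Lemma subset_mean_indep D E u v : D \subset E ->
  (forall F, u F = u (F :&: D)) -> (forall F, v F = v (F :\: D)) ->
  subset_mean E (fun F => u F * v F) = subset_mean E u * subset_mean E v.
Proof.
move=> sDE uD vD.
have E1 w : subset_mean E (fun F => u F * w (F :\: D)) =
  subset_mean D u * subset_mean (E :\: D) w.
  by rewrite -(subset_mean_prod _ _ sDE); apply: eq_bigr => F _; rewrite -uD.
have one D' : subset_mean D' (fun=> 1) = 1.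
  by rewrite -[RHS](sum_subset_weight D'); apply: eq_bigr => F _; rewrite mulr1.
transitivity (subset_mean D u * subset_mean (E :\: D) v).
  by rewrite -E1; apply: eq_bigr => F _; rewrite -vD.
congr (_ * _).
  have := E1 (fun=> 1); rewrite one mulr1 => <-.
  by apply: eq_bigr => F _; rewrite mulr1.
have := subset_mean_prod (fun=> 1) v sDE; rewrite one mul1r => <-.
by apply: eq_bigr => F _; rewrite mul1r -vD.
Qed.

Lemma subset_mean_cylinder D E A : D \subset E -> A \subset D ->
  subset_mean E (fun F => (F :&: D == A)%:R) = subset_weight D A.
Proof.
move=> sDE sAD.
transitivity (subset_mean D (fun F => (F == A)%:R) * subset_mean (E :\: D) (fun=> 1)).
  by rewrite -(subset_mean_prod _ _ sDE); apply: eq_bigr => F _; rewrite mulr1.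
have -> : subset_mean (E :\: D) (fun=> 1) = 1.
  by rewrite -[RHS](sum_subset_weight (E :\: D)); apply: eq_bigr => F _; rewrite mulr1.
rewrite mulr1 /subset_mean (bigD1 A) ?powersetE //= eqxx mulr1 big1 ?addr0 //.
by move=> F /andP[_ /negPf ->]; rewrite mulr0.
Qed.
End random_subset.

(** * Local dependence *)

Section local_dependence.
Variables (R : realType) (W J : finType) (S : {set W}) (w : W -> R).
Variables (K : {set J}) (X : J -> W -> bool) (nearby : rel J).
Hypotheses (w_ge0 : forall x, x \in S -> 0 <= w x)
  (w_sum1 : \sum_(x in S) w x = 1).

Definition mean (u : W -> R) : R := \sum_(x in S) w x * u x.

Definition count_in (x : W) : nat := \sum_(j in K) X j x.
Definition far_count (k : J) (x : W) : nat := \sum_(j in K | ~~ nearby k j) X j x.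

Let prob (j : J) : R := mean (fun x => (X j x)%:R).
Let prob2 (k j : J) : R := mean (fun x => (X k x && X j x)%:R).

(** The quantity b1 + b2 of the Chen-Stein method: j = k is kept among the products and left out of
    the joint probabilities. The third quantity b3 vanishes under [far_indep]. *)
Definition dependence_bound : R :=
  \sum_(k in K) (prob k * \sum_(j in K | nearby k j) prob j +
                 \sum_(j in K | nearby k j && (j != k)) prob2 k j).

Hypothesis near_refl : forall k, k \in K -> nearby k k.
Hypothesis far_indep : forall k (g : nat -> R), k \in K ->
  mean (fun x => (X k x)%:R * g (far_count k x)) =
  prob k * mean (fun x => g (far_count k x)).

Lemma eq_mean u v : (forall x, x \in S -> u x = v x) -> mean u = mean v.
Proof. by move=> uv; apply: eq_bigr => x xS; rewrite uv. Qed.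

Lemma meanD u v : mean (fun x => u x + v x) = mean u + mean v.
Proof. by rewrite -big_split; apply: eq_bigr => x _; rewrite mulrDr. Qed.

Lemma meanZ a u : mean (fun x => a * u x) = a * mean u.
Proof. by rewrite /mean big_distrr; apply: eq_bigr => x _; rewrite mulrCA. Qed.

Lemma meanN u : mean (fun x => - u x) = - mean u.
Proof. by rewrite -sumrN; apply: eq_bigr => x _; rewrite mulrN. Qed.

Lemma meanB u v : mean (fun x => u x - v x) = mean u - mean v.
Proof. by rewrite -meanN -meanD. Qed.

Lemma mean_cst a : mean (fun=> a) = a.
Proof. by rewrite /mean -big_distrl /= w_sum1 mul1r. Qed.

Lemma mean_sum (I : Type) (r : seq I) (P : pred I) (u : I -> W -> R) :
  mean (fun x => \sum_(i <- r | P i) u i x) = \sum_(i <- r | P i) mean (u i).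
Proof.
rewrite /mean exchange_big /=; apply: eq_bigr => x _.
by rewrite big_distrr.
Qed.

Lemma le_mean u v : (forall x, x \in S -> u x <= v x) -> mean u <= mean v.
Proof. by move=> uv; apply: ler_sum => x xS; rewrite ler_wpM2l ?w_ge0 ?uv. Qed.

Lemma norm_mean u : `|mean u| <= mean (fun x => `|u x|).
Proof.
apply: le_trans (ler_norm_sum _ _ _) _; apply: ler_sum => x xS.
by rewrite normrM (ger0_norm (w_ge0 xS)).
Qed.

Lemma mean_ge0 u : (forall x, x \in S -> 0 <= u x) -> 0 <= mean u.
Proof. by move=> u0; apply: sumr_ge0 => x xS; rewrite mulr_ge0 ?w_ge0 ?u0. Qed.

Lemma mean_count : mean (fun x => (count_in x)%:R) = \sum_(k in K) prob k.
Proof. by rewrite -mean_sum; apply: eq_mean => x _; rewrite natr_sum. Qed.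

Let rest k x : nat := \sum_(j in K | nearby k j) X j x.
Let rest' k x : nat := \sum_(j in K | nearby k j && (j != k)) X j x.

Lemma far_countE k x : count_in x = (rest k x + far_count k x)%N.
Proof. by rewrite /count_in (bigID (nearby k)). Qed.

Lemma restE k x : k \in K -> rest k x = (X k x + rest' k x)%N.
Proof.
move=> kK; rewrite /rest (bigD1 k) ?kK ?near_refl //=; congr (_ + _)%N.
by apply: eq_bigl => j; rewrite andbA.
Qed.

Lemma mean_rest k : mean (fun x => (rest k x)%:R) = \sum_(j in K | nearby k j) prob j.
Proof. by rewrite -mean_sum; apply: eq_mean => x _; rewrite natr_sum. Qed.

Lemma mean_rest' k : mean (fun x => (X k x)%:R * (rest' k x)%:R) =
  \sum_(j in K | nearby k j && (j != k)) prob2 k j.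
Proof.
rewrite -mean_sum; apply: eq_mean => x _.
by rewrite natr_sum big_distrr; apply: eq_bigr => j _ /=; rewrite -natrM mulnb.
Qed.

(** Only values of f at positive arguments are compared, because a Stein solution has an arbitrary
    value at 0. *)
Lemma lipschitz_steps (f : nat -> R) (L : R) :
  (forall n, `|f n.+2 - f n.+1| <= L) ->
  forall m n, `|f (n + m).+1 - f n.+1| <= L * m%:R.
Proof.
move=> fL; elim=> [|m IH] n; first by rewrite addn0 subrr normr0 mulr0.
have -> : f (n + m.+1).+1 - f n.+1 =
    (f (n + m).+2 - f (n + m).+1) + (f (n + m).+1 - f n.+1) by rewrite addnS; ring.
apply: le_trans (ler_normD _ _) _.
by rewrite -natr1 mulrDr mulr1 addrC lerD.
Qed.

(* Chen's local method: compare the count with the part of it that is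
   independent of the k-th indicator. *)
Lemma stein_local (f : nat -> R) (L : R) :
  (forall n, `|f n.+2 - f n.+1| <= L) ->
  `|mean (fun x => mean (fun y => (count_in y)%:R) * f (count_in x).+1
             - (count_in x)%:R * f (count_in x))| <= L * dependence_bound.
Proof.
move=> fL; have L0 : 0 <= L by apply: le_trans (fL 0%N).
(* The value [f (far_count k x).+1] is inserted twice with opposite signs; by [far_indep] the two
   insertions cancel in the mean. *)
pose g k x := prob k * (f (count_in x).+1 - f (far_count k x).+1)
  + (X k x)%:R * (f (far_count k x).+1 - f (count_in x)).
have -> : mean (fun x => mean (fun y => (count_in y)%:R) * f (count_in x).+1
             - (count_in x)%:R * f (count_in x)) = \sum_(k in K) mean (g k).
  rewrite mean_count.
  have -> : \sum_(k in K) mean (g k) = \sum_(k in K)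
      (prob k * mean (fun x => f (count_in x).+1)
       - mean (fun x => (X k x)%:R * f (count_in x))).
    apply: eq_bigr => k kK; rewrite meanD meanZ meanB.
    have -> : mean (fun x => (X k x)%:R * (f (far_count k x).+1 - f (count_in x)))
        = mean (fun x => (X k x)%:R * (f (far_count k x).+1))
          - mean (fun x => (X k x)%:R * f (count_in x)).
      by rewrite -meanB; apply: eq_mean => x _; rewrite mulrBr.
    rewrite (far_indep (fun n => f n.+1) kK); ring.
  rewrite meanB meanZ sumrB big_distrl /=; congr (_ - _).
  rewrite -mean_sum; apply: eq_mean => x _.
  by rewrite natr_sum big_distrl.
apply: le_trans (ler_norm_sum _ _ _) _.
rewrite /dependence_bound big_distrr /=; apply: ler_sum => k kK.
rewrite meanD meanZ mulrDr; apply: le_trans (ler_normD _ _) _.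
apply: lerD.
  have p0 : 0 <= prob k by apply: mean_ge0.
  rewrite normrM (ger0_norm p0) mulrCA ler_wpM2l //.
  rewrite -mean_rest -meanZ; apply: le_trans (norm_mean _) _.
  apply: le_mean => x _; rewrite (far_countE k) addnC.
  exact: lipschitz_steps.
rewrite -mean_rest' -meanZ; apply: le_trans (norm_mean _) _.
apply: le_mean => x _; rewrite (far_countE k) restE // normrM normr_nat.
(* When [X k x] holds, the count is one more than [rest' k x + far_count k x]. This one matches the
   successor in f, so only the steps with j != k remain. *)
case: (X k x); rewrite /= ?mul0r ?mulr0 // !mul1r add1n addSn distrC addnC.
exact: lipschitz_steps.
Qed.

(** In the second moment, far pairs contribute products that cancel against the square of the mean,
    and the diagonal contributes the mean itself. What is left is a difference of two nonnegative
    sums, hence the same bound as in Stein's method. *)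
Lemma variance_local (l := mean (fun x => (count_in x)%:R)) :
  `|mean (fun x => ((count_in x)%:R - l) ^+ 2) - l| <= dependence_bound.
Proof.
have lE : l = \sum_(k in K) prob k by rewrite /l mean_count.
have -> : mean (fun x => ((count_in x)%:R - l) ^+ 2) - l =
  \sum_(k in K) (\sum_(j in K | nearby k j && (j != k)) prob2 k j
                 - prob k * \sum_(j in K | nearby k j) prob j).
  have -> : mean (fun x => ((count_in x)%:R - l) ^+ 2) =
      mean (fun x => (count_in x)%:R * (count_in x)%:R) - l * l.
    transitivity (mean (fun x => (count_in x)%:R * (count_in x)%:R
        - 2 * l * (count_in x)%:R + l * l)); first by apply: eq_mean => x _; ring.
    rewrite meanD meanB meanZ mean_cst -/l; ring.
  have -> : mean (fun x => (count_in x)%:R * (count_in x)%:R : R) =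
     \sum_(k in K) (prob k + \sum_(j in K | nearby k j && (j != k)) prob2 k j
        + prob k * (l - \sum_(j in K | nearby k j) prob j)).
    transitivity (mean (fun x => \sum_(k in K) (X k x)%:R * (count_in x)%:R)).
      by apply: eq_mean => x _; rewrite -big_distrl -natr_sum.
    rewrite mean_sum; apply: eq_bigr => k kK.
    rewrite -mean_rest' -mean_rest -meanB.
    have -> : mean (fun x => (count_in x)%:R - (rest k x)%:R) =
        mean (fun x => (far_count k x)%:R).
      by apply: eq_mean => x _; rewrite (far_countE k) natrD addrC addKr.
    rewrite -(far_indep (fun n => n%:R)) // -!meanD; apply: eq_mean => x _.
    rewrite (far_countE k) restE // !natrD !mulrDr -natrM mulnb andbb; ring.
  have -> : l * l = \sum_(k in K) prob k * l by rewrite {1}lE big_distrl.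
  rewrite [X in _ - _ - X]lE -!sumrB; apply: eq_bigr => k _; ring.
apply: le_trans (ler_norm_sum _ _ _) _; apply: ler_sum => k kK.
apply: le_trans (ler_normB _ _) _; rewrite addrC !ger0_norm //.
  by apply: sumr_ge0 => j _; apply: mean_ge0.
by apply: mulr_ge0; [apply: mean_ge0 | apply: sumr_ge0 => j _; apply: mean_ge0].
Qed.
End local_dependence.

(** * The hypercube *)

Section cube_edges.
Variable d : nat.
Implicit Types (x y z : vertex d) (e : {set vertex d}) (i : 'I_d) (V : {set vertex d}).

Lemma cube_adjC x y : cube_adj x y = cube_adj y x.
Proof. by rewrite /cube_adj; congr (#|pred_of_set _| == _); apply/setP => i;
  rewrite !inE eq_sym. Qed.

Lemma cube_adjxx x : cube_adj x x = false.
Proof.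
rewrite /cube_adj (_ : [set i | _] = set0) ?cards0 //.
by apply/setP => i; rewrite !inE eqxx.
Qed.

Lemma cube_adj_neq x y : cube_adj x y -> x != y.
Proof. by apply: contraTneq => ->; rewrite cube_adjxx. Qed.

Lemma cube_edgesP e :
  reflect (exists x y, cube_adj x y /\ e = [set x; y]) (e \in cube_edges d).
Proof.
rewrite inE; apply: (iffP existsP) => [[x /existsP[y /andP[xy /eqP ->]]]|[x [y [xy
  ->]]]].
  by exists x, y.
by exists x; apply/existsP; exists y; rewrite xy eqxx.
Qed.

Lemma cube_edges2 x y : ([set x; y] \in cube_edges d) = cube_adj x y.
Proof.
apply/cube_edgesP/idP => [[u [v [uv E]]]|xy]; last by exists x, y.
have: x \in [set u; v] by rewrite -E !inE eqxx.
have: y \in [set u; v] by rewrite -E !inE eqxx orbT.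
have: u \in [set x; y] by rewrite E !inE eqxx.
have: v \in [set x; y] by rewrite E !inE eqxx orbT.
have := cube_adj_neq uv.
rewrite !inE => uv' /orP[]/eqP h1 /orP[]/eqP h2 /orP[]/eqP h3 /orP[]/eqP h4;
  subst; rewrite ?eqxx // in uv'; by [rewrite uv | rewrite cube_adjC uv].
Qed.

Lemma in_cube_edges_if (P : pred {set vertex d}) e :
  (e \in [set e in cube_edges d | P e]) = (e \in cube_edges d) && P e.
Proof. by rewrite [LHS]in_set. Qed.

Lemma card_cube_edge e : e \in cube_edges d -> #|e| = 2%N.
Proof. by move=> /cube_edgesP[x [y [/cube_adj_neq xy ->]]]; rewrite cards2 xy. Qed.

Lemma cube_edge_other e x : e \in cube_edges d -> x \in e ->
  exists2 y, cube_adj x y & e = [set x; y].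
Proof.
move=> /cube_edgesP[u [v [uv ->]]]; rewrite !inE => /orP[]/eqP->.
  by exists v.
by exists u; rewrite 1?cube_adjC // finset.setUC.
Qed.

Definition flip x i : vertex d := [ffun j => if j == i then ~~ x j else x j].

Lemma cube_adj_flip x i : cube_adj x (flip x i).
Proof.
rewrite /cube_adj (_ : [set j | _] = [set i]) ?cards1 //.
apply/setP => j; rewrite !inE ffunE; case: (j == i); last by rewrite eqxx.
by case: (x j).
Qed.

Lemma cube_adjP x y : reflect (exists i, y = flip x i) (cube_adj x y).
Proof.
apply: (iffP idP) => [/cards1P[i E]|[i ->]]; last exact: cube_adj_flip.
exists i; apply/ffunP => j; rewrite ffunE; have := in_set1 j i.
rewrite -E inE => <-; case: eqVneq => //.
by case: (x j); case: (y j).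
Qed.

Lemma flip_inj x : injective (flip x).
Proof.
move=> i j /ffunP /(_ i); rewrite !ffunE eqxx; case: eqVneq => //.
by case: (x i).
Qed.

Lemma card_neighbours x : #|[set y | cube_adj x y]| = d.
Proof.
rewrite -[RHS]card_ord -cardsT -(card_imset _ (@flip_inj x)).
congr #|pred_of_set _|; apply/setP => y; rewrite inE.
apply/cube_adjP/imsetP => [[i ->]|[i _ ->]]; by exists i.
Qed.

Lemma card_edges_at x : #|[set e in cube_edges d | x \in e]| = d.
Proof.
rewrite -[RHS](card_neighbours x).
rewrite -(@card_in_imset _ _ (fun y => [set x; y]) [set y | cube_adj x y]).
  congr #|pred_of_set _|; apply/setP => e; rewrite in_cube_edges_if.
  apply/andP/imsetP => [[eE xe]|[y]]; last rewrite inE.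
    by have [y xy ->] := cube_edge_other eE xe; exists y; rewrite ?inE.
  by move=> xy -> /=; rewrite cube_edges2 xy !inE eqxx.
move=> y z; rewrite !inE => xy xz /setP /(_ y); rewrite !inE eqxx orbT.
by move: (cube_adj_neq xy); rewrite eq_sym => /negPf -> /= /esym /eqP.
Qed.

Definition incident V : {set {set vertex d}} :=
  [set e in cube_edges d | e :&: V != set0].

Lemma in_incident V e :
  (e \in incident V) = (e \in cube_edges d) && (e :&: V != set0).
Proof. exact: in_cube_edges_if. Qed.

Lemma sub_incident V : incident V \subset cube_edges d.
Proof. by apply/subsetP => e; rewrite in_incident => /andP[]. Qed.

(** Count the pairs of a vertex of V and an edge at it: an edge with one end in V is counted once,
    an edge inside V twice. *)
Lemma card_incident V :
  (#|incident V| + #|[set e in cube_edges d | e \subset V]| = d * #|V|)%N.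
Proof.
transitivity (\sum_(x in V) \sum_(e in cube_edges d) (x \in e : nat))%N; last first.
  rewrite mulnC -sum_nat_const; apply: eq_bigr => x xV.
  rewrite -[RHS](card_edges_at x) -sum1_card big_mkcond [RHS]big_mkcond /=.
  by apply: eq_bigr => e _; rewrite in_cube_edges_if; case: (e \in _); case: (x \in e).
rewrite exchange_big /= -!sum1_card.
rewrite [X in (X + _)%N]big_mkcond [X in (_ + X)%N]big_mkcond -big_split.
rewrite [RHS]big_mkcond; apply: eq_bigr => e _ /=; rewrite in_incident in_cube_edges_if.
have [eE|//] := boolP (e \in cube_edges d); rewrite /=.
have -> : (\sum_(x in V) (x \in e : nat) = #|e :&: V|)%N.
  rewrite -sum1_card big_mkcond [RHS]big_mkcond; apply: eq_bigr => x _.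
  by rewrite inE; case: (x \in V); case: (x \in e).
have c2 := card_cube_edge eE.
have [sub|nsub] := boolP (e \subset V).
  by rewrite (setIidPl sub) c2 -card_gt0 c2.
have lt2 : (#|e :&: V| < 2)%N.
  rewrite -c2; apply: proper_card; rewrite properE subsetIl.
  by apply: contra nsub => h; apply: subset_trans h (subsetIr _ _).
by rewrite -card_gt0; case: #|_| lt2 => [|[]].
Qed.

(** An edge meeting two disjoint sets has one end in each, so a pair in their product determines
    it. *)
Lemma incident_meet V V' : [disjoint V & V'] ->
  (#|incident V :&: incident V'| <= #|V| * #|V'|)%N.
Proof.
move=> dV; rewrite -cardsX.
apply: leq_trans (leq_imset_card (fun u : vertex d * vertex d => [set u.1; u.2]) _).
apply: subset_leq_card; apply/subsetP => e; rewrite in_setI !in_incident.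
case/andP=> /andP[eE /set0Pn[x]]; rewrite inE => /andP[xe xV].
case/andP=> _ /set0Pn[y]; rewrite inE => /andP[ye yV'].
apply/imsetP; exists (x, y); first by rewrite !inE xV yV'.
have [z xz E] := cube_edge_other eE xe; rewrite E /=.
move: ye; rewrite E !inE => /orP[]/eqP yE; last by rewrite yE.
by move: (disjointFr dV xV); rewrite -yE yV'.
Qed.
End cube_edges.

(** * Components as events on incident edges *)

Section components.
Variable d : nat.
Implicit Types (x y z : vertex d) (F : {set {set vertex d}}) (G K : cgraph d).

Lemma gadjC K : symmetric (gadj K).
Proof. by move=> x y; rewrite /gadj finset.setUC. Qed.

Lemma gadj_connect_sym K : connect_sym (gadj K).
Proof. exact/sym_connect_sym/gadjC. Qed.

Lemma gadj_verts K x y : cube_subgraph K -> gadj K x y ->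
  (x \in verts K) && (y \in verts K).
Proof.
case/andP=> _ /forallP/(_ [set x; y])/implyP sub /sub /subsetP sxy.
by rewrite !sxy // !inE eqxx ?orbT.
Qed.

Lemma gadj_cube K x y : cube_subgraph K -> gadj K x y -> cube_adj x y.
Proof. by case/andP=> /subsetP sub _ /sub; rewrite cube_edges2. Qed.

Lemma edges_cube K e : cube_subgraph K -> e \in edges K ->
  (e \in cube_edges d) /\ e \subset verts K.
Proof.
case/andP=> /subsetP sub /forallP/(_ e)/implyP sv eK.
by split; [exact: sub | exact: sv].
Qed.

Lemma gconnectedP K :
  reflect ((exists x, x \in verts K) /\
           {in verts K &, forall x y, connect (gadj K) x y})
          (gconnected K).
Proof.
apply: (iffP andP) => -[h1 h2].
  split; first exact/set0Pn.
  move=> x y xK yK.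
  by move/forallP/(_ x)/implyP/(_ xK)/forallP/(_ y)/implyP/(_ yK): h2.
split; first exact/set0Pn.
apply/forallP => x; apply/implyP => xK; apply/forallP => y; apply/implyP => yK.
exact: h2.
Qed.

Lemma gcomponent_verts F x y :
  (y \in verts (gcomponent (spanning F) x)) = connect (gadj (spanning F)) x y.
Proof. by rewrite inE inE. Qed.

Lemma gcomponent_eq F x y : y \in verts (gcomponent (spanning F) x) ->
  gcomponent (spanning F) y = gcomponent (spanning F) x.
Proof.
rewrite gcomponent_verts => xy.
have E : verts (gcomponent (spanning F) y) = verts (gcomponent (spanning F) x).
  apply/setP => z; rewrite !gcomponent_verts.
  exact/esym/same_connect/xy/gadj_connect_sym.
by rewrite /gcomponent; move: E => /= E; rewrite [X in (X, _)]E; congr (_, _);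
  rewrite E.
Qed.

Lemma components_meet F K K' x : K \in components (spanning F) ->
  K' \in components (spanning F) -> x \in verts K -> x \in verts K' -> K = K'.
Proof.
case/imsetP=> y _ -> /imsetP[z _ ->] xy xz.
by rewrite -(gcomponent_eq xy) (gcomponent_eq xz).
Qed.

Lemma component_incident F x : F \subset cube_edges d ->
  edges (gcomponent (spanning F) x) =
  F :&: incident (verts (gcomponent (spanning F) x)).
Proof.
move=> /subsetP sF; apply/setP => e; rewrite in_set in_setI in_incident /=.
have [eF|//] := boolP (e \in F); rewrite (sF _ eF) /=.
have [u [v [uv eE]]] := cube_edgesP _ (sF _ eF).
have auv : gadj (spanning F) u v by rewrite /gadj -eE.
have cuv : (u \in verts (gcomponent (spanning F) x)) =
           (v \in verts (gcomponent (spanning F) x)).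
  rewrite !gcomponent_verts ![connect _ x _]gadj_connect_sym.
  exact/same_connect/connect1/auv/gadj_connect_sym.
rewrite eE subUset !sub1set -/(verts (gcomponent (spanning F) x)).
rewrite -[_ \in [set y in _ | _]]/(u \in verts (gcomponent (spanning F) x)).
rewrite -[v \in [set y in _ | _]]/(v \in verts (gcomponent (spanning F) x)).
rewrite -cuv andbb; apply/idP/set0Pn => [ux|[w]].
  by exists u; rewrite in_setI ux in_set2 eqxx.
by rewrite in_setI in_set2 => /andP[/orP[]/eqP-> //]; rewrite -cuv.
Qed.

Lemma components_cube F K : F \subset cube_edges d ->
  K \in components (spanning F) -> cube_subgraph K && gconnected K.
Proof.
move=> sF /imsetP[x _ ->]; set C := gcomponent _ x.
have CF e : e \in edges C -> e \in F by rewrite in_set => /andP[].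
have Cadj u v : u \in verts C -> gadj (spanning F) u v -> gadj C u v.
  move=> uC uv; rewrite /gadj (component_incident _ sF) in_setI in_incident.
  rewrite [X in X && _]uv (subsetP sF _ uv) /=.
  by apply/set0Pn; exists u; rewrite in_setI uC in_set2 eqxx.
have CvF u v : connect (gadj C) u v -> connect (gadj (spanning F)) u v.
  by apply: connect_sub => a b ab; apply: connect1; exact: CF.
have cx y : y \in verts C -> connect (gadj C) x y.
  rewrite gcomponent_verts => xy.
  have /closed_connect /(_ _ _ xy) : fingraph.closed (gadj (spanning F)) (connect (gadj
    C) x).
    move=> u v uv; rewrite ![_ \in connect _ _]unfold_in; apply/idP/idP => h.
      apply: (connect_trans h (connect1 (Cadj _ _ _ uv))).
      by rewrite gcomponent_verts CvF.
    apply: (connect_trans h (connect1 (Cadj _ _ _ _))); last by rewrite gadjC.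
    by rewrite gcomponent_verts CvF.
  by move=> E; have := connect0 (gadj C) x;
    rewrite -[connect _ _ x]/(x \in connect (gadj C) x) E.
apply/andP; split.
  apply/andP; split.
    by apply/subsetP => e /CF; exact: (subsetP sF).
  by apply/forallP => e; apply/implyP; rewrite in_set => /andP[].
apply/gconnectedP; split; first by exists x; rewrite gcomponent_verts connect0.
move=> y z yC zC; apply: connect_trans (cx _ zC).
by rewrite gadj_connect_sym cx.
Qed.

(** If F has exactly the edges of K at V(K), no edge of F leaves V(K), and K is connected through
    edges of F. This turns the global notion of component into a condition on finitely many
    prescribed edges. *)
Lemma components_isolated F K : F \subset cube_edges d -> cube_subgraph K ->
  gconnected K ->
  (K \in components (spanning F)) = (F :&: incident (verts K) == edges K).
Proof.
move=> sF cK /gconnectedP[[x xK] conn]; apply/idP/eqP => [/imsetP[z _ ->]|E].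
  by rewrite -component_incident.
have sKF : edges K \subset F by rewrite -E subsetIl.
have clo u v : gadj (spanning F) u v -> u \in verts K -> v \in verts K.
  move=> uv uK; suff /(gadj_verts cK)/andP[] : gadj K u v by [].
  rewrite /gadj -E in_setI in_incident [X in X && _]uv (subsetP sF _ uv) /=.
  by apply/set0Pn; exists u; rewrite in_setI uK in_set2 eqxx.
have VE : verts (gcomponent (spanning F) x) = verts K.
  apply/setP => y; rewrite gcomponent_verts; apply/idP/idP => [xy|yK].
    rewrite -(closed_connect _ xy) // => u v uv.
    by apply/idP/idP; apply: clo; rewrite // gadjC.
  apply: connect_sub (conn _ _ xK yK) => a b ab; apply: connect1.
  exact: (subsetP sKF).
apply/imsetP; exists x => //.
rewrite [LHS]surjective_pairing [RHS]surjective_pairing; congr (_, _) => //.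
by rewrite -[RHS]/(edges _) (component_incident _ sF) VE E.
Qed.
End components.

(** Canonical copies and placements of a graph in a subcube are both of this form, so the invariance
    of v, e and e' is proved once, for maps injective and adjacency-preserving on V(K). *)
Definition gimage d d' (f : vertex d -> vertex d') (K : cgraph d) : cgraph d' :=
  (f @: verts K, [set f @: (e : {set vertex d}) | e in edges K]).

Section graph_image.
Variables (d d' : nat) (f : vertex d -> vertex d') (K : cgraph d).
Implicit Types (e : {set vertex d}) (x y : vertex d).
Hypotheses (f_inj : {in verts K &, injective f})
  (f_adj : {in verts K &, forall x y, cube_adj (f x) (f y) = cube_adj x y})
  (K_cube : cube_subgraph K).

Lemma imset_inj_in (e e' : {set vertex d}) : e \subset verts K ->
  e' \subset verts K -> f @: e = f @: e' -> e = e'.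
Proof.
have sub (a b : {set vertex d}) : a \subset verts K -> b \subset verts K ->
    f @: a = f @: b -> a \subset b.
  move=> sa sb E; apply/subsetP => x xa.
  have : f x \in f @: b by rewrite -E imset_f.
  case/imsetP=> y yb /f_inj -> //; first exact: (subsetP sa).
  exact: (subsetP sb).
move=> se se' E; apply/eqP; rewrite eqEsubset; apply/andP; split.
  exact: sub se se' E.
exact: sub se' se (esym E).
Qed.

Lemma gimage_nverts : nverts (gimage f K) = nverts K.
Proof. exact: card_in_imset. Qed.

Lemma gimage_nedges : nedges (gimage f K) = nedges K.
Proof.
apply: card_in_imset => e e' eK e'K.
by apply: imset_inj_in; [have [] := edges_cube K_cube eK | have [] := edges_cube K_cube
  e'K].
Qed.

Lemma gimage_edge e : e \subset verts K ->
  (f @: e \in edges (gimage f K)) = (e \in edges K).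
Proof.
move=> eV; apply/imsetP/idP => [[e' e'K E]|eK]; last by exists e.
by rewrite (imset_inj_in eV _ E) //; have [] := edges_cube K_cube e'K.
Qed.

Lemma imset_set2 x y : f @: [set x; y] = [set f x; f y].
Proof. by rewrite imsetU !imset_set1. Qed.

Lemma gimage_gadj x y : x \in verts K -> y \in verts K ->
  gadj (gimage f K) (f x) (f y) = gadj K x y.
Proof.
move=> xK yK; rewrite /gadj -imset_set2 gimage_edge //.
by rewrite subUset !sub1set xK yK.
Qed.

Lemma gimage_cube_edge e : e \subset verts K ->
  (f @: e \in cube_edges d') = (e \in cube_edges d).
Proof.
move=> eV; apply/idP/idP; last first.
  move=> /cube_edgesP[x [y [xy eE]]]; move: eV.
  rewrite eE subUset !sub1set => /andP[xK yK].
  by rewrite imset_set2 cube_edges2 f_adj.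
move=> /cube_edgesP[u [v [uv E]]].
have : u \in f @: e by rewrite E in_set2 eqxx.
case/imsetP=> x xe uE.
have : v \in f @: e by rewrite E in_set2 eqxx orbT.
case/imsetP=> y ye vE.
have -> : e = [set x; y].
  apply: imset_inj_in => //; last by rewrite imset_set2 E uE vE.
  by rewrite subUset !sub1set !(subsetP eV).
by rewrite cube_edges2 -f_adj ?(subsetP eV) // -uE -vE.
Qed.

Lemma gimage_cube : cube_subgraph (gimage f K).
Proof.
apply/andP; split.
  apply/subsetP => _ /imsetP[e eK ->].
  by have [eE eV] := edges_cube K_cube eK; rewrite gimage_cube_edge.
apply/forallP => e'; apply/implyP => /imsetP[e eK ->].
by apply: imsetS; have [] := edges_cube K_cube eK.
Qed.

Lemma gimage_nmissing : nmissing (gimage f K) = nmissing K.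
Proof.
rewrite /nmissing; set A := [set e in cube_edges d | _].
have inA e : (e \in A) = (e \in cube_edges d) && ((e \subset verts K) && (e \notin
  edges K)).
  exact: in_cube_edges_if.
rewrite -(@card_in_imset _ _ (fun e : {set vertex d} => f @: e) A); last first.
  move=> e e'; rewrite !inA => /and3P[_ eV _] /and3P[_ eV' _].
  exact: imset_inj_in.
congr #|pred_of_set _|; apply/setP => e'; rewrite in_cube_edges_if.
apply/and3P/imsetP => [[e'E e'V e'K]|[e]].
  have E : f @: [set x in verts K | f x \in e'] = e'.
    apply/setP => u; apply/imsetP/idP => [[x]|ue'].
      by rewrite inE => /andP[_ xe'] ->.
    have /imsetP[x xK uE] := subsetP e'V _ ue'.
    by exists x => //; rewrite inE xK -uE.
  have sV : [set x in verts K | f x \in e'] \subset verts K.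
    by apply/subsetP => x; rewrite inE => /andP[].
  exists [set x in verts K | f x \in e'] => //.
  by rewrite inA sV -(gimage_cube_edge sV) -(gimage_edge sV) E e'E e'K.
rewrite inA => /and3P[eE eV eK] ->.
by rewrite gimage_cube_edge // gimage_edge // imsetS.
Qed.

Lemma gimage_connected : gconnected K -> gconnected (gimage f K).
Proof.
move=> /gconnectedP[[x xK] conn]; apply/gconnectedP; split.
  by exists (f x); apply: imset_f.
move=> _ _ /imsetP[u uK ->] /imsetP[v vK ->].
have /connectP[s] := conn _ _ uK vK.
elim: s u uK => [|w s IH] u uK /=; first by move=> _ ->; rewrite connect0.
case/andP=> uw sp vE; have /andP[_ wK] := gadj_verts K_cube uw.
by apply: connect_trans (IH _ wK sp vE); apply: connect1; rewrite gimage_gadj.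
Qed.
End graph_image.

Lemma eq_in_gimage d d' (f g : vertex d -> vertex d') (K : cgraph d) :
  cube_subgraph K -> {in verts K, f =1 g} -> gimage f K = gimage g K.
Proof.
move=> cK fg; rewrite /gimage (eq_in_imset fg); congr (_, _).
apply: eq_in_imset => e eK; apply: eq_in_imset => x xe; apply: fg.
by have [_ /subsetP] := edges_cube cK eK; apply.
Qed.

Lemma gimage_id d (K : cgraph d) : gimage id K = K.
Proof.
rewrite /gimage imset_id [RHS]surjective_pairing; congr (_, _).
rewrite -[RHS]imset_id; apply: eq_imset => e; exact: imset_id.
Qed.

Lemma gimage_comp d d' d'' (f : vertex d -> vertex d') (g : vertex d' -> vertex d'') K :
  gimage g (gimage f K) = gimage (g \o f) K.
Proof.
rewrite /gimage; congr (_, _); first exact/esym/imset_comp.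
rewrite -[LHS]imset_comp; apply: eq_imset => e /=; exact/esym/imset_comp.
Qed.

(** * Support and span of connected subgraphs *)

Section support.
Variables (d : nat) (K : cgraph d).
Hypotheses (K_cube : cube_subgraph K) (K_conn : gconnected K).

(** Follow a path from x to y: an edge along which coordinate i changes would put i in the support,
    whichever of its ends has value 0 there. *)
Lemma support_agree x y i : x \in verts K -> y \in verts K ->
  i \notin cube_support K -> x i = y i.
Proof.
have [_ conn] := gconnectedP _ K_conn.
move=> xK yK iS; have /connectP[s] := conn _ _ xK yK.
elim: s x {xK} => [|z s IH] x /=; first by move=> _ ->.
case/andP=> xz /IH h /h <-; apply/eqP; apply: contraNT iS => ne.
rewrite inE; have [xi|xi] := boolP (x i).
  apply/existsP; exists z; apply/existsP; exists x.
  rewrite finset.setUC; apply/and3P; split=> //.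
  by move: ne; rewrite xi; case: (z i).
apply/existsP; exists x; apply/existsP; exists z; apply/and3P; split=> //.
by move: ne xi; case: (x i); case: (z i).
Qed.

Lemma support_disagree i : i \in cube_support K ->
  exists x y, [/\ x \in verts K, y \in verts K, gadj K x y, ~~ x i & y i].
Proof.
rewrite inE => /existsP[x /existsP[y /and3P[xy xi yi]]]; exists x, y.
by have /andP[xK yK] := gadj_verts K_cube (xy : gadj K x y).
Qed.

Lemma proj_on_inj : {in verts K &, injective (proj_on (cube_support K))}.
Proof.
move=> x y xK yK E; apply/ffunP => i.
have [iS|iS] := boolP (i \in cube_support K); last exact: support_agree.
by have := congr1 (fun v : vertex _ => v (enum_rank_in iS i)) E;
  rewrite !ffunE enum_rankK_in.
Qed.

Lemma proj_on_adj : {in verts K &, forall x y,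
  cube_adj (proj_on (cube_support K) x) (proj_on (cube_support K) y) =
  cube_adj x y}.
Proof.
move=> x y xK yK; rewrite /cube_adj; congr (_ == _).
rewrite -(card_imset _ (@enum_val_inj _ (cube_support K))).
congr #|pred_of_set _|; apply/setP => i; apply/imsetP/idP => [[k]|].
  by rewrite inE !ffunE => ne ->; rewrite inE.
rewrite inE => ne.
have [iS|iS] := boolP (i \in cube_support K); last first.
  by rewrite (support_agree xK yK iS) eqxx in ne.
exists (enum_rank_in iS i); last by rewrite enum_rankK_in.
by rewrite inE !ffunE enum_rankK_in.
Qed.

Lemma canonical_copyE :
  canonical_copy K = Tagged cgraph (gimage (proj_on (cube_support K)) K).
Proof. by []. Qed.

Lemma cube_support_canonical :
  cube_support (gimage (proj_on (cube_support K)) K) = setT.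
Proof.
apply/setP => k; rewrite in_setT inE.
have [x [y [xK yK xy xi yi]]] := support_disagree (enum_valP k).
apply/existsP; exists (proj_on (cube_support K) x).
apply/existsP; exists (proj_on (cube_support K) y).
rewrite !ffunE xi yi !andbT.
by rewrite -[_ \in _]/(gadj _ _ _) gimage_gadj //; exact: proj_on_inj.
Qed.

Lemma nverts_le_span : (nverts K <= 2 ^ cube_span K)%N.
Proof.
rewrite -(gimage_nverts proj_on_inj); apply: leq_trans (max_card _) _.
by rewrite card_ffun card_bool card_ord.
Qed.

Let dirs (W : {set vertex d}) : {set 'I_d} :=
  [set i | [exists x in W, exists y in W, x i != y i]].

(** A maximal vertex set around x0 with fewer nonconstant coordinates than vertices is closed under
    adjacency, so it is all of V(K). The inequality bounds d * 'C(d, span) by d ^ v, the source of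
    the exponent t in the error terms. *)
Lemma span_lt_nverts : (cube_span K < nverts K)%N.
Proof.
have [[x0 x0K] conn] := gconnectedP _ K_conn.
have dirs1 : (#|dirs [set x0]| < #|[set x0]|)%N.
  rewrite cards1 ltnS leqn0 cards_eq0; apply/eqP/setP => i; rewrite inE in_set0.
  apply/negbTE/negP => /existsP[x /andP[/set1P-> /existsP[y /andP[/set1P->]]]].
  by rewrite eqxx.
(* Adjoining a neighbour to W adds at most one nonconstant coordinate. *)
pose good (W : {set vertex d}) := [&& x0 \in W, W \subset verts K & (#|dirs W| <
  #|W|)%N].
have good1 : good [set x0] by rewrite /good set11 sub1set x0K.
have [W /maxsetP[/and3P[x0W sW ltW] maxW] _] := maxset_exists good1.
suff WK : W = verts K.
  rewrite WK in ltW; apply: leq_ltn_trans ltW; apply: subset_leq_card.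
  apply/subsetP => i /support_disagree[x [y [xK yK _ xi yi]]]; rewrite inE.
  apply/existsP; exists x; rewrite xK; apply/existsP; exists y.
  by rewrite yK yi; move: xi; case: (x i).
apply/eqP; rewrite eqEsubset sW /=; apply/subsetP => y yK.
have clo : fingraph.closed (gadj K) [in W].
  suff sub u v : gadj K u v -> u \in W -> v \in W.
    by move=> u v uv; apply/idP/idP; apply: sub; rewrite // gadjC.
  move=> uv uW; have /andP[uK vK] := gadj_verts K_cube uv.
  apply: contraT => vW; suff E : v |: W = W by rewrite -E setU11 in vW.
  apply: maxW; last exact: finset.subsetUr.
  rewrite /good in_setU x0W orbT subUset sub1set vK sW cardsU1 vW add1n ltnS /=.
  have [i vE] := cube_adjP _ _ (gadj_cube K_cube uv).
  apply: leq_trans ltW; rewrite -(add1n #|dirs W|).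
  have : dirs (v |: W) \subset i |: dirs W.
    have vj j z : j != i -> z \in v |: W -> exists2 z', z' \in W & z j = z' j.
      move=> ji /setU1P[->|zW]; last by exists z.
      by exists u => //; rewrite vE ffunE (negPf ji).
    apply/subsetP => j; rewrite in_setU1; case: (eqVneq j i) => //= ji.
    rewrite !inE => /existsP[x /andP[xW /existsP[z /andP[zW ne]]]].
    have [x' x'W xE] := vj _ _ ji xW; have [z' z'W zE] := vj _ _ ji zW.
    apply/existsP; exists x'; rewrite x'W; apply/existsP; exists z'.
    by rewrite z'W -xE -zE.
  move/subset_leq_card/leq_trans; apply.
  by rewrite cardsU1 leq_add2r leq_b1.
have := closed_connect clo (conn _ _ x0K yK).
by rewrite -[x0 \in _]/(x0 \in W) -[y \in _]/(y \in W) x0W => <-.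
Qed.
End support.

(** * Placing a graph in a subcube *)

Section lift.
Variables (d : nat) (S : {set 'I_d}).
Implicit Types (a x : vertex d) (u : vertex #|S|) (U : cgraph #|S|).

(** The section of [proj_on S] onto the subcube whose coordinates outside S are frozen at those of
    a; the values of a on S are ignored. *)
Definition lift_on a u : vertex d :=
  [ffun i => if [pick k | enum_val k == i] is Some k then u k else a i].

Lemma lift_on_val a u k : lift_on a u (enum_val k) = u k.
Proof.
rewrite ffunE; case: pickP => [k' /eqP/enum_val_inj->//|/(_ k)].
by rewrite eqxx.
Qed.

Lemma lift_on_out a u i : i \notin S -> lift_on a u i = a i.
Proof.
move=> iS; rewrite ffunE; case: pickP => // k /eqP E.
by rewrite -E enum_valP in iS.
Qed.

Lemma lift_onK a : cancel (lift_on a) (proj_on S).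
Proof. by move=> u; apply/ffunP => k; rewrite ffunE lift_on_val. Qed.

Lemma lift_on_eq a u x : (forall i, i \notin S -> a i = x i) ->
  u = proj_on S x -> lift_on a u = x.
Proof.
move=> ax ->; apply/ffunP => i; have [iS|iS] := boolP (i \in S).
  by rewrite -(enum_rankK_in iS iS) lift_on_val ffunE.
by rewrite lift_on_out // ax.
Qed.

Lemma lift_on_adj a u v : cube_adj (lift_on a u) (lift_on a v) = cube_adj u v.
Proof.
rewrite /cube_adj; congr (_ == _).
rewrite -[in RHS](card_imset _ (@enum_val_inj _ S)).
congr #|pred_of_set _|; apply/setP => i; apply/idP/imsetP => [|[k]]; last first.
  by rewrite !in_set => ne ->; rewrite !lift_on_val.
rewrite inE; have [iS|iS] := boolP (i \in S); last by rewrite !lift_on_out ?eqxx.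
rewrite -(enum_rankK_in iS iS) !lift_on_val => ne.
by exists (enum_rank_in iS i) => //; rewrite in_set.
Qed.

Section with_graph.
Variables (U : cgraph #|S|) (a : vertex d).
Hypotheses (U_cube : cube_subgraph U) (U_conn : gconnected U)
  (U_full : cube_support U = setT).

Let inj : {in verts U &, injective (lift_on a)}.
Proof. by move=> u v _ _; exact: (can_inj (lift_onK a)). Qed.
Let adj : {in verts U &, forall u v, cube_adj (lift_on a u) (lift_on a v) = cube_adj u
  v}.
Proof. by move=> u v _ _; exact: lift_on_adj. Qed.

Lemma lift_cube : cube_subgraph (gimage (lift_on a) U).
Proof. exact: gimage_cube. Qed.

Lemma lift_connected : gconnected (gimage (lift_on a) U).
Proof. exact: gimage_connected. Qed.

Lemma lift_support : cube_support (gimage (lift_on a) U) = S.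
Proof.
apply/setP => i; apply/idP/idP => [|iS].
  move/(support_disagree lift_cube) => [_ [_ [/imsetP[u _ ->] /imsetP[v _ ->] _]]].
  have [//|iS] := boolP (i \in S); rewrite !lift_on_out //.
  by case: (a i).
have := in_setT (enum_rank_in iS i); rewrite -U_full.
move/(support_disagree U_cube) => [u [v [uU vU uv ui vi]]].
rewrite inE; apply/existsP; exists (lift_on a u); apply/existsP; exists (lift_on a v).
have Eu := lift_on_val a u (enum_rank_in iS i).
have Ev := lift_on_val a v (enum_rank_in iS i).
rewrite enum_rankK_in // in Eu Ev; rewrite Eu Ev ui vi !andbT.
by rewrite -[_ \in _]/(gadj _ _ _) gimage_gadj.
Qed.

Lemma proj_lift : gimage (proj_on S) (gimage (lift_on a) U) = U.
Proof.
rewrite gimage_comp -[RHS]gimage_id; apply: eq_in_gimage => // u _.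
exact: lift_onK.
Qed.
End with_graph.

Lemma lift_inj (U : cgraph #|S|) a b : gconnected U ->
  gimage (lift_on a) U = gimage (lift_on b) U ->
  forall i, i \notin S -> a i = b i.
Proof.
move=> /gconnectedP[[u uU] _] /(congr1 (@verts d)) E i iS.
have : lift_on a u \in verts (gimage (lift_on b) U) by rewrite -E imset_f.
by case/imsetP=> v _ /ffunP/(_ i); rewrite !lift_on_out.
Qed.
End lift.
Arguments lift_on {d} S a u.

Lemma lift_proj d (K : cgraph d) (a : vertex d) (S : {set 'I_d}) :
  cube_support K = S -> cube_subgraph K -> gconnected K ->
  (exists2 x, x \in verts K & forall i, i \notin S -> a i = x i) ->
  gimage (lift_on S a) (gimage (proj_on S) K) = K.
Proof.
move=> <- cK conn [x xK ax]; rewrite gimage_comp -[RHS]gimage_id.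
apply: eq_in_gimage => // y yK /=; apply: lift_on_eq => // i iS.
by rewrite ax //; exact: support_agree iS.
Qed.

(** * Counting copies *)

Definition copies d n (H : cgraph n) : {set cgraph d} :=
  [set K | [&& cube_subgraph K, gconnected K & ambient_iso K H]].

Section copies.
Variables (n : nat) (H : cgraph n) (d : nat).
Hypotheses (H_cube : cube_subgraph H) (H_conn : gconnected H).
Implicit Types (K : cgraph d) (S : {set 'I_d}).

Lemma copiesP K : reflect [/\ cube_subgraph K, gconnected K &
  canonical_copy K = canonical_copy H] (K \in copies d H).
Proof. by rewrite inE; apply: (iffP and3P) => -[h1 h2 /eqP h3]. Qed.

(** Equal canonical copies are equal pairs of a dimension and a graph. A quantity defined in all
    dimensions and unchanged by projection passes through this equality without a cast. *)
Lemma copies_invariant (T : Type) (f : forall m, cgraph m -> T) K :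
  (forall m (G : cgraph m), cube_subgraph G -> gconnected G ->
     f _ (gimage (proj_on (cube_support G)) G) = f _ G) ->
  K \in copies d H -> f d K = f n H.
Proof.
move=> fE /copiesP[cK conn E]; rewrite -fE // -[RHS]fE //.
exact: (congr1 (fun u : {s & cgraph s} => f (tag u) (tagged u)) E).
Qed.

Lemma copies_nverts K : K \in copies d H -> nverts K = nverts H.
Proof.
apply: (copies_invariant (f := nverts)) => m G cG conn.
by apply: gimage_nverts; exact: proj_on_inj.
Qed.

Lemma copies_nedges K : K \in copies d H -> nedges K = nedges H.
Proof.
apply: (copies_invariant (f := nedges)) => m G cG conn.
by apply: gimage_nedges => //; exact: proj_on_inj.
Qed.

Lemma copies_nmissing K : K \in copies d H -> nmissing K = nmissing H.
Proof.
apply: (copies_invariant (f := nmissing)) => m G cG conn.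
by apply: gimage_nmissing => //; [exact: proj_on_inj|exact: proj_on_adj].
Qed.

Lemma copies_span K : K \in copies d H -> #|cube_support K| = cube_span H.
Proof. by move=> /copiesP[_ _ E]; have := congr1 tag E. Qed.

(** The canonical copy retyped in dimension [#|S|], so that it can be lifted along S; eliminating
    the equality of dimensions on a generalised pair avoids a transport in later statements. *)
Lemma canonical_on S : #|S| = cube_span H ->
  exists U : cgraph #|S|, [/\ canonical_copy H = Tagged cgraph U,
    cube_subgraph U, gconnected U & cube_support U = setT].
Proof.
move=> cS; pose u := canonical_copy H.
have : [/\ tag u = #|S|, cube_subgraph (tagged u), gconnected (tagged u) &
        cube_support (tagged u) = setT].
  split=> //.
  - by apply: gimage_cube => //; [exact: proj_on_inj|exact: proj_on_adj].
  - by apply: gimage_connected => //; exact: proj_on_inj.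
  - exact: cube_support_canonical.
rewrite -/u; case: u => m U /= [E]; case: _ / E in U * => h1 h2 h3.
by exists U.
Qed.

Lemma in_copies_support S (U : cgraph #|S|) K :
  canonical_copy H = Tagged cgraph U -> cube_support K = S ->
  (K \in copies d H) =
  [&& cube_subgraph K, gconnected K & gimage (proj_on S) K == U].
Proof.
move=> HU KS; rewrite inE /ambient_iso HU; do 2!congr (_ && _).
by move: KS U {HU} => <- U; rewrite canonical_copyE eq_Tagged.
Qed.

(** Both copies project to the same graph on the common support, and the shared vertex fixes the
    coordinates outside it. *)
Lemma copies_eq K K' x : K \in copies d H -> K' \in copies d H ->
  x \in verts K -> x \in verts K' -> cube_support K = cube_support K' ->
  K = K'.
Proof.
move=> KH K'H xK xK' E.
have [U [HU _ _ _]] := canonical_on (copies_span KH).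
move: (KH); rewrite (in_copies_support HU erefl) => /and3P[cK conn /eqP KU].
move: K'H; rewrite (in_copies_support HU (esym E)) => /and3P[cK' conn' /eqP K'U].
rewrite -(@lift_proj _ K x _ erefl cK conn); last by exists x.
by rewrite KU -K'U (@lift_proj _ K' x _ (esym E) cK' conn') //; exists x.
Qed.

Lemma card_copies_support S : #|S| = cube_span H ->
  #|[set K in copies d H | cube_support K == S]| = (2 ^ (d - cube_span H))%N.
Proof.
move=> cS; have [U [HU cU connU fullU]] := canonical_on cS.
have copyE K : cube_support K = S -> (K \in copies d H) =
    [&& cube_subgraph K, gconnected K & gimage (proj_on S) K == U].
  exact: in_copies_support HU.
pose A := [set a : vertex d | [forall i in S, ~~ a i]].
have AP (a : vertex d) : reflect (forall i, i \in S -> ~~ a i) (a \in A).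
  by rewrite inE; apply: (iffP forall_inP).
have -> : [set K in copies d H | cube_support K == S] =
    (fun a => gimage (lift_on S a) U) @: A.
  apply/setP => K; rewrite in_set; apply/andP/imsetP => [[KH /eqP KS]|[a aA ->]].
    move: KH; rewrite copyE // => /and3P[cK connK /eqP KU].
    have [[x xK] _] := gconnectedP _ connK.
    pose a : vertex d := [ffun i => (i \notin S) && x i].
    exists a; first by apply/AP => i iS; rewrite ffunE iS.
    rewrite -KU lift_proj //; exists x => // i iS.
    by rewrite ffunE iS.
  have KS := lift_support a cU fullU.
  by rewrite KS copyE // lift_cube // lift_connected // proj_lift // !eqxx.
rewrite card_in_imset; last first.
  move=> a b /AP aA /AP bA /(lift_inj connU) ab; apply/ffunP => i.
  have [iS|/ab//] := boolP (i \in S).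
  by rewrite (negPf (aA _ iS)) (negPf (bA _ iS)).
have -> : (d - cube_span H = #|~: S|)%N.
  by rewrite -cS; apply: (canLR (addnK _)); rewrite addnC cardsC card_ord.
transitivity #|pffun_on false (mem (~: S)) (predT : pred bool)|; last first.
  by rewrite card_pffun_on card_bool.
apply: eq_card => a; apply/AP/pffun_onP => [aS|[/supportP aS _] i iS].
  split=> //; apply/supportP => i; rewrite in_setC negbK => /aS.
  exact: negbTE.
by rewrite aS // in_setC negbK.
Qed.

Lemma card_copies :
  #|copies d H| = ('C(d, cube_span H) * 2 ^ (d - cube_span H))%N.
Proof.
rewrite -[in 'C(d, _)](card_ord d) -card_draws -sum_nat_const.
rewrite -sum1_card (partition_big (@cube_support d)
  [in [set S : {set 'I_d} | #|S| == cube_span H]]) /=; last first.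
  by move=> K /copies_span cK; rewrite inE cK.
apply: eq_bigr => S; rewrite inE => /eqP cS.
rewrite -(card_copies_support cS) -sum1_card; apply: eq_bigl => K.
exact/esym/in_set.
Qed.

(** By [copies_eq], each support carries at most one copy through x. *)
Lemma copies_at x :
  (#|[set K in copies d H | x \in verts K]| <= 'C(d, cube_span H))%N.
Proof.
rewrite -[in 'C(d, _)](card_ord d) -card_draws.
rewrite -(@card_in_imset _ _ (@cube_support d)); last first.
  move=> K K'; rewrite [K \in _]in_set [K' \in _]in_set => /andP[KH xK] /andP[K'H xK'].
  exact: (copies_eq KH K'H xK xK').
apply: subset_leq_card; apply/subsetP => S /imsetP[K].
by rewrite [K \in _]in_set => /andP[/copies_span cK _] ->; rewrite inE cK.
Qed.
End copies.

(** * Copies as components *)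

Lemma card_bigcup_le (I T : finType) (A : {pred I}) (F : I -> {set T}) :
  (#|\bigcup_(i in A) F i| <= \sum_(i in A) #|F i|)%N.
Proof.
apply: (big_ind2 (fun (S : {set T}) m => (#|S| <= m)%N)) => [|S1 n1 S2 n2 h1 h2|//].
  by rewrite cards0.
exact: leq_trans (leq_card_setU _ _) (leq_add h1 h2).
Qed.

Section weight_bounds.
Variables (R : realType) (T : finType) (p : R).
Hypotheses (p_gt0 : 0 < p) (p_le : p <= 1 - p).
Implicit Types (A D E : {set T}).

Let q_gt0 : 0 < 1 - p. Proof. exact: lt_le_trans p_gt0 p_le. Qed.

Lemma subset_weight_ge0 E A : 0 <= subset_weight p E A.
Proof. by apply: mulr_ge0; apply: exprn_ge0; apply: ltW. Qed.

Lemma subset_weight_lb E A : A \subset E -> p ^+ #|E| <= subset_weight p E A.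
Proof.
move=> sAE; rewrite -(cardsID A E) (setIidPr sAE) exprD /subset_weight.
by rewrite ler_pM2l ?exprn_gt0 // lerXn2r ?nnegrE ?(ltW p_gt0) ?(ltW q_gt0).
Qed.

(** Since p <= 1 - p, a prescribed state of one edge, present or absent, has probability at least p;
    so dropping the edges of D gains at most one factor 1/p for each. *)
Lemma subset_weight_setD D E A : A \subset E ->
  p ^+ #|D :&: E| * subset_weight p (E :\: D) (A :\: D) <= subset_weight p E A.
Proof.
move=> sAE.
have E1 : E :\: D = E :\: (E :&: D) by rewrite setDIr setDv set0U.
rewrite -[A in leRHS](setID A D) (@subset_weightU _ _ _ (E :&: D)).
- rewrite -E1 ler_wpM2r ?subset_weight_ge0 // finset.setIC.
  by apply: subset_weight_lb; rewrite setSI.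
- exact: subsetIl.
- exact: setSI.
- by rewrite -E1 setSD.
Qed.
End weight_bounds.

Section random_cube.
Variables (R : realType) (p : R) (d : nat).
Hypotheses (p_gt0 : 0 < p) (p_lt_half : p < 1 / 2).
Implicit Types (K : cgraph d) (F : {set {set vertex d}}).
Local Notation q := (1 - p).

Let p_le : p <= q. Proof. by have h := p_lt_half; lra. Qed.
Let q_gt0 : 0 < q. Proof. exact: lt_le_trans p_gt0 p_le. Qed.

(* For a connected cube subgraph K and F in the cube this says that K is a
   component; stated this way it depends on F only through the edges incident
   to K, for every F. *)
Definition isolated K F : bool := F :&: incident (verts K) == edges K.

Definition nearby K K' : bool :=
  [exists x in verts K, exists y in verts K', (x == y) || cube_adj x y].

Definition isolation_prob K : R := Ex p (fun F => (isolated K F)%:R).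

Lemma sub_edges_incident K : cube_subgraph K ->
  edges K \subset incident (verts K).
Proof.
move=> cK; apply/subsetP => e eK; have [eE eV] := edges_cube cK eK.
rewrite in_incident eE (setIidPl eV) /= -card_gt0.
by rewrite (card_cube_edge eE).
Qed.

(** There are d v - (e + e') incident edges, of which e must be present. This is the origin of the
    factors (p / q^2)^e and (1 / q)^e' of beta. *)
Lemma card_incident_edges K : cube_subgraph K ->
  (#|incident (verts K) :\: edges K| + (2 * nedges K + nmissing K) = d * nverts K)%N.
Proof.
move=> cK; rewrite -card_incident cardsD.
rewrite (setIidPr (sub_edges_incident cK)).
have -> : #|[set e in cube_edges d | e \subset verts K]| = (nedges K + nmissing K)%N.
  rewrite -(cardsID (edges K)); congr (_ + _)%N.
    congr #|pred_of_set _|; apply/setP => e.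
    rewrite in_setI in_cube_edges_if; have [eK|] := boolP (e \in edges K).
      by have [-> ->] := edges_cube cK eK.
    by rewrite andbF.
  congr #|pred_of_set _|; apply/setP => e.
  by rewrite in_setD !in_cube_edges_if andbC -andbA.
have := subset_leq_card (sub_edges_incident cK); rewrite /nedges; lia.
Qed.

Lemma isolation_probE K : cube_subgraph K -> isolation_prob K =
  p ^+ nedges K * q ^+ (d * nverts K) / q ^+ (2 * nedges K + nmissing K).
Proof.
move=> cK; rewrite -(card_incident_edges cK) exprD mulrA mulfK; last first.
  by rewrite expf_neq0 // gt_eqF.
have := @subset_mean_cylinder R _ p _ _ _ (sub_incident (verts K)) (sub_edges_incident
  cK).
by [].
Qed.

Lemma near_refl K : gconnected K -> nearby K K.
Proof.
move=> /gconnectedP[[x xK] _]; apply/existsP; exists x; rewrite xK.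
by apply/existsP; exists x; rewrite xK eqxx.
Qed.

Lemma far_incident K K' : ~~ nearby K K' ->
  [disjoint incident (verts K) & incident (verts K')].
Proof.
apply: contraNT; rewrite -setI_eq0 => /set0Pn[e].
rewrite in_setI !in_incident => /andP[/andP[eE /set0Pn[x]]].
rewrite in_setI => /andP[xe xK] /andP[_ /set0Pn[y]].
rewrite in_setI => /andP[ye yK'].
apply/existsP; exists x; rewrite xK; apply/existsP; exists y; rewrite yK' /=.
have [z xz E] := cube_edge_other eE xe; move: ye; rewrite E in_set2 eq_sym.
by case/orP=> [->//|/eqP->]; rewrite xz orbT.
Qed.

(** If K and K' share a vertex they cannot both be components. Otherwise drop from the condition on
    K' the edges incident to K: the rest is independent of the condition on K, and only the at most
    v v' common edges were lost, at a factor of at most 1/p each. *)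
Lemma isolated2_bound K K' : cube_subgraph K -> gconnected K ->
  cube_subgraph K' -> gconnected K' -> K' != K ->
  p ^+ (nverts K * nverts K') *
    Ex p (fun F => (isolated K F && isolated K' F)%:R) <=
  isolation_prob K * isolation_prob K'.
Proof.
move=> cK connK cK' connK' ne.
have pr_ge0 L : 0 <= isolation_prob L.
  by apply: sumr_ge0 => F _; rewrite mulr_ge0 // subset_weight_ge0.
have [dV|] := boolP [disjoint verts K & verts K']; last first.
  rewrite -setI_eq0 => /set0Pn[x]; rewrite in_setI => /andP[xK xK'].
  rewrite [Ex _ _]big1 ?mulr0 ?mulr_ge0 // => F; rewrite powersetE => sF.
  rewrite /isolated -!components_isolated //.
  case: andP => [[KF K'F]|]; last by rewrite mulr0.
  by rewrite (components_meet KF K'F xK xK') eqxx in ne.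
set D := incident (verts K); set D' := incident (verts K').
have sD : D \subset cube_edges d := sub_incident _.
have sD' : D' :\: D \subset cube_edges d.
  by apply: subset_trans (sub_incident (verts K')); exact: subsetDl.
have bound : Ex p (fun F => (isolated K F && isolated K' F)%:R) <=
    isolation_prob K * subset_weight p (D' :\: D) (edges K' :\: D).
  rewrite -(@subset_mean_cylinder R _ p _ _ _ sD') ?setSD ?sub_edges_incident //.
  rewrite -[X in _ <= X * _]/(subset_mean p (cube_edges d) (fun F => (isolated K
    F)%:R)).
  rewrite -(subset_mean_indep _ sD).
  - apply: ler_sum => F _; rewrite ler_wpM2l ?subset_weight_ge0 //.
    have imp : isolated K' F -> F :&: (D' :\: D) == edges K' :\: D.
      by move=> /eqP <-; rewrite setIDA.
    rewrite -natrM mulnb ler_nat; case: (isolated K F) => //=.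
    by case: (boolP (isolated K' F)) => [/imp ->|].
  - by move=> F; rewrite /isolated -setIA finset.setIid.
  - move=> F; congr (_ == _)%:R; apply/setP => e.
    by rewrite !(in_setI, in_setD); case: (e \in D); rewrite ?andbF.
apply: le_trans (ler_wpM2l _ bound) _; first by rewrite exprn_ge0 // ltW.
rewrite mulrCA ler_wpM2l //.
have -> : isolation_prob K' = subset_weight p D' (edges K').
  exact: (subset_mean_cylinder _ (sub_incident _) (sub_edges_incident cK')).
apply: le_trans (subset_weight_setD p_gt0 p_le D (sub_edges_incident cK')).
rewrite ler_wpM2r ?subset_weight_ge0 // ler_wiXn2l ?ltW //;
  first by have h := p_lt_half; lra.
exact: incident_meet.
Qed.

Lemma card_near n (H : cgraph n) K : cube_subgraph H -> gconnected H ->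
  (#|[set K' in copies d H | nearby K K']| <=
     nverts K * d.+1 * 'C(d, cube_span H))%N.
Proof.
move=> cH connH.
pose N := \bigcup_(x in verts K) [set y | (x == y) || cube_adj x y].
have cN : (#|N| <= nverts K * d.+1)%N.
  rewrite /nverts -sum_nat_const; apply: leq_trans (card_bigcup_le _ _) _.
  apply: leq_sum => x _.
  rewrite (_ : [set y | _] = x |: [set y | cube_adj x y]); last first.
    by apply/setP => y; rewrite !inE eq_sym.
  by rewrite cardsU1 card_neighbours -add1n leq_add2r leq_b1.
apply: leq_trans (leq_mul cN (leqnn _)).
apply: (@leq_trans #|\bigcup_(y in N) [set K' in copies d H | y \in verts K']|).
  apply: subset_leq_card; apply/subsetP => K'; rewrite [K' \in _]in_set.
  case/andP=> K'H /existsP[x /andP[xK /existsP[y /andP[yK' xy]]]].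
  apply/bigcupP; exists y; last by rewrite [K' \in _]in_set K'H.
  by apply/bigcupP; exists x; rewrite ?inE.
rewrite -sum_nat_const; apply: leq_trans (card_bigcup_le _ _) _.
by apply: leq_sum => y _; exact: copies_at.
Qed.
End random_cube.

(** * The family of all copies of the given graphs *)

Section copies_family.
Variables (R : realType) (p : R) (r : nat) (n : 'I_r -> nat).
Variable H : forall i : 'I_r, cgraph (n i).
Hypotheses (p_gt0 : 0 < p) (p_lt_half : p < 1 / 2)
  (H_cube : forall i, cube_subgraph (H i))
  (H_conn : forall i, gconnected (H i))
  (H_noniso : forall i j, i != j -> ~~ ambient_iso (H i) (H j)).
Variable d : nat.
Local Notation q := (1 - p).

Definition all_copies : {set cgraph d} := \bigcup_i copies d (H i).

Lemma all_copiesP K :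
  reflect (exists i, K \in copies d (H i)) (K \in all_copies).
Proof. by apply: (iffP bigcupP) => [[i _]|[i]]; exists i. Qed.

Lemma copies_disjoint i j K :
  K \in copies d (H i) -> K \in copies d (H j) -> i = j.
Proof.
move=> /copiesP[_ _ Ei] /copiesP[_ _ Ej]; apply/eqP.
by apply: contraT => /H_noniso; rewrite /ambient_iso -Ei -Ej eqxx.
Qed.

Lemma big_all_copies (V : Type) (idx : V) (op : Monoid.com_law idx)
    (f : cgraph d -> V) :
  \big[op/idx]_(K in all_copies) f K =
  \big[op/idx]_(i < r) \big[op/idx]_(K in copies d (H i)) f K.
Proof.
rewrite (exchange_big_dep [in all_copies]) /=; last first.
  by move=> i K _ KH; apply/all_copiesP; exists i.
apply: eq_bigr => K /all_copiesP[i Ki].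
rewrite (big_pred1 i) // => j; apply/idP/eqP => [Kj|->//].
exact: copies_disjoint Kj Ki.
Qed.

Definition copy_prob (i : 'I_r) : R :=
  p ^+ nedges (H i) * q ^+ (d * nverts (H i)) /
  q ^+ (2 * nedges (H i) + nmissing (H i)).

Lemma isolation_prob_copy i K : K \in copies d (H i) ->
  isolation_prob p K = copy_prob i.
Proof.
move=> KH; have /copiesP[cK _ _] := KH; rewrite isolation_probE //.
by rewrite (copies_nverts _ _ KH) ?(copies_nedges _ _ KH) ?(copies_nmissing _ _ KH).
Qed.

Lemma comp_count_isolated F : F \in powerset (cube_edges d) ->
  (\sum_(i < r) comp_count (H i) F)%N =
  count_in all_copies (@isolated d) F.
Proof.
rewrite powersetE => sF; rewrite /count_in big_all_copies.
apply: eq_bigr => i _; rewrite /comp_count -sum1_card big_mkcond [RHS]big_mkcond.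
apply: eq_bigr => K _; rewrite [K \in [set _ in _ | _]]in_set.
rewrite [K \in copies _ _]in_set; case: (boolP (ambient_iso K (H i))); last first.
  by rewrite !andbF.
rewrite !andbT => _; have [|ncK] := boolP (cube_subgraph K && gconnected K).
  by case/andP=> cK connK; rewrite components_isolated //; case: isolated.
by case: ifP => // /(components_cube sF); rewrite (negPf ncK).
Qed.

Lemma mean_isolated_count :
  Ex p (fun F : {set {set vertex d}} => (\sum_(i < r) comp_count (H i) F)%:R) =
  \sum_(i < r) #|copies d (H i)|%:R * copy_prob i.
Proof.
transitivity (mean (powerset (cube_edges d)) (weight p (d:=d))
  (fun F => (count_in all_copies (@isolated d) F)%:R : R)).
  by apply: eq_bigr => F FE; rewrite comp_count_isolated.
rewrite mean_count big_all_copies; apply: eq_bigr => i _.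
rewrite mulrC mulr_natr -sumr_const; apply: eq_bigr => K KH.
exact: isolation_prob_copy KH.
Qed.

Lemma copies_expectation i :
  #|copies d (H i)|%:R * copy_prob i =
  beta_coef p (cube_span (H i)) (H i) * (d ^_ cube_span (H i))%:R *
    (2 * q ^+ nverts (H i)) ^+ d.
Proof.
have q0 : q != 0 by rewrite gt_eqF //; have h := p_lt_half; lra.
rewrite card_copies // /copy_prob /beta_coef; set s := cube_span _.
set e := nedges _; set m := nmissing _.
rewrite [(2 * _) ^+ d]exprMn -[(q ^+ nverts _) ^+ d]exprM [(nverts _ * d)%N]mulnC.
(* For d < s both sides vanish, whereas the truncated exponent d - s would spoil the computation. *)
have [sd|ds] := leqP s d; last first.
  by rewrite bin_small // ffact_small // mul0n !(mul0r, mulr0).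
have alg (N a P Q A B f b : R) : A != 0 -> B != 0 -> f != 0 -> b != 0 ->
    N * a * (P * Q / (A * B)) =
    1 / (b * f) * (P / A) * (1 / B) * (N * f) * (a * b * Q).
  by move=> A0 B0 f0 b0; field; rewrite A0 B0 f0 b0.
have -> : (p / q ^+ 2) ^+ e = p ^+ e / q ^+ (2 * e).
  by rewrite expr_div_n -exprM.
have -> : (1 / q) ^+ m = 1 / q ^+ m by rewrite expr_div_n expr1n.
have -> : 2 ^+ d = 2 ^+ (d - s) * 2 ^+ s :> R by rewrite -exprD subnK.
rewrite -bin_ffact !natrM !natrX exprD.
by apply: alg; rewrite ?expf_neq0 ?pnatr_eq0 // -lt0n fact_gt0.
Qed.

(** S bounds the expected number of isolated copies near any fixed copy. So the products of
    probabilities sum to at most S times the mean, and [isolated2_bound] reduces the joint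
    probabilities to these products at the cost of the inverse power of p. *)
Lemma dependence_all_copies (M : nat) : (forall i, (nverts (H i) <= M)%N) ->
  dependence_bound (powerset (cube_edges d)) (weight p (d:=d))
    all_copies (@isolated d) (@nearby d) <=
  (1 + (p ^+ (M * M))^-1) *
    (\sum_(i < r) (M * d.+1 * 'C(d, cube_span (H i)))%:R * copy_prob i) *
  Ex p (fun F : {set {set vertex d}} => (\sum_(i < r) comp_count (H i) F)%:R).
Proof.
move=> leM; set S := \sum_(i < r) _.
have pr0 (K : cgraph d) : 0 <= isolation_prob p K.
  apply: sumr_ge0 => F _; rewrite mulr_ge0 //.
  by apply: subset_weight_ge0 => //; have h := p_lt_half; lra.
have nearS K : K \in all_copies ->
    \sum_(j in all_copies | nearby K j) isolation_prob p j <= S.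
  case/all_copiesP=> i0 Ki0; rewrite big_mkcondr big_all_copies.
  apply: ler_sum => i _; rewrite -big_mkcondr.
  rewrite (eq_bigr (fun=> copy_prob i)); last first.
    by move=> j /andP[jH _]; exact: isolation_prob_copy jH.
  rewrite big_const iter_addr_0 -[leLHS]mulr_natl; apply: ler_wpM2r.
    have := pr0 K.
    have q0 : 0 < q by have h := p_lt_half; lra.
    by move=> _; rewrite divr_ge0 ?mulr_ge0 ?exprn_ge0 // ltW.
  rewrite ler_nat -[X in (X <= _)%N]cardsE.
  apply: leq_trans (@card_near d _ (H i) K (H_cube i) (H_conn i)) _.
  by rewrite !leq_mul2r (copies_nverts _ _ Ki0) // leM !orbT.
rewrite [leRHS](_ : _ = \sum_(K in all_copies)
    isolation_prob p K * ((1 + (p ^+ (M * M))^-1) * S)); last first.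
  rewrite -big_distrl mulrC; congr (_ * _).
  rewrite mean_isolated_count big_all_copies; apply: eq_bigr => i _.
  rewrite mulrC mulr_natr -sumr_const; apply: eq_bigr => K KH.
  exact/esym/isolation_prob_copy.
apply: ler_sum => K KH; rewrite mulrDl mul1r mulrDr; apply: lerD.
  by apply: ler_wpM2l; [exact: pr0 | exact: nearS].
rewrite mulrCA mulrA; apply: le_trans (ler_wpM2l _ (nearS K KH)); last first.
  by rewrite mulr_ge0 ?invr_ge0 ?exprn_ge0 // ltW.
rewrite big_distrr /=.
rewrite [leRHS](bigID (fun j => j != K)) /=; apply: ler_wpDr.
  by apply: sumr_ge0 => j _; rewrite !mulr_ge0 ?invr_ge0 ?exprn_ge0 // ltW.
rewrite (eq_bigl (fun j => (j \in all_copies) && nearby K j && (j != K))); last first.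
  by move=> j; rewrite andbA.
apply: ler_sum => j /andP[/andP[jH _] jK].
have [i Ki] := all_copiesP _ KH; have [i' ji] := all_copiesP _ jH.
have /copiesP[cK connK _] := Ki; have /copiesP[cj connj _] := ji.
rewrite -mulrA mulrC ler_pdivlMr ?exprn_gt0 // mulrC.
apply: le_trans (isolated2_bound p_gt0 p_lt_half cK connK cj connj jK).
apply: ler_wpM2r.
  apply: sumr_ge0 => F _; rewrite mulr_ge0 //.
  by apply: subset_weight_ge0 => //; have h := p_lt_half; lra.
apply: ler_wiXn2l; rewrite ?ltW //; first by have h := p_lt_half; lra.
by apply: leq_mul; [rewrite (copies_nverts _ _ Ki) | rewrite (copies_nverts _ _ ji)].
Qed.

End copies_family.

(** * The Poisson distribution *)

Local Open Scope classical_set_scope.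

Section poisson.
Variables (R : realType) (l : R).
Hypothesis l_gt0 : 0 < l.
Local Notation pmf := (poisson_pmf l).

Lemma poisson_pmfE k : pmf k = l ^+ k / k`!%:R * expR (- l).
Proof. by rewrite /poisson_pmf l_gt0. Qed.

Lemma poisson_pmf_gt0 k : 0 < pmf k.
Proof.
by rewrite poisson_pmfE mulr_gt0 ?expR_gt0 // divr_gt0 ?exprn_gt0 // ltr0n fact_gt0.
Qed.

Lemma poisson_pmfS k : k.+1%:R * pmf k.+1 = l * pmf k.
Proof.
rewrite !poisson_pmfE factS natrM exprS.
have k0 : k.+1%:R != 0 :> R by rewrite pnatr_eq0.
have f0 : k`!%:R != 0 :> R by rewrite pnatr_eq0 -lt0n fact_gt0.
by move: k0 f0; move: (k.+1%:R : R) (k`!%:R : R) => a b a0 b0; field; rewrite b0 a0.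
Qed.

Lemma sum_exp_coeff_le (x : R) N : 0 <= x ->
  \sum_(k < N) x ^+ k / k`!%:R <= expR x.
Proof.
move=> x0; rewrite -(big_mkord xpredT (fun k => x ^+ k / k`!%:R)).
apply: (@nondecreasing_cvgn_le R (series (exp_coeff x))).
  by apply: nondecreasing_series => k _ _; exact: exp_coeff_ge0.
exact: is_cvg_series_exp_coeff.
Qed.

(** The probability of a value strictly below N; the distribution function at k is therefore taken
    at k.+1. *)
Definition poisson_sum N : R := \sum_(k < N) pmf k.

Lemma poisson_sum_le1 N : poisson_sum N <= 1.
Proof.
rewrite /poisson_sum (eq_bigr _ (fun k _ => poisson_pmfE _)) -big_distrl /=.
by rewrite -[leRHS](expRxMexpNx_1 l) ler_wpM2r ?expR_ge0 // sum_exp_coeff_le // ltW.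
Qed.

Lemma poisson_sumS N : poisson_sum N.+1 = poisson_sum N + pmf N.
Proof. exact: big_ord_recr. Qed.

Lemma poisson_sum_mono M N : (M <= N)%N -> poisson_sum M <= poisson_sum N.
Proof.
move=> /subnKC <-; elim: (N - M)%N => [|n IH]; first by rewrite addn0.
by rewrite addnS poisson_sumS (le_trans IH) // lerDl ltW ?poisson_pmf_gt0.
Qed.

Lemma poisson_sum_cvg (e : R) : 0 < e -> exists N, 1 - e <= poisson_sum N.
Proof.
move=> e0; have e1 : 0 < e * expR l by rewrite mulr_gt0 // expR_gt0.
have /cvgrPdist_le /(_ _ e1) [N _ /(_ N (leqnn N))] :=
  @is_cvg_series_exp_coeff R l.
rewrite -/(expR l) => h; exists N.
have -> : poisson_sum N = series (exp_coeff l) N * expR (- l).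
  rewrite /series /= big_mkord big_distrl /=; apply: eq_bigr => k _.
  exact: poisson_pmfE.
move: h; rewrite ler_norml => /andP[_ h].
rewrite expRN ler_pdivlMr ?expR_gt0 //.
by rewrite mulrBl mul1r lerBlDr -lerBlDl.
Qed.

(** For Z Poisson, [poisson_pmfS] gives E[Z; Z <= k] = l P(Z < k), and Z <= k on this event. *)
Lemma poisson_sum_mean k : l * poisson_sum k <= k%:R * poisson_sum k.+1.
Proof.
elim: k => [|k IH]; first by rewrite mul0r /poisson_sum big_ord0 mulr0.
rewrite poisson_sumS mulrDr -poisson_pmfS (poisson_sumS k.+1) mulrDr lerD2r.
apply: le_trans IH _; rewrite ler_wpM2r ?ler_nat //.
by apply: sumr_ge0 => i _; exact: poisson_pmf_ge0.
Qed.

(** Likewise E[Z; Z > k] = l P(Z >= k), and Z >= k there. The two inequalities give the signs in the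
    Lipschitz bound for the Stein solution. *)
Lemma poisson_tail_mean k :
  k%:R * (1 - poisson_sum k.+1) <= l * (1 - poisson_sum k).
Proof.
have step m : k%:R * (poisson_sum (k + m).+1 - poisson_sum k.+1) <=
    l * (poisson_sum (k + m) - poisson_sum k).
  elim: m => [|m IH]; first by rewrite addn0 !subrr !mulr0.
  rewrite addnS [poisson_sum (k + m).+2]poisson_sumS.
  rewrite [X in _ <= l * (X - _)]poisson_sumS.
  rewrite ![_ + pmf _ - _]addrAC [leLHS]mulrDr [leRHS]mulrDr lerD //.
  rewrite -poisson_pmfS ler_wpM2r ?poisson_pmf_ge0 // ler_nat.
  by rewrite ltnW // ltnS leq_addr.
apply/ler_addgt0Pr => e e0.
(* The truncation error gets multiplied by k; dividing by k.+1 also allows k = 0. *)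
have e1 : 0 < e / k.+1%:R by rewrite divr_gt0.
have [N hN] := poisson_sum_cvg e1.
have hm : 1 - e / k.+1%:R <= poisson_sum (k + N).+1.
  by apply: le_trans hN _; apply: poisson_sum_mono; rewrite ltnW // ltnS leq_addl.
have h1 : k%:R * (1 - poisson_sum k.+1) - e <=
          k%:R * (poisson_sum (k + N).+1 - poisson_sum k.+1).
  have g1 : k%:R * (1 - e / k.+1%:R) <= k%:R * poisson_sum (k + N).+1.
    by rewrite ler_wpM2l.
  have g2 : k%:R * (e / k.+1%:R) <= e.
    by rewrite mulrCA ger_pMr // ler_pdivrMr ?ltr0n // mul1r ler_nat.
  move: g1 g2; move: (e / _) (k%:R : R) (poisson_sum _) (poisson_sum _) => x y z w g1
    g2.
  by nra.
have h2 : l * (poisson_sum (k + N) - poisson_sum k) <= l * (1 - poisson_sum k).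
  by rewrite ler_pM2l // lerD2r poisson_sum_le1.
by have := step N; lra.
Qed.

(** * Stein's equation for the Poisson distribution *)

Section stein_solution.
Variables (A : pred nat) (N : nat).
Hypothesis A_lt : forall k, A k -> (k < N)%N.

Definition poisson_mass k : R := \sum_(j < k | A j) pmf j.

(* The division by zero makes this 0 at k = 0, where the value is irrelevant. *)
Definition stein_fun k : R :=
  (poisson_mass k - poisson_mass N * poisson_sum k) / (k%:R * pmf k).

Lemma poisson_massS k : poisson_mass k.+1 = poisson_mass k + (A k)%:R * pmf k.
Proof.
rewrite /poisson_mass big_mkcond big_ord_recr -big_mkcond /=.
by case: (A k); rewrite ?mul1r ?mul0r.
Qed.

(** With u k = k * pmf k * f k for the solution f, multiplying the left side by pmf k gives u k.+1 -
    u k, by [poisson_pmfS]. The solution is thus a partial sum of the right side weighted by pmf. *)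
Lemma stein_eq k :
  l * stein_fun k.+1 - k%:R * stein_fun k = (A k)%:R - poisson_mass N.
Proof.
have pk0 : pmf k != 0 by rewrite gt_eqF ?poisson_pmf_gt0.
rewrite /stein_fun poisson_pmfS poisson_massS poisson_sumS.
have l0 : l != 0 by rewrite gt_eqF.
case: k pk0 => [|k] pk0.
  rewrite mul0r subr0 /poisson_mass /poisson_sum !big_ord0.
  by field; rewrite pk0 l0.
have k0 : k.+1%:R != 0 :> R by rewrite pnatr_eq0.
by move: k0; move: (k.+1%:R : R) => a a0; field; rewrite pk0 l0 a0.
Qed.

Lemma poisson_mass_mono k : poisson_mass k <= poisson_mass k.+1.
Proof.
rewrite poisson_massS lerDl mulr_ge0 //; exact: poisson_pmf_ge0.
Qed.

Lemma poisson_mass_stable k : (N <= k)%N -> poisson_mass k = poisson_mass N.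
Proof.
move=> /subnKC <-; elim: (k - N)%N => [|n IH]; first by rewrite addn0.
rewrite addnS poisson_massS; case: (boolP (A _)) => [/A_lt|_].
  by rewrite ltnNge leq_addr.
by rewrite mul0r addr0.
Qed.

Lemma poisson_mass_le k : poisson_mass k <= poisson_mass N.
Proof.
have [kN|/ltnW/poisson_mass_stable->//] := leqP k N.
rewrite -(subnKC kN); elim: (N - k)%N => [|n IH]; first by rewrite addn0.
by rewrite addnS (le_trans IH) ?poisson_mass_mono.
Qed.

(** The analogue of [poisson_mass_le] for the complement of A, whose total mass is 1 -
    [poisson_mass N]. *)
Lemma poisson_comass_le k :
  poisson_sum k - poisson_mass k <= 1 - poisson_mass N.
Proof.
have step m : poisson_sum m - poisson_mass m <= poisson_sum m.+1 - poisson_mass m.+1.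
  rewrite poisson_sumS poisson_massS.
  have := poisson_pmf_ge0 l m.
  by case: (A m); rewrite ?mul1r ?mul0r; lra.
have steps n : poisson_sum k - poisson_mass k <=
    poisson_sum (k + n) - poisson_mass (k + n).
  by elim: n => [|n IH]; rewrite ?addn0 // addnS; exact: le_trans IH (step _).
apply: le_trans (steps N) _.
by rewrite poisson_mass_stable ?leq_addl // lerD2r poisson_sum_le1.
Qed.

(** Upward only the point m can contribute: the case A = {m} gives (m T + l S) / (m l) <= 1 / l,
    with S and T the masses below and above m. The extreme downward case is that of the complement
    of {m}, with the opposite value. *)
Lemma stein_fun_lipschitz k : `|stein_fun k.+2 - stein_fun k.+1| <= l^-1.
Proof.
move: (k.+1) (ltn0Sn k) => m m_gt0; set pi := pmf m.
have pi0 : 0 < pi by exact: poisson_pmf_gt0.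
have m0 : 0 < m%:R :> R by rewrite ltr0n.
set a := poisson_mass m; set S := poisson_sum m.
set e : R := (A m)%:R.
have ESm : poisson_sum m.+1 = S + pi by exact: poisson_sumS.
have Eam : poisson_mass m.+1 = a + e * pi by exact: poisson_massS.
pose T := 1 - (S + pi); pose b := poisson_mass N - (a + e * pi).
have i1 : m%:R * T <= l * (T + pi).
  have := poisson_tail_mean m; rewrite ESm -/S -/T.
  by rewrite (_ : T + pi = 1 - S) // /T; ring.
have i2 : l * S <= m%:R * (S + pi).
  by have := poisson_sum_mean m; rewrite ESm.
have a0 : 0 <= a by apply: sumr_ge0 => j _; exact: poisson_pmf_ge0.
have b0 : 0 <= b by rewrite subr_ge0 -Eam poisson_mass_le.
have bT : b <= T.
  have := poisson_comass_le m.+1; rewrite ESm Eam /b /T; lra.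
have aS : a <= S.
  rewrite /a /S /poisson_mass /poisson_sum big_mkcond; apply: ler_sum => j _.
  by case: ifP => // _; exact: poisson_pmf_ge0.
have e01 : 0 <= e <= 1 by rewrite /e; case: (A m); rewrite ?ler01 ?lexx.
have QE : poisson_mass N = a + e * pi + b by rewrite /b; ring.
have T1 : 1 = S + pi + T by rewrite /T; ring.
pose X := a * (m%:R * T - l * (T + pi)) + b * (l * S - m%:R * (S + pi))
          + e * pi * (m%:R * T + l * S).
(* a and b are the masses of A below and above m, out of S and T; the
   coefficients of a and b in X are nonpositive. *)
have -> : stein_fun m.+1 - stein_fun m = X / (m%:R * l * pi).
  rewrite /stein_fun poisson_pmfS -/pi -/S -/a ESm Eam QE /X.
  rewrite (_ : a - (a + e * pi + b) * S = a * (T + pi) - (b + e * pi) * S); last first.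
    by rewrite -{1}[a]mulr1 T1; ring.
  rewrite (_ : a + e * pi - (a + e * pi + b) * (S + pi) =
               (a + e * pi) * T - b * (S + pi)); last first.
    by rewrite -{1}[a + e * pi]mulr1 T1; ring.
  by field; rewrite (gt_eqF l_gt0) (gt_eqF pi0) (gt_eqF m0).
rewrite normrM [X in _ * X]ger0_norm; last first.
  by rewrite invr_ge0 !mulr_ge0 // ltW.
rewrite ler_pdivrMr ?mulr_gt0 //.
rewrite (_ : l^-1 * (m%:R * l * pi) = m%:R * pi); last first.
  by field; rewrite gt_eqF.
have c0 : 0 <= m%:R * T + l * S.
  by rewrite addr_ge0 // mulr_ge0 //; [exact: le_trans b0 bT | exact: ltW | exact:
    le_trans a0 aS].
have c1 : m%:R * T + l * S <= m%:R.
  have E : m%:R = m%:R * (S + pi) + m%:R * T :> R by rewrite -mulrDr -T1 mulr1.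
  by rewrite [leRHS]E addrC lerD2r.
rewrite ler_norml; apply/andP; split.
  have h1 : S * (m%:R * T - l * (T + pi)) <= a * (m%:R * T - l * (T + pi)).
    by rewrite ler_wnM2r // subr_le0.
  have h2 : T * (l * S - m%:R * (S + pi)) <= b * (l * S - m%:R * (S + pi)).
    by rewrite ler_wnM2r // subr_le0.
  have h3 : 0 <= e * pi * (m%:R * T + l * S).
    by rewrite !mulr_ge0 // ?ltW //; case/andP: e01.
  have h4 : (m%:R * T + l * S) * pi <= m%:R * pi by rewrite ler_pM2r.
  have h5 : S * (m%:R * T - l * (T + pi)) + T * (l * S - m%:R * (S + pi)) =
     - ((m%:R * T + l * S) * pi) by ring.
  by rewrite /X; lra.
have h1 : a * (m%:R * T - l * (T + pi)) <= 0 by rewrite mulr_ge0_le0 // subr_le0.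
have h2 : b * (l * S - m%:R * (S + pi)) <= 0 by rewrite mulr_ge0_le0 // subr_le0.
have h3 : e * pi * (m%:R * T + l * S) <= m%:R * pi.
  rewrite mulrAC ler_pM2r //; apply: le_trans c1.
  by rewrite ler_piMl //; case/andP: e01.
by rewrite /X; lra.
Qed.
End stein_solution.

(** * Exponential tail bounds *)

Lemma expR_le_quadratic (x : R) : x <= 1 / 3 -> -1 <= x -> expR x <= 1 + x + x ^+ 2.
Proof.
move=> x3 x1.
have [x0|x0] := leP x 0.
  have h : 0 < 1 - x by lra.
  have := expR_ge1Dx (- x); rewrite expRN => h2.
  have e0 := expR_gt0 x.
  have : expR x <= (1 - x)^-1 by rewrite -[leLHS]invrK lef_pV2 ?posrE ?invr_gt0.
  move=> /le_trans; apply; rewrite -[leLHS]mul1r ler_pdivrMr //.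
  nra.
(* For x > 0 the bound 1 / (1 - x) exceeds the quadratic. Squaring the bound at x / 2 leaves the
   condition 1 - 3 x + x^2 >= 0, whence the 1/3. *)
have -> : expR x = expR (x / 2) ^+ 2.
  by rewrite expr2 -expRD; congr expR; lra.
have h : 0 < 1 - x / 2 by lra.
have := expR_ge1Dx (- (x / 2)); rewrite expRN => h2.
have e0 := expR_gt0 (x / 2).
have h3 : expR (x / 2) <= (1 - x / 2)^-1.
  by rewrite -[leLHS]invrK lef_pV2 ?posrE ?invr_gt0.
apply: (@le_trans _ _ ((1 - x / 2)^-1 ^+ 2)).
  by rewrite lerXn2r // nnegrE ?invr_ge0 ltW.
rewrite exprVn -[leLHS]mul1r ler_pdivrMr ?exprn_gt0 //.
have -> : (1 + x + x ^+ 2) * (1 - x / 2) ^+ 2 =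
   1 + x ^+ 2 / 4 * (1 - 3 * x + x ^+ 2) by field.
by rewrite lerDl mulr_ge0 ?divr_ge0 ?sqr_ge0 //; nra.
Qed.

Lemma poisson_mgf (t : R) N :
  \sum_(k < N) pmf k * expR (t * k%:R) <= expR (l * (expR t - 1)).
Proof.
have -> : l * (expR t - 1) = l * expR t - l by ring.
rewrite expRD; apply: (@le_trans _ _
    ((\sum_(k < N) (l * expR t) ^+ k / k`!%:R) * expR (- l))).
  rewrite big_distrl /=; apply: ler_sum => k _; rewrite poisson_pmfE expRM_natr.
  by rewrite exprMn le_eqVlt; apply/orP; left; apply/eqP; ring.
by rewrite ler_wpM2r ?expR_ge0 // sum_exp_coeff_le // mulr_ge0 ?expR_ge0 // ltW.
Qed.

(** Exponential bounds with parameters t and -t, added. The parameter stays free because it is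
    chosen twice: of order sqrt (d / l) for concentration, and 1 / sqrt l in the normal
    approximation. *)
Lemma poisson_chernoff (t u : R) N : 0 <= t <= 1 / 3 ->
  \sum_(k < N | u <= `|k%:R - l|) pmf k <= 2 * expR (l * t ^+ 2 - t * u).
Proof.
move=> /andP[t0 t3].
have tail (s : R) : - 1 <= s <= 1 / 3 ->
  \sum_(k < N) pmf k * expR (s * (k%:R - l) - t * u) <=
     expR (l * s ^+ 2 - t * u).
  move=> /andP[s1 s3].
  have -> : l * s ^+ 2 - t * u = l * ((1 + s + s ^+ 2) - 1) + (- s * l - t * u) by ring.
  rewrite [leRHS]expRD.
  apply: (@le_trans _ _ (expR (l * (expR s - 1)) * expR (- s * l - t * u))); last first.
    by rewrite ler_pM2r ?expR_gt0 // ler_expR ler_pM2l // lerD2r expR_le_quadratic.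
  apply: (@le_trans _ _ ((\sum_(k < N) pmf k * expR (s * k%:R)) * expR (- s * l - t *
    u))).
    rewrite big_distrl; apply: ler_sum => k _ /=; rewrite -mulrA -expRD.
    by rewrite (_ : s * (k%:R - l) - t * u = s * k%:R + (- s * l - t * u)) //; ring.
  by rewrite ler_pM2r ?expR_gt0 // poisson_mgf.
have h1 := tail t ltac:(lra); have h2 := tail (- t) ltac:(lra).
rewrite sqrrN in h2.
rewrite mulr2n mulrDl mul1r; apply: le_trans (lerD h1 h2).
rewrite -big_split /= big_mkcond; apply: ler_sum => k _.
have p0 := poisson_pmf_ge0 l k.
have g1 := expR_ge0 (t * (k%:R - l) - t * u).
have g2 := expR_ge0 (- t * (k%:R - l) - t * u).
case: ifP => [uk|_]; last by rewrite addr_ge0 // mulr_ge0.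
rewrite -mulrDr ler_peMr //; move: uk; rewrite ler_normr => /orP[] uk.
  have g3 : 1 <= expR (t * (k%:R - l) - t * u).
    by rewrite -[leLHS]expR0 ler_expR -mulrBr mulr_ge0 // subr_ge0.
  by lra.
have g3 : 1 <= expR (- t * (k%:R - l) - t * u).
  by rewrite -[leLHS]expR0 ler_expR mulNr -mulrN -mulrBr mulr_ge0 // subr_ge0.
by lra.
Qed.
End poisson.

(** * Poisson approximation of a locally dependent count *)

Section poisson_local.
Variables (R : realType) (W J : finType) (S : {set W}) (w : W -> R).
Variables (K : {set J}) (X : J -> W -> bool) (nearby : rel J).
Hypotheses (w_ge0 : forall x, x \in S -> 0 <= w x)
  (w_sum1 : \sum_(x in S) w x = 1)
  (near_refl : forall k, k \in K -> nearby k k)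
  (far_indep : forall k (g : nat -> R), k \in K ->
     mean S w (fun x => (X k x)%:R * g (far_count K X nearby k x)) =
     mean S w (fun x => (X k x)%:R) * mean S w (fun x => g (far_count K X nearby k x))).
Local Notation l := (mean S w (fun x => (count_in K X x)%:R)).

(** For the Stein solution of A, the mean bounded in [stein_local] is the difference of the two
    probabilities of A, by [stein_eq]. *)
Lemma poisson_local (A : pred nat) N : 0 < l -> (forall k, A k -> (k < N)%N) ->
  `|mean S w (fun x => (A (count_in K X x))%:R) - \sum_(k < N | A k) poisson_pmf l k| <=
  l^-1 * dependence_bound S w K X nearby.
Proof.
move=> l0 AN.
have := stein_local w_ge0 near_refl far_indep
  (@stein_fun_lipschitz R _ l0 A N AN).
congr (`|_| <= _).
rewrite (eq_mean _ (fun x _ => stein_eq l0 A N (count_in K X x))).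
by rewrite meanB mean_cst.
Qed.
End poisson_local.

Section poisson_approximation.
Variables (R : realType) (p : R) (d : nat).
Variable Y : {set {set vertex d}} -> nat.
Variables l delta : R.
Hypotheses (p_gt0 : 0 < p) (p_lt_half : p < 1 / 2) (l_gt0 : 0 < l).
Hypothesis approx : forall (A : pred nat) N, (forall k, A k -> (k < N)%N) ->
  `|Pr p (fun F => A (Y F)) - \sum_(k < N | A k) poisson_pmf l k| <= delta.

Lemma PrE (A : pred {set {set vertex d}}) :
  Pr p A = mean (powerset (cube_edges d)) (weight p (d:=d)) (fun F => (A F)%:R).
Proof.
rewrite /Pr big_mkcondr; apply: eq_bigr => F _.
by case: (A F); rewrite ?mulr1 ?mulr0.
Qed.

Lemma cube_weight_ge0 (F : {set {set vertex d}}) : 0 <= weight p F.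
Proof. by apply: subset_weight_ge0 => //; have h := p_lt_half; lra. Qed.

Lemma sum_cube_weight : \sum_(F in powerset (cube_edges d)) weight p F = 1.
Proof. exact: sum_subset_weight. Qed.

Lemma PrC (A : pred {set {set vertex d}}) : Pr p (fun F => ~~ A F) = 1 - Pr p A.
Proof.
rewrite !PrE -[X in X - _](mean_cst sum_cube_weight 1) -meanB.
by apply: eq_mean => F _; case: (A F); rewrite ?subrr ?subr0.
Qed.

Lemma Pr_mono (A B : pred {set {set vertex d}}) :
  (forall F, A F -> B F) -> Pr p A <= Pr p B.
Proof.
move=> AB; rewrite !PrE; apply: le_mean => [F _|F _]; first exact: cube_weight_ge0.
by rewrite ler_nat; case: (boolP (A F)) => [/AB ->|].
Qed.

Lemma eq_Pr (A B : pred {set {set vertex d}}) : A =1 B -> Pr p A = Pr p B.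
Proof. by move=> AB; rewrite !PrE; apply: eq_mean => F _; rewrite AB. Qed.

Let bound : nat := (\sum_F Y F).+1.

Let Y_bound F : (Y F < bound)%N.
Proof. by rewrite /bound ltnS (bigD1 F) //= leq_addr. Qed.

(** [approx] covers bounded sets of values; an arbitrary A is cut off above every value that Y
    takes. *)
Lemma poisson_approx_large : exists N0, forall N (A : pred nat), (N0 <= N)%N ->
  `|Pr p (fun F => A (Y F)) - \sum_(k < N | A k) poisson_pmf l k| <= delta.
Proof.
exists bound => N A leN.
have := @approx (fun k => A k && (k < N)%N) N (fun k => @proj2 _ _ \o elimT andP).
congr (`|_ - _| <= _).
  by apply: eq_Pr => F; rewrite (leq_trans (Y_bound F)) // andbT.
by apply: eq_bigl => k; rewrite ltn_ord andbT.
Qed.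

(** The values where P k reaches the Poisson weight and the others form two sets; by [approx] each
    contributes at most delta to the sum of absolute differences, and the factor 1/2 absorbs the
    two. *)
Lemma poisson_approx_dTV :
  (0%:E <= dTV (fun k => Pr p (fun F => (Y F)%:R == k%:R :> R)) (poisson_pmf l)
     <= delta%:E)%E.
Proof.
set P := fun k : nat => _.
have Psum (A : pred nat) N : Pr p (fun F => A (Y F) && (Y F < N)%N) =
    \sum_(k < N | A k) P k.
  transitivity (\sum_(k < N | A k) mean (powerset (cube_edges d))
     (weight p (d:=d)) (fun F => (Y F == k)%:R)); last first.
    by apply: eq_bigr => k _; rewrite /P PrE; apply: eq_mean => F _; rewrite eqr_nat.
  rewrite PrE -mean_sum; apply: eq_mean => F _.
  have [YN|YN] := ltnP (Y F) N.
    rewrite andbT big_mkcond (bigD1 (Ordinal YN)) //= eqxx big1 ?addr0.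
      by case: (A _).
    move=> k ne; rewrite eq_sym; case: ifP => // _.
    by rewrite (_ : ((k : nat) == Y F) = false) //; apply: contraNF ne => /eqP E;
      apply/eqP/val_inj.
  rewrite andbF big1 // => k _; rewrite gtn_eqF //.
  exact: leq_trans (ltn_ord k) YN.
have half (A : pred nat) N : `|\sum_(k < N | A k) (P k - poisson_pmf l k)| <= delta.
  have := @approx (fun k => A k && (k < N)%N) N (fun k => @proj2 _ _ \o elimT andP).
  rewrite Psum sumrB; congr (`|_ - _| <= _).
  by apply: eq_bigl => k; rewrite ltn_ord andbT.
have partial N : \sum_(k < N) `|P k - poisson_pmf l k| <= 2 * delta.
  rewrite (bigID (fun k : 'I_N => 0 <= P k - poisson_pmf l k)) /=.
  rewrite mulr2n mulrDl mul1r; apply: lerD.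
    apply: le_trans (half (fun k => 0 <= P k - poisson_pmf l k) N).
    rewrite [leRHS]ger0_norm; last by apply: sumr_ge0.
    by rewrite le_eqVlt (eq_bigr (fun k : 'I_N => P k - poisson_pmf l k)) ?eqxx // => k
      /ger0_norm.
  apply: le_trans (half (fun k => ~~ (0 <= P k - poisson_pmf l k)) N).
  rewrite -normrN -sumrN.
  rewrite [leRHS]ger0_norm; last first.
    by apply: sumr_ge0 => k; rewrite -ltNge oppr_ge0 => /ltW.
  rewrite le_eqVlt (eq_bigr (fun k : 'I_N => - (P k - poisson_pmf l k))) ?eqxx // => k.
  by rewrite -ltNge => /ltr0_norm.
rewrite /dTV; apply/andP; split.
  by apply: mule_ge0; rewrite ?lee_fin ?invr_ge0 //; apply: nneseries_ge0 => k _ _;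
    rewrite lee_fin.
rewrite (_ : delta = 2^-1 * (2 * delta)); last by field.
rewrite EFinM; apply: lee_wpmul2l; first by rewrite lee_fin invr_ge0.
apply: lime_le; first by apply: is_cvg_nneseries => k _ _; rewrite lee_fin.
apply: nearW => N; rewrite sumEFin lee_fin big_mkord; exact: partial.
Qed.

Lemma poisson_approx_tail (t u : R) : 0 <= t <= 1 / 3 ->
  1 - (delta + 2 * expR (l * t ^+ 2 - t * u)) <=
  Pr p (fun F => `|(Y F)%:R - l| < u).
Proof.
move=> t01; rewrite lerBlDr -lerBlDl.
have -> : 1 - Pr p (fun F => `|(Y F)%:R - l| < u) = Pr p (fun F => u <= `|(Y F)%:R -
  l|).
  by rewrite -PrC; apply: eq_Pr => F; rewrite leNgt.
have [N0 h] := poisson_approx_large.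
have := h N0 (fun k => u <= `|k%:R - l|) (leqnn _).
have := poisson_chernoff l_gt0 u N0 t01.
by move=> h1 /ler_normlP[_ h2]; lra.
Qed.
End poisson_approximation.

(** * Poisson approximation of the number of components *)

Section copies_approximation.
Variables (R : realType) (p : R) (r : nat) (n : 'I_r -> nat).
Variable H : forall i : 'I_r, cgraph (n i).
Hypotheses (p_gt0 : 0 < p) (p_lt_half : p < 1 / 2)
  (H_cube : forall i, cube_subgraph (H i))
  (H_conn : forall i, gconnected (H i))
  (H_noniso : forall i j, i != j -> ~~ ambient_iso (H i) (H j)).
Variables (M d : nat).
Hypothesis leM : forall i, (nverts (H i) <= M)%N.

Let Y (F : {set {set vertex d}}) : nat := (\sum_(i < r) comp_count (H i) F)%N.
Let l : R := Ex p (fun F => (Y F)%:R).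

Definition approx_error : R := (1 + (p ^+ (M * M))^-1) *
  (\sum_(i < r) (M * d.+1 * 'C(d, cube_span (H i)))%:R * copy_prob p H d i).

Let S := powerset (cube_edges d).
Let K := all_copies H d.
Let X := @isolated d.

Lemma mean_copies : l = mean S (weight p (d:=d)) (fun F => (count_in K X F)%:R).
Proof.
by apply: eq_mean => F FS; rewrite /Y (comp_count_isolated H_noniso FS).
Qed.

Lemma near_refl_copies k : k \in K -> nearby k k.
Proof. by case/all_copiesP=> i /copiesP[_ conn _]; exact: near_refl. Qed.

Lemma far_indep_copies k (g : nat -> R) : k \in K ->
  mean S (weight p (d:=d)) (fun x => (X k x)%:R * g (far_count K X (@nearby d) k x)) =
  mean S (weight p (d:=d)) (fun x => (X k x)%:R) *
  mean S (weight p (d:=d)) (fun x => g (far_count K X (@nearby d) k x)).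
Proof.
move=> _; apply: (subset_mean_indep _ (sub_incident (verts k))) => F.
  by rewrite /X /isolated -setIA finset.setIid.
congr (g _); apply: eq_bigr => j /andP[_ /far_incident dkj].
rewrite /X /isolated; congr (nat_of_bool (_ == _)).
apply/setP => e; rewrite !(in_setI, in_setD).
have [ej|] := boolP (e \in incident (verts j)); last by rewrite !andbF.
by rewrite (disjointFl dkj ej).
Qed.

Let w_ge0 F : F \in S -> 0 <= weight p F.
Proof. by move=> _; exact: cube_weight_ge0. Qed.

Lemma copies_poisson_approx : 0 < l ->
  forall (A : pred nat) N, (forall k, A k -> (k < N)%N) ->
  `|Pr p (fun F => A (Y F)) - \sum_(k < N | A k) poisson_pmf l k| <= approx_error.
Proof.
move=> l0 A N AN; have E := mean_copies.
have := @poisson_local _ _ _ S (weight p (d:=d)) K X (@nearby d) w_ge0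
  (sum_cube_weight p d) near_refl_copies far_indep_copies A N.
rewrite -E => /(_ l0 AN) h; rewrite PrE.
rewrite (@eq_mean R _ S (weight p (d:=d)) _ (fun F => (A (count_in K X F))%:R));
  last first.
  by move=> F FS; rewrite /Y (comp_count_isolated H_noniso FS).
(* The factor l^-1 from the Stein solution cancels the factor l in the bound on close pairs. *)
apply: le_trans h _; rewrite mulrC ler_pdivrMr //.
exact: dependence_all_copies.
Qed.

Lemma copies_variance : `|Var p (fun F => (Y F)%:R) - l| <= approx_error * l.
Proof.
have := variance_local w_ge0 (sum_cube_weight p d) near_refl_copies far_indep_copies.
rewrite -mean_copies => h; apply: le_trans (dependence_all_copies _ _ _ _ _ _ leM) =>
  //.
apply: le_trans h; rewrite le_eqVlt; apply/orP; left; apply/eqP; congr (`|_ - _|).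
rewrite /Var -/l; apply: eq_mean => F FS.
by rewrite /Y (comp_count_isolated H_noniso FS).
Qed.
End copies_approximation.

(** * Normal approximation of the Poisson distribution *)

Section normal_cdf.
Variable R : realType.
Implicit Types (a b x : R).
Local Notation Phi := (@normal_cdf R).
Local Notation phi := (@normal_pdf R 0 1).

Lemma normal_pdf01E x : phi x = normal_peak 1 * expR (- (x ^+ 2 / 2)).
Proof.
rewrite normal_pdfE ?oner_neq0 // /normal_fun subr0 expr1n; congr (_ * expR _).
by rewrite mulNr.
Qed.

Lemma normal_pdf01_gt0 x : 0 < phi x.
Proof. by rewrite normal_pdf01E mulr_gt0 ?expR_gt0 // normal_peak_gt0 // oner_neq0. Qed.

Lemma normal_cdfE x : (Phi x)%:E = normal_prob 0 1 `]-oo, x].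
Proof.
rewrite /normal_cdf -set_itvNyc fineK //; exact: fin_num_measure.
Qed.

Lemma normal_cdf_diff a b : a <= b ->
  (Phi b - Phi a)%:E = normal_prob 0 1 `]a, b].
Proof.
move=> ab; rewrite EFinB !normal_cdfE.
rewrite (@itv_bndbnd_setU _ _ _ (BRight a)) //.
rewrite measureU //; first by rewrite addeAC subee ?add0e // fin_num_measure.
rewrite -classical_sets.subset0 => x /=; rewrite !in_itv /= => -[xa /andP[ax _]].
by move: xa; rewrite leNgt ax.
Qed.

Lemma normal_cdf_diff_le a b (c : R) : a <= b ->
  (forall u, a < u <= b -> phi u <= c) -> Phi b - Phi a <= c * (b - a).
Proof.
move=> ab hc; rewrite -lee_fin normal_cdf_diff // /normal_prob.
apply: (@le_trans _ _ (\int[lebesgue_measure]_(u in `]a, b]) (cst c%:E) u)%E).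
  apply: ge0_le_integral => //.
  - by move=> u _; rewrite lee_fin normal_pdf_ge0.
  - apply/measurable_realfun.measurable_EFinP; apply: measurable_funTS;
    exact: measurable_normal_pdf.
rewrite integral_cst //= lebesgue_measure_itv /= lte_fin.
case: ltP => [_|ba]; first by rewrite -EFinB -EFinM.
by rewrite mule0 lee_fin (_ : a = b) ?subrr ?mulr0 //; apply/le_anti/andP.
Qed.

Lemma normal_cdf_diff_ge a b (c : R) : 0 <= c -> a <= b ->
  (forall u, a < u <= b -> c <= phi u) -> c * (b - a) <= Phi b - Phi a.
Proof.
move=> c0 ab hc; rewrite -lee_fin normal_cdf_diff // /normal_prob.
apply: (@le_trans _ _ (\int[lebesgue_measure]_(u in `]a, b]) (cst c%:E) u)%E);
  last first.
  apply: ge0_le_integral => //.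
  - apply/measurable_realfun.measurable_EFinP; apply: measurable_funTS;
    exact: measurable_normal_pdf.
rewrite integral_cst //= lebesgue_measure_itv /= lte_fin.
case: ltP => [_|ba]; first by rewrite -EFinB -EFinM.
by rewrite mule0 lee_fin (_ : a = b) ?subrr ?mulr0 //; apply/le_anti/andP.
Qed.

Lemma normal_peak01_le1 : normal_peak 1 <= 1 :> R.
Proof.
rewrite /normal_peak expr1n mul1r invf_le1; last first.
  by rewrite sqrtr_gt0 mulrn_wgt0 // pi_gt0.
rewrite -[leLHS]sqrtr1 ler_wsqrtr //.
have := pi_ge2 R; lra.
Qed.

Lemma normal_cdf_mono a b : a <= b -> Phi a <= Phi b.
Proof.
move=> ab; rewrite -subr_ge0 -lee_fin normal_cdf_diff //; exact: measure_ge0.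
Qed.

Lemma normal_cdf_lipschitz a b : a <= b -> Phi b - Phi a <= b - a.
Proof.
move=> ab; rewrite -[leRHS]mul1r; apply: normal_cdf_diff_le => // u _.
by apply: le_trans (normal_pdf_ub _ _ _) normal_peak01_le1; rewrite oner_neq0.
Qed.

Lemma normal_cdf_ge0 x : 0 <= Phi x.
Proof. by rewrite -lee_fin normal_cdfE measure_ge0. Qed.

Lemma normal_cdf_le1 x : Phi x <= 1.
Proof. by rewrite -lee_fin normal_cdfE; exact: probability_le1. Qed.

(** The identity as a random variable under the normal law: its distribution function is Phi, so the
    general limits of distribution functions apply. *)
Let idTR : measurableTypeR R -> R := idfun.

HB.instance Definition _ :=
  @isMeasurableFun.Build _ _ _ _ idTR (@measurable_id _ _ classical_sets.setT).

Lemma normal_cdf_tails (e : R) : 0 < e -> exists M0 : R, forall M, M0 <= M ->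
  Phi (- M) <= e /\ 1 - e <= Phi M.
Proof.
move=> e0; pose P : probability _ R := normal_prob 0 1.
pose X : {RV P >-> R} := idTR.
have cE : cdf X = EFin \o Phi by apply/funext => x; rewrite /= normal_cdfE.
have c1 := cvg_cdfy1 X; rewrite cE in c1.
have c2 := cvg_cdfNy0 X; rewrite cE in c2.
have /fine_cvgP[_ /cvgrPdist_le /(_ _ e0) [M1 [_ h1]]] := c1.
have /fine_cvgP[_ /cvgrPdist_le /(_ _ e0) [M2 [_ h2]]] := c2.
exists (Num.max M1 (- M2) + 1) => M hM.
have [m1 m2] : M1 < M /\ - M < M2.
  have : M1 <= Num.max M1 (- M2) by rewrite le_max lexx.
  have : - M2 <= Num.max M1 (- M2) by rewrite le_max lexx orbT.
  by split; lra.
move: (h1 _ m1) (h2 _ m2) => /= /ler_normlP[g1 g2] /ler_normlP[g3 g4].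
by split; lra.
Qed.
End normal_cdf.

Section poisson_local_limit.
Variables (R : realType) (l : R).
Hypothesis l_gt0 : 0 < l.
Local Notation Phi := (@normal_cdf R).
Local Notation phi := (@normal_pdf R 0 1).
Local Notation pmf := (poisson_pmf l).
Local Notation h := ((Num.sqrt l)^-1).

Definition standardized (k : nat) : R := (k%:R - l) * h.
Local Notation y := standardized.
(* Consecutive ratios differ by a factor exp (O (M ^ 2 / l)), so over the
   O (M * sqrt l) indices k with |y k| <= M the ratio is constant up to a factor
   exp (O (M ^ 3 / sqrt l)).  The total mass 1 then determines the constant, and
   Stirling's formula is not needed. *)
Definition poisson_ratio (k : nat) : R := pmf k / (h * phi (y k)).
Local Notation rho := poisson_ratio.

Let h_gt0 : 0 < h. Proof. by rewrite invr_gt0 sqrtr_gt0. Qed.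

Lemma mul_inv_sqrt_sq : l * h ^+ 2 = 1.
Proof. by rewrite exprVn sqr_sqrtr ?ltW // mulfV // gt_eqF. Qed.

Lemma standardizedS k : y k.+1 = y k + h.
Proof. by rewrite /y -natr1; ring. Qed.

Lemma standardizedD k j : y (k + j) = y k + j%:R * h.
Proof. by rewrite /y natrD; ring. Qed.

Lemma poisson_ratio_gt0 k : 0 < rho k.
Proof. by rewrite divr_gt0 ?mulr_gt0 ?poisson_pmf_gt0 ?normal_pdf01_gt0. Qed.

Lemma poisson_pmf_ratio k : pmf k = rho k * (h * phi (y k)).
Proof. by rewrite divfK // gt_eqF // mulr_gt0 ?normal_pdf01_gt0. Qed.

Lemma normal_pdf01_shift (a b : R) : phi a = phi b * expR ((b ^+ 2 - a ^+ 2) / 2).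
Proof. by rewrite !normal_pdf01E -[RHS]mulrA -expRD; congr (_ * expR _); field. Qed.

Variable M : R.
Hypotheses (M_ge1 : 1 <= M) (Mh : M * h <= 1 / 2).

(** With v = y k.+1 * h one has k.+1 = l (1 + v), so the ratio changes by the factor exp (v - h^2 /
    2) / (1 + v). The linear terms in v cancel, and v^2 <= M^2 h^2; [Mh] keeps 1 + v >= 1/2. *)
Lemma poisson_ratio_step k : - M <= y k.+1 <= M ->
  rho k * expR (- (2 * M ^+ 2 * h ^+ 2)) <= rho k.+1 /\
  rho k.+1 <= rho k * expR (2 * M ^+ 2 * h ^+ 2).
Proof.
move=> /andP[y1 y2]; pose v := y k.+1 * h.
have M1 := M_ge1; have Mh' := Mh; have h0 := h_gt0.
have v1 : v <= M * h by rewrite ler_pM2r.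
have v2 : - (M * h) <= v by rewrite -mulNr ler_pM2r.
have vpos : 0 < 1 + v by lra.
have E : k.+1%:R = l * (1 + v).
  rewrite /v /y mulrDr mulr1 -mulrA -expr2 mulrCA mul_inv_sqrt_sq; ring.
have Ev : phi (y k) = phi (y k.+1) * expR (v - h ^+ 2 / 2).
  rewrite (normal_pdf01_shift (y k) (y k.+1)); congr (_ * expR _).
  by rewrite /v standardizedS; move: (y k) ((Num.sqrt l)^-1) => a b; field.
clearbody v.
have Er : rho k.+1 = rho k * (expR (v - h ^+ 2 / 2) / (1 + v)).
  rewrite /poisson_ratio Ev; have -> : pmf k.+1 = pmf k / (1 + v).
    apply: (mulfI (_ : k.+1%:R != 0 :> R)); first by rewrite pnatr_eq0.
    by rewrite poisson_pmfS // E; field; rewrite gt_eqF.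
  have e0 : expR (v - h ^+ 2 / 2) != 0 by rewrite expR_eq0.
  have p0 : phi (y k.+1) != 0 by rewrite gt_eqF ?normal_pdf01_gt0.
  move: e0 p0; move: (expR _) (phi _) => e f e0 f0.
  by field; rewrite e0 f0 !gt_eqF // sqrtr_gt0.
have r0 := ltW (poisson_ratio_gt0 k).
have hh : h ^+ 2 <= M ^+ 2 * h ^+ 2.
  by rewrite ler_peMl ?sqr_ge0 // -(expr1n _ 2) lerXn2r // nnegrE; lra.
have vv : v ^+ 2 <= M ^+ 2 * h ^+ 2.
  rewrite -exprMn -ler_sqrt ?sqr_ge0 // !sqrtr_sqr [leRHS]ger0_norm ?mulr_ge0 //;
    try lra.
  by rewrite ler_norml v1 v2.
have h2 := sqr_ge0 h.
have g1 : expR (- (2 * M ^+ 2 * h ^+ 2)) <= expR (v - h ^+ 2 / 2) / (1 + v).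
  rewrite ler_pdivlMr //.
  apply: (@le_trans _ _ (expR (- (2 * M ^+ 2 * h ^+ 2)) * expR v)).
    by rewrite ler_pM2l ?expR_gt0 // expR_ge1Dx.
  by rewrite -expRD ler_expR -mulrA; lra.
have g2 : expR (v - h ^+ 2 / 2) / (1 + v) <= expR (2 * M ^+ 2 * h ^+ 2).
  have k1 : (1 + v)^-1 <= expR (- (v / (1 + v))).
    apply: le_trans (expR_ge1Dx _); rewrite le_eqVlt; apply/orP; left.
    by apply/eqP; field; rewrite gt_eqF.
  apply: (@le_trans _ _ (expR (v - h ^+ 2 / 2) * expR (- (v / (1 + v))))).
    by rewrite ler_pM2l ?expR_gt0.
  rewrite -expRD ler_expR.
  have -> : v - h ^+ 2 / 2 + - (v / (1 + v)) = v ^+ 2 / (1 + v) - h ^+ 2 / 2.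
    by move: (h ^+ 2 / 2) => w; field; rewrite gt_eqF.
  have h3 : v ^+ 2 / (1 + v) <= 2 * v ^+ 2.
    rewrite ler_pdivrMr // -subr_ge0.
    have -> : 2 * v ^+ 2 * (1 + v) - v ^+ 2 = v ^+ 2 * (1 + 2 * v) by ring.
    by rewrite mulr_ge0 ?sqr_ge0 //; lra.
  by rewrite -mulrA; lra.
by rewrite Er; split; rewrite ler_wpM2l.
Qed.

(** At most 2 M / h steps fit between -M and M, each with exponent 2 M^2 h^2. *)
Lemma poisson_ratio_steps k j : - M <= y k -> y (k + j) <= M ->
  rho k * expR (- (4 * M ^+ 3 * h)) <= rho (k + j) /\
    rho (k + j) <= rho k * expR (4 * M ^+ 3 * h).
Proof.
move=> yk ykj; have M1 := M_ge1; have h0 := h_gt0.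
have M2 : 0 <= M ^+ 2 := sqr_ge0 M.
have steps : rho k * expR (- (2 * M ^+ 2 * h ^+ 2 * j%:R)) <= rho (k + j) /\
    rho (k + j) <= rho k * expR (2 * M ^+ 2 * h ^+ 2 * j%:R).
  elim: j ykj => [|j IH] ykj.
    by split; rewrite addn0 mulr0 ?oppr0 expR0 mulr1.
  have y0 : 0 <= j%:R * h by rewrite mulr_ge0 // ltW.
  rewrite addnS standardizedS in ykj.
  have [IH1 IH2] := IH ltac:(lra).
  have [|s1 s2] := @poisson_ratio_step (k + j).
    by rewrite standardizedS ykj standardizedD andbT; lra.
  rewrite addnS -[j.+1%:R]natr1 mulrDr mulr1 opprD !expRD ![rho k * (_ * _)]mulrA;
    split.
    by apply: le_trans s1; rewrite ler_wpM2r ?expR_ge0.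
  by apply: le_trans s2 _; rewrite ler_wpM2r ?expR_ge0.
have jh : j%:R * h <= 2 * M by rewrite standardizedD in ykj; lra.
have le4 : 2 * M ^+ 2 * h ^+ 2 * j%:R <= 4 * M ^+ 3 * h.
  have -> : 2 * M ^+ 2 * h ^+ 2 * j%:R = (2 * M ^+ 2 * h) * (j%:R * h) by ring.
  have -> : 4 * M ^+ 3 * h = (2 * M ^+ 2 * h) * (2 * M) by ring.
  by rewrite ler_wpM2l // mulr_ge0 ?(ltW h0) // mulr_ge0.
have r0 := ltW (poisson_ratio_gt0 k).
case: steps => s1 s2; split.
  by apply: le_trans s1; rewrite ler_wpM2l // ler_expR lerN2.
by apply: le_trans s2 _; rewrite ler_wpM2l // ler_expR.
Qed.

Lemma normal_cell k : - M <= y k -> y k.+1 <= M ->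
  h * phi (y k.+1) * expR (- (M * h)) <= Phi (y k.+1) - Phi (y k) /\
    Phi (y k.+1) - Phi (y k) <= h * phi (y k.+1) * expR (M * h).
Proof.
move=> y1 y2; have h0 := h_gt0.
have dy : y k.+1 - y k = h by rewrite standardizedS; ring.
have p0 := ltW (normal_pdf01_gt0 (y k.+1)).
have bound u : y k < u <= y k.+1 -> `|(y k.+1 ^+ 2 - u ^+ 2) / 2| <= M * h.
  move=> /andP[u1 u2].
  have -> : (y k.+1 ^+ 2 - u ^+ 2) / 2 = ((y k.+1 + u) / 2) * (y k.+1 - u) by field.
  rewrite normrM; apply: ler_pM => //; rewrite ler_norml; apply/andP; split; lra.
have yle : y k <= y k.+1 by lra.
have E (z : R) : h * phi (y k.+1) * z = phi (y k.+1) * z * (y k.+1 - y k).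
  by rewrite dy [h * _]mulrC mulrAC.
rewrite !E; split.
  apply: normal_cdf_diff_ge => //; first by rewrite mulr_ge0 ?expR_ge0.
  move=> u hu; rewrite (normal_pdf01_shift u (y k.+1)) ler_wpM2l // ler_expR.
  by have /ler_normlP[] := bound u hu; lra.
apply: normal_cdf_diff_le => // u hu.
rewrite (normal_pdf01_shift u (y k.+1)) ler_wpM2l // ler_expR.
by have /ler_normlP[] := bound u hu; lra.
Qed.

(** The index i is matched with the cell from y (i - 1) to y i, so a block starting at k sums the
    indices k + 1 to k + j. The 5 is 4 for the drift of the ratio plus 1 for the variation of the
    density in a cell, where M h <= M^3 h. *)
Lemma poisson_block k j : - M <= y k -> y (k + j) <= M ->
  rho k * expR (- (5 * M ^+ 3 * h)) * (Phi (y (k + j)) - Phi (y k)) <=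
    poisson_sum l (k + j).+1 - poisson_sum l k.+1 /\
    poisson_sum l (k + j).+1 - poisson_sum l k.+1 <=
    rho k * expR (5 * M ^+ 3 * h) * (Phi (y (k + j)) - Phi (y k)).
Proof.
move=> yk; elim: j => [|j IH] ykj; first by split; rewrite addn0 !subrr mulr0.
have M1 := M_ge1; have h0 := h_gt0.
have [r1 r2] := poisson_ratio_steps yk ykj.
rewrite addnS in r1 r2 ykj *.
have y0 : 0 <= j%:R * h by rewrite mulr_ge0 // ltW.
have [IH1 IH2] := IH ltac:(rewrite standardizedS in ykj; lra).
have [c1 c2] := @normal_cell (k + j) ltac:(rewrite standardizedD; lra) ykj.
rewrite poisson_sumS poisson_pmf_ratio.
have r0 := ltW (poisson_ratio_gt0 k).
have p0 : 0 <= h * phi (y (k + j).+1) by rewrite ltW // mulr_gt0 ?normal_pdf01_gt0.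
have MM : M * h <= M ^+ 3 * h.
  rewrite ler_pM2r // -[leLHS]mulr1 exprS ler_pM2l; last by lra.
  by rewrite -(expr1n _ 2) lerXn2r // nnegrE; lra.
have es1 : expR (- (5 * M ^+ 3 * h)) = expR (- (4 * M ^+ 3 * h)) * expR (- (M ^+ 3 *
  h)).
  by rewrite -expRD; congr expR; ring.
have es2 : expR (5 * M ^+ 3 * h) = expR (4 * M ^+ 3 * h) * expR (M ^+ 3 * h).
  by rewrite -expRD; congr expR; ring.
set D := Phi _ - Phi (y (k + j)) in c1 c2.
have D0 : 0 <= D by apply: le_trans c1; rewrite mulr_ge0 ?expR_ge0.
have s1 : rho k * expR (- (5 * M ^+ 3 * h)) * D <= rho (k + j).+1 * (h * phi (y (k +
  j).+1)).
  apply: (@le_trans _ _ (rho k * expR (- (4 * M ^+ 3 * h)) * (h * phi (y (k +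
    j).+1)))); last first.
    by rewrite ler_wpM2r.
  rewrite es1 [rho k * (_ * _)]mulrA -[leLHS]mulrA ler_wpM2l ?(mulr_ge0 r0 (expR_ge0
    _)) //.
  apply: (@le_trans _ _ (expR (- (M * h)) * D)).
    by rewrite ler_wpM2r // ler_expR lerN2.
  apply: (@le_trans _ _ (expR (- (M * h)) * (h * phi (y (k + j).+1) * expR (M * h)))).
    by rewrite ler_wpM2l ?expR_ge0.
  rewrite mulrCA -expRD addNr expR0 mulr1; exact: lexx.
have s2 : rho (k + j).+1 * (h * phi (y (k + j).+1)) <= rho k * expR (5 * M ^+ 3 * h) *
  D.
  apply: (@le_trans _ _ (rho k * expR (4 * M ^+ 3 * h) * (h * phi (y (k + j).+1)))).
    by rewrite ler_wpM2r.
  rewrite es2 [rho k * (_ * _)]mulrA -[leRHS]mulrA ler_wpM2l ?(mulr_ge0 r0 (expR_ge0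
    _)) //.
  apply: (@le_trans _ _ (expR (M * h) * D)); last first.
    by rewrite ler_wpM2r // ler_expR.
  apply: le_trans (ler_wpM2l (expR_ge0 _) c1).
  rewrite mulrCA -expRD addrN expR0 mulr1; exact: lexx.
have -> : Phi (y (k + j).+1) - Phi (y k) = D + (Phi (y (k + j)) - Phi (y k)).
  by rewrite /D; ring.
clearbody D; rewrite [_ + _ * _ - _]addrAC [_ - _ + _]addrC ![_ * (D + _)]mulrDr.
by split; [exact: lerD s1 IH1 | exact: lerD s2 IH2].
Qed.
End poisson_local_limit.

(** Here g0, gx, g1 stand for Poisson distribution function values far left, near x and far right,
    A, C, B for those of Phi at the same points, and F for Phi x. On the whole range both masses are
    nearly 1, which forces r to be nearly 1; the comparison up to x then gives the claim. *)
Lemma sandwich_arith (R : realType) (eta r W g0 gx g1 A B C F : R) :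
  0 < eta -> eta <= 1 / 4 -> 0 < r -> 1 <= W -> W <= 1 + eta ->
  0 <= g0 -> g0 <= eta -> 0 <= gx -> gx <= 1 -> 1 - 2 * eta <= g1 -> g1 <= 1 ->
  0 <= A -> A <= eta -> 1 - eta <= B -> B <= 1 ->
  A <= C -> C <= F -> F - eta <= C -> F <= 1 ->
  r * (B - A) <= (g1 - g0) * W -> g1 - g0 <= r * (B - A) ->
  r * (C - A) <= (gx - g0) * W -> gx - g0 <= r * (C - A) ->
  `|gx - F| <= 6 * eta.
Proof.
move=> eta0 eta4 r0 W1 W2 G00 G0 gx0 Gx1 G1 G11 A0 A1 B1 B2 AC CF FC F1.
have W0 : 0 <= W by lra.
have D0 : 0 <= C - A by lra.
have D1 : C - A <= F by lra.
have D2 : F - 2 * eta <= C - A by lra.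
have BA : 1 - 2 * eta <= B - A by lra.
have BA1 : B - A <= 1 by lra.
move: (C - A) (B - A) D0 D1 D2 BA BA1 => D K D0 D1 D2 BA BA1 {A B C A0 A1 B1 B2 AC CF
  FC}.
move=> d1 d2 f1 f2.
have up : gx <= F + 6 * eta.
  have u1 : r * (1 - 2 * eta) <= W.
    apply: (@le_trans _ _ (r * K)); first by rewrite ler_pM2l.
    by apply: le_trans d1 _; rewrite -[leRHS]mul1r ler_wpM2r //; lra.
  have u2 : r * (1 - 2 * eta) * D <= W * D by rewrite ler_wpM2r.
  have u3 : W * D <= (1 + eta) * D by rewrite ler_wpM2r.
  have u4 : eta * D <= eta by rewrite ler_piMr ?(ltW eta0) //; lra.
  have u5 : (gx - eta) * (1 - 2 * eta) <= r * D * (1 - 2 * eta).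
    by rewrite ler_wpM2r //; lra.
  have u6 : eta * gx <= eta by rewrite ler_piMr // ltW.
  have u7 := sqr_ge0 eta.
  by lra.
have dn : F - 6 * eta <= gx.
  have l1 : 1 - 3 * eta <= r.
    apply: (@le_trans _ _ (r * K)); first by lra.
    by rewrite ler_piMr // ltW.
  have l2 : (1 - 3 * eta) * D <= r * D by rewrite ler_wpM2r.
  have l3 : g0 * W >= 0 by rewrite mulr_ge0.
  have l4 : gx * W <= gx * (1 + eta) by rewrite ler_wpM2l.
  have l5 : eta * gx <= eta by rewrite ler_piMr // ltW.
  have l6 : eta * D <= eta by rewrite ler_piMr ?(ltW eta0) //; lra.
  by lra.
by rewrite ler_norml; apply/andP; split; lra.
Qed.

Section poisson_clt.
Variable R : realType.
Local Notation Phi := (@normal_cdf R).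

Lemma standardized_floor (l z : R) : 0 < l -> 0 <= l + z * Num.sqrt l ->
  exists k, [/\ standardized l k <= z, z < standardized l k + (Num.sqrt l)^-1 &
    forall j, (standardized l j <= z) = (j <= k)%N].
Proof.
move=> l0 lz; have s0 : 0 < Num.sqrt l by rewrite sqrtr_gt0.
have stdE j : (standardized l j <= z) = (j%:R <= l + z * Num.sqrt l).
  by rewrite /standardized ler_pdivrMr // lerBlDl.
have [k1 k2] := andP (truncn_itv lz).
exists (Num.truncn (l + z * Num.sqrt l)); split.
- by rewrite stdE.
- by rewrite ltNge -standardizedS stdE -ltNge.
- move=> j; rewrite stdE; apply/idP/idP => [jz|jk].
    by rewrite -ltnS -(ltr_nat R); exact: le_lt_trans jz k2.
  by apply: le_trans k1; rewrite ler_nat.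
Qed.

(** Chernoff with t = 1 / sqrt l gives 2 exp (-(M - 2)), and exp (M - 2) >= M - 1 >= 2 / eta. *)
Lemma poisson_tail_small (l eta M : R) N : 0 < l -> 0 < eta ->
  2 + 2 / eta <= M -> (Num.sqrt l)^-1 <= 1 / 3 ->
  \sum_(k < N | (M - 1) * Num.sqrt l <= `|k%:R - l|) poisson_pmf l k <= eta.
Proof.
move=> l0 eta0 hM h3.
have s0 : 0 < Num.sqrt l by rewrite sqrtr_gt0.
have t01 : 0 <= (Num.sqrt l)^-1 <= 1 / 3 by rewrite invr_ge0 ltW.
apply: le_trans (poisson_chernoff l0 ((M - 1) * Num.sqrt l) N t01) _.
rewrite mul_inv_sqrt_sq // mulrCA mulVf ?gt_eqF // mulr1.
have -> : 1 - (M - 1) = - (M - 2) by ring.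
have := expR_ge1Dx (M - 2); rewrite expRN => h.
have h2 : 2 / eta <= expR (M - 2) by lra.
rewrite -ler_pdivlMl // -[leRHS]invrK lef_pV2 ?posrE ?expR_gt0 ?invr_gt0 ?mulr_gt0
  ?invr_gt0 //.
by rewrite invfM invrK.
Qed.

Lemma poisson_clt (x e : R) : 0 < e -> exists2 L : R, 0 < L &
  forall l, L <= l -> exists N0, forall N, (N0 <= N)%N ->
  `|\sum_(k < N | standardized l k <= x) poisson_pmf l k - Phi x| <= e.
Proof.
(* The 6 is the constant of [sandwich_arith], and 1/4 its condition on eta. *)
move=> e0; pose eta := Num.min (e / 6) (1 / 4).
have eta0 : 0 < eta by rewrite lt_min; apply/andP; split; lra.
have eta6 : eta <= e / 6 by rewrite ge_min lexx.
have eta4 : eta <= 1 / 4 by rewrite ge_min lexx orbT.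
have E3 (z : R) : 0 <= z -> z <= eta / 3 -> expR z <= 1 + eta.
  move=> z0 zle; have z2 : z ^+ 2 <= z by rewrite expr2 ler_piMr //; lra.
  by apply: le_trans (expR_le_quadratic _ _) _; lra.
have [M0 hM0] := normal_cdf_tails eta0.
(* The three entries place x well inside the range, make the normal tails beyond M - 1 small, and do
   the same for the Poisson tails. *)
pose M := Num.max (`|x| + 2) (Num.max (M0 + 1) (2 + 2 / eta)).
have Mx : `|x| + 2 <= M by rewrite le_max lexx.
have MM0 : M0 + 1 <= M by rewrite !le_max lexx orbT.
have Meta : 2 + 2 / eta <= M by rewrite !le_max lexx !orbT.
have x0 := normr_ge0 x.
have xle : x <= `|x| := ler_norm x.
have xge : - `|x| <= x by rewrite lerNl -normrN ler_norm.
have [n1 n2] := hM0 (M - 1) ltac:(lra).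
have M1 : 1 <= M by lra.
have xM : x <= M by lra.
have xNM : - (M - 1) <= x by lra.
have NM : - M <= - (M - 1) <= M by apply/andP; split; lra.
have NMx : - M <= x by lra.
have NMM : - M <= M by lra.
clear Mx MM0 hM0 x0 xle xge.
have Mpos : 0 < M by lra.
have M3 : M <= M ^+ 3 by rewrite -[leLHS]expr1; apply: ler_weXn2l.
(* Upper and lower block bounds differ by exp (10 M^3 h), which [E3] bounds by 1 + eta once 30 M^3 h
   <= eta. *)
pose h0 := eta / (30 * M ^+ 3).
have M30 : 0 < 30 * M ^+ 3 by lra.
have h00 : 0 < h0 by rewrite divr_gt0.
exists (h0 ^- 2); first by rewrite invr_gt0 exprn_gt0.
move=> l hl; have l0 : 0 < l by apply: lt_le_trans hl; rewrite invr_gt0 exprn_gt0.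
have s0 : 0 < Num.sqrt l by rewrite sqrtr_gt0.
set h := (Num.sqrt l)^-1.
have hpos : 0 < h by rewrite invr_gt0.
have hle : h <= h0.
  rewrite /h -[leRHS]invrK lef_pV2 ?posrE ?invr_gt0 //.
  have -> : h0^-1 = Num.sqrt (h0^-1 ^+ 2).
    by rewrite sqrtr_sqr ger0_norm // invr_ge0 ltW.
  by rewrite ler_wsqrtr // exprVn.
have M3h : 30 * (M ^+ 3 * h) <= eta.
  by rewrite mulrA -ler_pdivlMl // mulrC.
have Mh : M * h <= M ^+ 3 * h by rewrite ler_pM2r.
have hM : h <= M * h by rewrite ler_peMl // ltW.
have Mh2 : M * h <= 1 / 2 by lra.
have heta : h <= eta by lra.
have h30 : h <= 1 / 3 by lra.
have z10 : 10 * (M ^+ 3 * h) <= eta / 3 by lra.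
have hs : h * Num.sqrt l = 1 by rewrite mulVf // gt_eqF.
have lss : l = Num.sqrt l * Num.sqrt l by rewrite -expr2 sqr_sqrtr // ltW.
have sM : 2 * M <= Num.sqrt l.
  have : M * h * Num.sqrt l <= 1 / 2 * Num.sqrt l by rewrite ler_pM2r.
  by rewrite -mulrA hs mulr1; lra.
have nonneg z : - M <= z -> 0 <= l + z * Num.sqrt l.
  by move=> zM; rewrite {1}lss -mulrDl mulr_ge0 ?sqrtr_ge0 //; lra.
(* The left end is -(M - 1) and not -M: rounding down loses up to h, and [y k0] has to stay above
   -M. *)
have [k0 [a1 a2 a3]] := standardized_floor l0 (nonneg (- (M - 1)) (proj1 (andP NM))).
have [kx [b1 b2 b3]] := standardized_floor l0 (nonneg x NMx).
have [k1 [c1 c2 c3]] := standardized_floor l0 (nonneg M NMM).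
rewrite -/h in a2 b2 c2.
have ay : - M <= standardized l k0 by lra.
have cy : M - 1 <= standardized l k1 by lra.
have k0x : (k0 <= kx)%N by rewrite -b3; exact: le_trans a1 xNM.
have kx1 : (kx <= k1)%N by rewrite -c3; exact: le_trans b1 xM.
have tail N : \sum_(k < N | (M - 1) * Num.sqrt l <= `|k%:R - l|) poisson_pmf l k <= eta.
  exact: poisson_tail_small.
have stdM (k : nat) : k%:R - l = standardized l k * Num.sqrt l.
  by rewrite /standardized mulfVK // gt_eqF.
have G0 : poisson_sum l k0.+1 <= eta.
  apply: le_trans (tail k0.+1); rewrite /poisson_sum [leRHS]big_mkcond.
  apply: ler_sum => k _; rewrite ifT //.
  have : standardized l k <= - (M - 1) by rewrite a3 -ltnS.
  move=> yk; rewrite stdM normrM (ger0_norm (ltW s0)) ler_pM2r //.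
  by rewrite -normrN; apply: le_trans (ler_norm _); rewrite lerNr.
have G1 : 1 - 2 * eta <= poisson_sum l k1.+1.
  have [N hN] := poisson_sum_cvg l0 eta0.
  have hN' : 1 - eta <= poisson_sum l (k1.+1 + N).
    by apply: le_trans hN _; apply: poisson_sum_mono; rewrite ?leq_addl.
  move: hN'; rewrite /poisson_sum.
  rewrite (bigID (fun k : 'I_(k1.+1 + N) => (M - 1) * Num.sqrt l <= `|k%:R - l|)) /=.
  have := tail (k1.+1 + N)%N.
  suff : \sum_(k < k1.+1 + N | ~~ ((M - 1) * Num.sqrt l <= `|k%:R - l|)) poisson_pmf l k
      <= \sum_(k < k1.+1) poisson_pmf l k by lra.
  rewrite (big_ord_widen (k1.+1 + N) (poisson_pmf l) (leq_addr N k1.+1)).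
  rewrite big_mkcond [leRHS]big_mkcond; apply: ler_sum => k _.
  case: ifPn => [|_]; last by case: ifP => // _; exact: poisson_pmf_ge0.
  rewrite -ltNge stdM normrM (ger0_norm (ltW s0)) ltr_pM2r // => yk.
  rewrite ifT // ltnS -c3; apply: le_trans (ler_norm _) (le_trans (ltW yk) _).
  by rewrite gerBl.
pose rho := poisson_ratio l k0.
have rho0 : 0 < rho by exact: poisson_ratio_gt0.
pose E := expR (5 * M ^+ 3 * h).
have E1 : 1 <= E.
  by rewrite -expR0 ler_expR !mulr_ge0 ?ltW // exprn_gt0.
have E2 : E * E <= 1 + eta.
  rewrite -expRD (_ : 5 * M ^+ 3 * h + 5 * M ^+ 3 * h = 10 * (M ^+ 3 * h));
    last by ring.
  by apply: E3; rewrite ?z10 // !mulr_ge0 // ?ltW // exprn_gt0.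
have EV : expR (- (5 * M ^+ 3 * h)) = E^-1 by rewrite expRN.
have [d1 d2] := @poisson_block _ _ l0 M M1 Mh2 k0 (k1 - k0) ay
  ltac:(rewrite subnKC ?(leq_trans k0x) //).
have [f1 f2] := @poisson_block _ _ l0 M M1 Mh2 k0 (kx - k0) ay
  ltac:(rewrite subnKC //; exact: le_trans b1 xM).
rewrite subnKC ?(leq_trans k0x) // -/rho EV in d1 d2.
rewrite subnKC // -/rho EV in f1 f2.
have Gx1 := poisson_sum_le1 l0 kx.+1; have G11 := poisson_sum_le1 l0 k1.+1.
have G00 : 0 <= poisson_sum l k0.+1.
  by apply: sumr_ge0 => k _; exact: poisson_pmf_ge0.
have P0 := normal_cdf_mono a1.
have P00 := normal_cdf_ge0 (standardized l k0).
have P1 : 1 - eta <= Phi (standardized l k1).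
  by apply: le_trans n2 _; exact: normal_cdf_mono.
have P11 := normal_cdf_le1 (standardized l k1).
have Px := normal_cdf_mono b1.
have Px2 := @normal_cdf_lipschitz _ _ _ b1.
have Px1 := normal_cdf_le1 x.
have Px0 : Phi (standardized l k0) <= Phi (standardized l kx).
  apply: normal_cdf_mono; rewrite -(subnKC k0x) standardizedD lerDl.
  by rewrite mulr_ge0 // ltW.
have sumE N : (kx.+1 <= N)%N ->
    \sum_(k < N | standardized l k <= x) poisson_pmf l k = poisson_sum l kx.+1.
  move=> kN; rewrite /poisson_sum (big_ord_widen N (poisson_pmf l) kN).
  by apply: eq_bigl => k; rewrite b3 ltnS.
exists kx.+1 => N /sumE ->.
have r0 : 0 < rho * E by rewrite mulr_gt0 // (lt_le_trans _ E1).
have W1 : 1 <= E * E by rewrite -[leLHS]mulr1 ler_pM.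
have rW (z : R) : rho * E^-1 * z * (E * E) = rho * E * z.
  by field; rewrite gt_eqF // (lt_le_trans _ E1).
have W0 := le_trans ler01 W1.
have {}d1 := ler_wpM2r W0 d1; have {}f1 := ler_wpM2r W0 f1.
rewrite !rW in d1 f1.
apply: le_trans (_ : 6 * eta <= e); last by rewrite mulrC -ler_pdivlMr.
apply: (sandwich_arith eta0 eta4 r0 W1 E2 G00 G0 _ Gx1 G1 G11 P00 _ P1 P11 Px0 Px _ Px1
  d1 d2 f1 f2).
- by apply: sumr_ge0 => k _; exact: poisson_pmf_ge0.
- exact: le_trans P0 n1.
- rewrite lerBlDr -lerBlDl; apply: le_trans Px2 _; apply: le_trans heta.
  by rewrite lerBlDl ltW.
Qed.
End poisson_clt.

(** * Limit laws *)

Section growth.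
Variable R : realType.

Lemma eqO_bound (f g : nat -> R) (C : R) N :
  (forall d, (N <= d)%N -> `|f d| <= C * `|g d|) -> f =O_\oo g.
Proof.
move=> fg; apply/eqOP; near=> k; exists N => // d /= Nd.
apply: le_trans (fg d Nd) _; rewrite ler_wpM2r //.
Unshelve. all: by end_near. Qed.

Lemma pow_geom_bounded (q : R) m : 0 < q < 1 ->
  exists2 C : R, 0 < C & forall d : nat, d%:R ^+ m * q ^+ d <= C.
Proof.
move=> /andP[q0 q1]; pose a := - ln q.
have a0 : 0 < a by rewrite oppr_gt0 ln_lt0 // q0.
(* The quotient comes from the term of degree m.+1 of the exponential series at a * d; the summand 1
   covers d = 0, where [0 ^+ 0 = 1]. *)
exists ((m.+1)`!%:R / a ^+ m.+1 + 1) => [|d].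
  by rewrite addr_gt0 // divr_gt0 ?exprn_gt0 // ltr0n fact_gt0.
have qE : q ^+ d = expR (- (a * d%:R)).
  by rewrite /a mulNr opprK mulrC expRM_natl lnK.
case: d qE => [|d] qE.
  rewrite expr0 mulr1 expr0n; case: (m == 0%N) => /=; rewrite ?lerDr ?addr_ge0 //;
  by rewrite divr_ge0 // exprn_ge0 // ltW.
apply: (@le_trans _ _ (d.+1%:R ^+ m.+1 * q ^+ d.+1)).
  rewrite ler_wpM2r ?exprn_ge0 ?(ltW q0) // exprS ler_peMl ?exprn_ge0 //.
  by rewrite ler1n.
rewrite qE expRN ler_pdivrMr ?expR_gt0 //.
have da : 0 <= a * d.+1%:R by rewrite mulr_ge0 // ltW.
have := expR_ge1Dxn m da => h.
have h2 : (a * d.+1%:R) ^+ m.+1 / (m.+1)`!%:R <= expR (a * d.+1%:R) by lra.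
have f0 : 0 < (m.+1)`!%:R :> R by rewrite ltr0n fact_gt0.
apply: (@le_trans _ _ ((m.+1)`!%:R / a ^+ m.+1 * expR (a * d.+1%:R))); last first.
  by rewrite ler_pM2r ?expR_gt0 // lerDl.
rewrite mulrAC ler_pdivlMr ?exprn_gt0 // -exprMn [_ * a]mulrC.
by rewrite [_ * expR _]mulrC -ler_pdivrMr.
Qed.

Lemma pow_geom_small (q e : R) : 0 < q < 1 -> 0 < e ->
  exists N : nat, forall d : nat, (N <= d)%N -> d%:R * q ^+ d <= e.
Proof.
move=> q01 e0; have [C C0 hC] := pow_geom_bounded 2 q01.
exists (Num.truncn (C / e)).+1 => d Nd.
have d0 : 0 < d%:R :> R by rewrite ltr0n; case: d Nd.
have Cd : C / e <= d%:R.
  have /andP[_ h] := truncn_itv (divr_ge0 (ltW C0) (ltW e0)).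
  by apply: le_trans (ltW h) _; rewrite ler_nat.
rewrite -(ler_pM2l d0) mulrA -expr2; apply: le_trans (hC d) _.
by rewrite -ler_pdivrMr.
Qed.
End growth.

(** * Concentration and normality from Poisson approximation *)

Section limit_laws.
Variables (R : realType) (p q : R).
Variable Y : forall d, {set {set vertex d}} -> nat.
Variables (l V delta : nat -> R) (kappa C : R) (N0 : nat).
Arguments Y {d}.
Hypotheses (p_gt0 : 0 < p) (p_lt_half : p < 1 / 2) (q01 : 0 < q < 1).
Hypotheses (kappa_gt0 : 0 < kappa) (C_gt0 : 0 < C) (N0_gt0 : (0 < N0)%N).
Hypothesis l_ge : forall d, (N0 <= d)%N -> kappa * d%:R <= l d.
Hypothesis approx : forall d, (N0 <= d)%N ->
  forall (A : pred nat) N, (forall k, A k -> (k < N)%N) ->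
  `|Pr p (fun F : {set {set vertex d}} => A (Y F)) -
    \sum_(k < N | A k) poisson_pmf (l d) k| <= delta d.
Hypothesis delta_le : forall d, (N0 <= d)%N -> delta d <= C * (d%:R * q ^+ d).
Hypothesis variance_le : forall d, (N0 <= d)%N -> `|V d - l d| <= delta d * l d.

Lemma mean_gt0 d : (N0 <= d)%N -> 0 < l d.
Proof.
move=> Nd; apply: lt_le_trans (l_ge Nd).
by rewrite mulr_gt0 // ltr0n (leq_trans N0_gt0).
Qed.

Lemma deviation_wvhp (eps : R) : 0 < eps ->
  wvhp p (fun d F => `|(Y F)%:R - l d| < eps * Num.sqrt (d%:R * l d)).
Proof.
move=> eps0; have [q0 q1] := andP q01.
(* The first entry makes the Chernoff exponent at most -(eta eps / 2) d; the second, with l d >=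
   kappa d, keeps tau at most 1/3. *)
pose eta := Num.min (eps / 2) (Num.sqrt kappa / 3).
have sk0 : 0 < Num.sqrt kappa by rewrite sqrtr_gt0.
have eta0 : 0 < eta by rewrite lt_min !divr_gt0.
have eta1 : eta <= eps / 2 by rewrite ge_min lexx.
have eta2 : eta <= Num.sqrt kappa / 3 by rewrite ge_min lexx orbT.
pose a := eta * eps / 2; pose b := - ln q.
have a0 : 0 < a by rewrite !mulr_gt0 // invr_gt0.
have b0 : 0 < b by rewrite oppr_gt0 ln_lt0.
(* A rate strictly below a and b: the surplus exponential decay absorbs C d in one error term and
   the constant in the other, leaving half of exp (-k d) for each. *)
pose k := Num.min a b / 2.
have k0 : 0 < k by rewrite divr_gt0 // lt_min a0.
have mina : Num.min a b <= a by rewrite ge_min lexx.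
have ka : k < a by rewrite /k; lra.
have minb : Num.min a b <= b by rewrite ge_min lexx orbT.
have kb : k < b by rewrite /k; lra.
have geom (c : R) : 0 < c -> 0 < expR (- c) < 1 by move=> c0;
  rewrite expR_gt0 expR_lt1 oppr_lt0.
have c2 : 0 < 1 / (2 * C) by rewrite divr_gt0 // mulr_gt0.
have [N1 h1] := pow_geom_small (geom (b - k) ltac:(lra)) c2.
have [N2 h2] := pow_geom_small (geom (a - k) ltac:(lra)) (ltac:(lra) : 0 < 1 / 4 :> R).
exists k => //; exists (maxn N0 (maxn N1 N2)) => // d /=.
rewrite !geq_max => /and3P[Nd Nd1 Nd2].
have l0 := mean_gt0 Nd; have d0 : 0 < d%:R :> R by rewrite ltr0n (leq_trans N0_gt0).
set tau := eta * Num.sqrt (d%:R / l d).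
have tau13 : 0 <= tau <= 1 / 3.
  rewrite mulr_ge0 ?sqrtr_ge0 ?(ltW eta0) //=.
  have sle : Num.sqrt (d%:R / l d) <= (Num.sqrt kappa)^-1.
    rewrite -sqrtrV ?(ltW kappa_gt0) // ler_wsqrtr // ler_pdivrMr // ler_pdivlMl //.
    exact: l_ge.
  apply: (@le_trans _ _ (eta * (Num.sqrt kappa)^-1)); first by rewrite ler_pM2l.
  by rewrite ler_pdivrMr // mulrC mulrA mulr1.
have := poisson_approx_tail l0 (approx Nd)
  (eps * Num.sqrt (d%:R * l d)) tau13.
apply: le_trans; rewrite lerB //.
(* tau is chosen so that both terms of the Chernoff exponent are linear in d. *)
have e1 : l d * tau ^+ 2 - tau * (eps * Num.sqrt (d%:R * l d)) <= - (a * d%:R).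
  have -> : l d * tau ^+ 2 = eta ^+ 2 * d%:R.
    by rewrite /tau exprMn sqr_sqrtr ?divr_ge0 ?ltW //; field; rewrite gt_eqF.
  have -> : tau * (eps * Num.sqrt (d%:R * l d)) = eta * eps * d%:R.
    rewrite /tau mulrACA -sqrtrM ?divr_ge0 ?ltW //.
    have -> : d%:R / l d * (d%:R * l d) = d%:R ^+ 2 by field; rewrite gt_eqF.
    by rewrite sqrtr_sqr ger0_norm // ltW.
  rewrite /a -subr_ge0.
  have -> : - (eta * eps / 2 * d%:R) - (eta ^+ 2 * d%:R - eta * eps * d%:R) =
     eta * (eps / 2 - eta) * d%:R by field.
  by rewrite !mulr_ge0 // ?subr_ge0 // ltW.
have qE : q ^+ d = expR (- b * d%:R) by rewrite /b opprK mulrC expRM_natl lnK.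
have split_exp (c : R) : expR (- c * d%:R) = expR (- k * d%:R) * expR (- (c - k)) ^+ d.
  by rewrite -expRM_natr -expRD; congr expR; ring.
have ek := expR_gt0 (- k * d%:R).
have ds (c : R) : 1 * expR (- (c - k)) ^+ d <= d%:R * expR (- (c - k)) ^+ d.
  by rewrite ler_pM2r ?exprn_gt0 ?expR_gt0 // ler1n (leq_trans N0_gt0).
have half1 : C * (d%:R * q ^+ d) <= expR (- k * d%:R) * (1 / 2).
  rewrite qE split_exp (_ : C * _ = expR (- k * d%:R) * (C * (d%:R * expR (- (b - k))
    ^+ d))).
    rewrite ler_pM2l // -ler_pdivlMl //; apply: le_trans (h1 d Nd1) _.
    by rewrite invfM mulrCA mulrC !mul1r mulrC.
  by ring.
have half2 : 2 * expR (- (a * d%:R)) <= expR (- k * d%:R) * (1 / 2).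
  rewrite -mulNr split_exp mulrCA ler_pM2l //.
  by have := h2 d Nd2; have := ds a; lra.
have h3 := delta_le Nd.
have h4 : 2 * expR (l d * tau ^+ 2 - tau * (eps * Num.sqrt (d%:R * l d))) <=
    2 * expR (- (a * d%:R)) by rewrite ler_pM2l // ler_expR.
lra.
Qed.

(** Since l d >= kappa d, the width sqrt (kappa d (l d)) is at most l d, so the previous bound
    applies with eps sqrt kappa. *)
Lemma relative_deviation_wvhp (eps : R) : 0 < eps ->
  wvhp p (fun d F => `|(Y F)%:R - l d| < eps * l d).
Proof.
move=> eps0; have sk0 : 0 < Num.sqrt kappa by rewrite sqrtr_gt0.
have [k k0 [N _ h]] := deviation_wvhp (mulr_gt0 eps0 sk0).
exists k => //; exists (maxn N N0) => // d /=; rewrite geq_max => /andP[Nd N0d].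
apply: le_trans (h d Nd) _; apply: Pr_mono => // F /lt_le_trans; apply.
have l0 := mean_gt0 N0d.
have lE : l d = Num.sqrt (l d ^+ 2) by rewrite sqrtr_sqr ger0_norm // ltW.
rewrite -mulrA ler_pM2l // -sqrtrM ?(ltW kappa_gt0) // [leRHS]lE.
by rewrite ler_wsqrtr // mulrA expr2 ler_pM2r // l_ge.
Qed.

Lemma dTV_bigO (f : nat -> R) :
  (exists C' N, forall d, (N <= d)%N -> delta d <= C' * `|f d|) ->
  exists2 e : nat -> R, (e =O_\oo f) &
     \forall d \near \oo,
       dTV (fun k => Pr p (fun F : {set {set vertex d}} => (Y F)%:R == k%:R :> R))
         (poisson_pmf (l d)) = (e d)%:E.
Proof.
move=> [C' [N hN]].
pose D d := dTV (fun k => Pr p (fun F : {set {set vertex d}} => (Y F)%:R == k%:R :> R))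
         (poisson_pmf (l d)).
have hD d : (N0 <= d)%N -> (0%:E <= D d <= (delta d)%:E)%E.
  by move=> Nd; exact: poisson_approx_dTV (approx Nd).
exists (fun d => fine (D d)).
  apply: (@eqO_bound _ _ _ C' (maxn N N0)) => d; rewrite geq_max => /andP[Nd N0d].
  apply: le_trans (hN d Nd); have /andP[] := hD d N0d.
  by case: (D d) => [x| |] //=; rewrite !lee_fin => x0 xd; rewrite ger0_norm.
exists N0 => // d /= Nd; have /andP[] := hD d Nd; rewrite -/(D d).
by case: (D d).
Qed.

(** [poisson_clt] treats a fixed threshold, but normalising by the variance instead of l moves the
    threshold to x * sg, with sg depending on d. As sg is near 1, the event lies between those for x
    - eta and x + eta, and Phi is Lipschitz. *)
Lemma standardized_cvg : cvg_in_distribution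
  (fun d x => Pr p (fun F : {set {set vertex d}} =>
      ((Y F)%:R - l d) / Num.sqrt (V d) <= x))
  (@normal_cdf R).
Proof.
move=> x _; apply/cvgrPdist_le => e e0.
pose eta := e / 4; have eta0 : 0 < eta by rewrite divr_gt0.
have [L1 L10 hL1] := poisson_clt (x - eta) eta0.
have [L2 L20 hL2] := poisson_clt (x + eta) eta0.
(* m bounds the Chen-Stein error and the relative error of the variance: 1/2 keeps the variance
   positive, and the last entry gives |x * sg - x| <= eta. *)
pose m := Num.min eta (Num.min (1 / 2) (eta / (`|x| + 1))).
have m0 : 0 < m.
  by rewrite !lt_min eta0 !divr_gt0 // ltr_pwDr.
have meta : m <= eta by rewrite ge_min lexx.
have mhalf : m <= 1 / 2 by rewrite !ge_min lexx orbT.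
have mx : m * `|x| <= eta.
  have x1 : 0 < `|x| + 1 by rewrite ltr_pwDr.
  have : m <= eta / (`|x| + 1) by rewrite !ge_min lexx !orbT.
  rewrite ler_pdivlMr // mulrDr mulr1; lra.
have [N1 h1] := pow_geom_small q01 (divr_gt0 m0 C_gt0).
pose N2 := (Num.truncn (Num.max L1 L2 / kappa)).+1.
exists (maxn N0 (maxn N1 N2)) => // d /=.
rewrite !geq_max => /and3P[Nd Nd1 Nd2].
have l0 := mean_gt0 Nd; have s0 : 0 < Num.sqrt (l d) by rewrite sqrtr_gt0.
have dm : delta d <= m.
  apply: le_trans (delta_le Nd) _; rewrite -ler_pdivlMl // [C^-1 * _]mulrC; exact: h1.
have Lmax : Num.max L1 L2 <= l d.
  apply: le_trans (l_ge Nd); rewrite -ler_pdivrMl // mulrC.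
  have M0 : 0 <= Num.max L1 L2 / kappa by rewrite divr_ge0 ?ltW // lt_max L10.
  have /andP[_ h] := truncn_itv M0; apply: le_trans (ltW h) _.
  by rewrite ler_nat.
have lL1 : L1 <= l d by apply: le_trans Lmax; rewrite le_max lexx.
have lL2 : L2 <= l d by apply: le_trans Lmax; rewrite le_max lexx orbT.
have vm : `|V d - l d| <= m * l d.
  by apply: le_trans (variance_le Nd) _; rewrite ler_pM2r.
have V0 : 0 < V d.
  have ml : m * l d <= 1 / 2 * l d by rewrite ler_pM2r.
  by have /ler_normlP[h _] := vm; lra.
pose sg := Num.sqrt (V d / l d).
have sg0 : 0 < sg by rewrite sqrtr_gt0 divr_gt0.
have sgm : `|sg - 1| <= m.
  have E : (sg - 1) * (sg + 1) = (V d - l d) / l d.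
    have -> : (sg - 1) * (sg + 1) = sg ^+ 2 - 1 by ring.
    by rewrite sqr_sqrtr ?divr_ge0 ?ltW //; field; rewrite gt_eqF.
  have E2 : `|sg - 1| * (sg + 1) <= m.
    rewrite -[sg + 1 in leLHS]ger0_norm ?addr_ge0 ?(ltW sg0) // -normrM E normrM.
    by rewrite normfV (ger0_norm (ltW l0)) ler_pdivrMr.
  apply: le_trans E2; rewrite ler_peMr //; lra.
have sV : Num.sqrt (V d) = sg * Num.sqrt (l d).
  by rewrite /sg -sqrtrM ?divr_ge0 ?ltW // divfK // gt_eqF.
have evE (F : {set {set vertex d}}) : (((Y F)%:R - l d) / Num.sqrt (V d) <= x) =
    (standardized (l d) (Y F) <= x * sg).
  by rewrite /standardized sV ler_pdivrMr ?mulr_gt0 // ler_pdivrMr // mulrA.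
have xs : `|x * sg - x| <= eta.
  rewrite -[X in _ - X]mulr1 -mulrBr normrM; apply: le_trans mx.
  by rewrite mulrC ler_wpM2r.
have /ler_normlP[xs1 xs2] := xs.
have approx1 z L : (forall l, L <= l -> exists N0, forall N, (N0 <= N)%N ->
    `|\sum_(k < N | standardized l k <= z) poisson_pmf l k - normal_cdf z| <= eta) ->
    L <= l d ->
    `|Pr p (fun F : {set {set vertex d}} => standardized (l d) (Y F) <= z) - normal_cdf
      z|
      <= 2 * eta.
  move=> hL Ll; have [Na hNa] := hL _ Ll.
  have [Nb hNb] := poisson_approx_large (approx Nd).
  have ha := hNa (maxn Na Nb) (leq_maxl _ _).
  have hb := hNb (maxn Na Nb) (fun k => standardized (l d) k <= z) (leq_maxr _ _).
  move/ler_normlP: ha => [ha1 ha2]; move/ler_normlP: hb => [hb1 hb2].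
  by rewrite ler_norml; apply/andP; split; lra.
have /ler_normlP[p1 p2] := approx1 _ _ hL1 lL1.
have /ler_normlP[p3 p4] := approx1 _ _ hL2 lL2.
have lip1 := @normal_cdf_lipschitz _ (x - eta) x ltac:(lra).
have lip2 := @normal_cdf_lipschitz _ x (x + eta) ltac:(lra).
have -> : Pr p (fun F : {set {set vertex d}} => ((Y F)%:R - l d) / Num.sqrt (V d) <= x)
  =
  Pr p (fun F : {set {set vertex d}} => standardized (l d) (Y F) <= x * sg).
  by apply: eq_Pr => F; rewrite evE.
have b1 : Pr p (fun F : {set {set vertex d}} => standardized (l d) (Y F) <= x - eta) <=
  Pr p (fun F : {set {set vertex d}} => standardized (l d) (Y F) <= x * sg).
  by apply: Pr_mono => // F h; apply: le_trans h _; lra.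
have b2 : Pr p (fun F : {set {set vertex d}} => standardized (l d) (Y F) <= x * sg) <=
  Pr p (fun F : {set {set vertex d}} => standardized (l d) (Y F) <= x + eta).
  by apply: Pr_mono => // F h; apply: le_trans h _; lra.
have e4 : e = 4 * eta by rewrite /eta; field.
by rewrite ler_norml e4; apply/andP; split; lra.
Qed.
End limit_laws.

(** * Falling factorials and eventual bounds *)

Section falling_factorial.
Implicit Types d k m : nat.

Lemma ffact_le_exp d k m : (d ^_ (k + m) <= d ^_ k * d ^ m)%N.
Proof.
elim: m => [|m IH]; first by rewrite addn0 expn0 muln1.
by rewrite addnS ffactnSr expnSr mulnA leq_mul // leq_subr.
Qed.

Lemma leq_ffact_exp d m : (d ^_ m <= d ^ m)%N.
Proof. by have := ffact_le_exp d 0 m; rewrite ffactn0 mul1n. Qed.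

Lemma leq_ffact2 d k m : (k <= m <= d)%N -> (d ^_ k <= d ^_ m)%N.
Proof.
case/andP=> /subnKC <-; elim: (m - k)%N => [|j IH] kd; first by rewrite addn0.
rewrite addnS in kd *; apply: leq_trans (IH (ltnW kd)) _.
by rewrite ffactnSr leq_pmulr // subn_gt0.
Qed.

Lemma leq_bin_exp d k : ('C(d, k) <= d ^ k)%N.
Proof.
apply: leq_trans (leq_ffact_exp d k); rewrite -bin_ffact.
by rewrite leq_pmulr // fact_gt0.
Qed.

Lemma ffact_gap d k m : (k < m)%N -> (2 * m <= d)%N ->
  (d ^_ k * d <= 2 * d ^_ m)%N.
Proof.
case: m => // m km md; rewrite ffactnSr mulnCA; apply: leq_mul.
  by apply: leq_ffact2; lia.
lia.
Qed.
End falling_factorial.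

Section eventual_bounds.
Variable R : realType.

(** One-sided: no absolute values, and no sign is imposed on C. *)
Definition eventually_le (u g : nat -> R) : Prop :=
  exists C N, forall d, (N <= d)%N -> u d <= C * g d.

Lemma eventually_le_sum (I : Type) (s : seq I) (Q : pred I) (u : I -> nat -> R) g :
  (forall i, Q i -> eventually_le (u i) g) ->
  eventually_le (fun d => \sum_(i <- s | Q i) u i d) g.
Proof.
move=> h; elim: s => [|i s [C1 [N1 IH]]].
  by exists 0, 0%N => d _; rewrite big_nil mul0r.
have [Qi|Qi] := boolP (Q i); last first.
  by exists C1, N1 => d /IH; rewrite big_cons (negPf Qi).
have [C2 [N2 h2]] := h i Qi.
exists (C2 + C1), (maxn N1 N2) => d; rewrite geq_max => /andP[d1 d2].
by rewrite big_cons Qi mulrDl lerD ?h2 ?IH.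
Qed.

Lemma eventually_leZ a (u g : nat -> R) : 0 <= a -> eventually_le u g ->
  eventually_le (fun d => a * u d) g.
Proof.
move=> a0 [C [N h]]; exists (a * C), N => d /h ug.
by rewrite -mulrA ler_wpM2l.
Qed.
End eventual_bounds.

(** * Asymptotics of the expectation and of the error *)

Section expectation_asymptotics.
Variables (R : realType) (p : R) (r : nat) (n : 'I_r -> nat).
Variable H : forall i : 'I_r, cgraph (n i).
Hypotheses (p_gt0 : 0 < p) (p_lt_half : p < 1 / 2)
  (H_cube : forall i, cube_subgraph (H i))
  (H_conn : forall i, gconnected (H i))
  (H_noniso : forall i j, i != j -> ~~ ambient_iso (H i) (H j)).
Variables (t s : nat).
Hypotheses
  (t_min : forall i, (t <= nverts (H i))%N)
  (s_att : exists2 i, nverts (H i) = t & cube_span (H i) = s)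
  (s_max : forall i, nverts (H i) = t -> (cube_span (H i) <= s)%N).
Local Notation q := (1 - p).

Let lambda d : R :=
  Ex p (fun F : {set {set vertex d}} => (\sum_(i < r) comp_count (H i) F)%:R).

Let q01 : 0 < q < 1.
Proof. by have h := p_lt_half; have h0 := p_gt0; apply/andP; split; lra. Qed.
Let q_gt0 : 0 < q. Proof. by case/andP: q01. Qed.
Let q_le1 : q <= 1. Proof. by case/andP: q01 => _ /ltW. Qed.

Let term i d : R := beta_coef p (cube_span (H i)) (H i) *
  (d ^_ cube_span (H i))%:R * (2 * q ^+ nverts (H i)) ^+ d.

Let extremal i := (nverts (H i) == t) && (cube_span (H i) == s).

Let c : R := \sum_(i < r | extremal i) beta_coef p s (H i).

Let main d : R := c * (d ^_ s)%:R * (2 * q ^+ t) ^+ d.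

Lemma beta_coef_gt0 k i : 0 < beta_coef p k (H i).
Proof.
by rewrite /beta_coef !mulr_gt0 ?exprn_gt0 ?divr_gt0 ?ltr0n ?muln_gt0 ?expn_gt0
  ?fact_gt0 ?exprn_gt0.
Qed.

Lemma expectation_terms d : lambda d = \sum_(i < r) term i d.
Proof.
rewrite /lambda mean_isolated_count //; apply: eq_bigr => i _.
exact: copies_expectation.
Qed.

Lemma term_ge0 i d : 0 <= term i d.
Proof.
apply: mulr_ge0.
  by apply: mulr_ge0 => //; exact: ltW (beta_coef_gt0 _ _).
by apply: exprn_ge0; apply: mulr_ge0 => //; apply: exprn_ge0; exact: ltW.
Qed.

Lemma extremal_gt0 : 0 < c.
Proof.
have [i it is_] := s_att; rewrite /c (bigD1 i) /extremal ?it ?is_ ?eqxx //=.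
apply: ltr_pwDl; first exact: beta_coef_gt0.
by apply: sumr_ge0 => j _; exact: ltW (beta_coef_gt0 _ _).
Qed.

Lemma expectation_split d :
  lambda d = main d + \sum_(i < r | ~~ extremal i) term i d.
Proof.
rewrite expectation_terms (bigID extremal) /=; congr (_ + _).
rewrite /main /c !big_distrl /=; apply: eq_bigr => i /andP[/eqP it /eqP is_].
by rewrite /term it is_.
Qed.

Lemma main_gt0 d : (s <= d)%N -> 0 < main d.
Proof.
move=> sd; rewrite !mulr_gt0 ?extremal_gt0 ?exprn_gt0 ?mulr_gt0 ?exprn_gt0 //.
by rewrite ltr0n ffact_gt0.
Qed.

(** The relative error is exactly the sum of the non-extremal terms over the main term, so these
    terms can be bounded one by one. *)
Lemma expectation_factor (f : nat -> R) : (forall d, 0 <= f d) ->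
  (forall i, ~~ extremal i -> eventually_le (term i) (fun d => f d * main d)) ->
  eq_factor_bigO f lambda main.
Proof.
move=> f0 h; have [C [N hN]] := eventually_le_sum (index_enum _) h.
exists (fun d => (lambda d - main d) / main d); last first.
  exists s => // d /= sd; rewrite mulrDl mul1r divfK ?gt_eqF ?main_gt0 //.
  by rewrite addrC subrK.
apply: (@eqO_bound _ _ _ C (maxn N s)) => d; rewrite geq_max => /andP[Nd sd].
have m0 := main_gt0 sd.
rewrite expectation_split addrAC subrr add0r normrM normfV.
rewrite (ger0_norm (ltW m0)) ler_pdivrMr // (ger0_norm (f0 d)) -mulrA.
rewrite ger0_norm ?hN //.
by apply: sumr_ge0 => i _; exact: term_ge0.
Qed.

(** In fact an equality: every vertex beyond t costs a factor q^d. *)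
Lemma term_le_geom i d : (t < nverts (H i))%N ->
  term i d <= beta_coef p (cube_span (H i)) (H i) * (d ^_ cube_span (H i))%:R *
    (q ^+ d) ^+ (nverts (H i) - t) * (2 * q ^+ t) ^+ d.
Proof.
move=> lt; rewrite le_eqVlt; apply/orP; left; apply/eqP.
rewrite /term -[in LHS](subnKC (ltnW lt)) -[RHS]mulrA; congr (_ * _).
by rewrite exprD mulrA [LHS]exprMn mulrC -!exprM mulnC.
Qed.

(** A graph of order t with smaller span loses a factor of order d in the falling factorial; a
    larger graph loses a power of q^d, which beats every power of d. *)
Lemma term_bound_inv i : ~~ extremal i ->
  eventually_le (term i) (fun d => 1 / d%:R * main d).
Proof.
have [lt _|le ni] := ltnP t (nverts (H i)); last first.
  have it : nverts (H i) = t by apply/eqP; rewrite eqn_leq le t_min.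
  have si : (cube_span (H i) < s)%N.
    by rewrite ltn_neqAle s_max // andbT; move: ni; rewrite /extremal it eqxx.
  exists (2 * beta_coef p (cube_span (H i)) (H i) / c), (2 * s).+1 => d hd.
  have d0 : 0 < d%:R :> R by rewrite ltr0n; lia.
  have c0 := extremal_gt0; have b0 := beta_coef_gt0 (cube_span (H i)) i.
  rewrite /term /main it; set Q := (2 * q ^+ t) ^+ d.
  have Q0 : 0 < Q by rewrite exprn_gt0 // mulr_gt0 // exprn_gt0.
  have xy : (d ^_ cube_span (H i))%:R * d%:R <= 2 * (d ^_ s)%:R :> R.
    by rewrite -!natrM ler_nat ffact_gap // ltnW.
  set b := beta_coef _ _ _ in b0 *; set x := (d ^_ _)%:R in xy *.
  have -> : 2 * b / c * (1 / d%:R * (c * (d ^_ s)%:R * Q)) =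
      b * (2 * (d ^_ s)%:R / d%:R) * Q by field; rewrite !gt_eqF.
  by rewrite ler_pM2r // ler_pM2l // ler_pdivlMr.
have [C C0 hC] := pow_geom_bounded (cube_span (H i)).+1 q01.
exists (beta_coef p (cube_span (H i)) (H i) * C / c), s.+1 => d hd.
have d0 : 0 < d%:R :> R by rewrite ltr0n; lia.
have c0 := extremal_gt0; have b0 := beta_coef_gt0 (cube_span (H i)) i.
apply: le_trans (term_le_geom d lt) _.
rewrite /main; set Q := (2 * q ^+ t) ^+ d.
have Q0 : 0 < Q by rewrite exprn_gt0 // mulr_gt0 // exprn_gt0.
set b := beta_coef _ _ _ in b0 *.
have qd0 : 0 < q ^+ d by rewrite exprn_gt0.
have qd1 : q ^+ d <= 1 by rewrite exprn_ile1 // ltW.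
have h1 : (d ^_ cube_span (H i))%:R * (q ^+ d) ^+ (nverts (H i) - t) <= C / d%:R.
  rewrite ler_pdivlMr //; apply: le_trans (hC d).
  rewrite exprSr mulrAC; apply: ler_pM.
  - by rewrite mulr_ge0 // ltW.
  - by rewrite exprn_ge0 // ltW.
  - by rewrite ler_pM2r // -natrX ler_nat leq_ffact_exp.
  - by rewrite -[leRHS]expr1 ler_wiXn2l ?(ltW qd0) ?qd1 ?subn_gt0.
have h2 : 1 <= (d ^_ s)%:R :> R by rewrite ler1n ffact_gt0 ltnW.
apply: (@le_trans _ _ (b * (C / d%:R) * Q)).
  by rewrite ler_pM2r // -[leLHS]mulrA ler_pM2l.
have -> : b * C / c * (1 / d%:R * (c * (d ^_ s)%:R * Q)) =
    b * (C / d%:R) * Q * (d ^_ s)%:R by field; rewrite !gt_eqF.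
rewrite ler_peMr // ltW //; apply: mulr_gt0 => //; apply: mulr_gt0 => //.
exact: divr_gt0.
Qed.

(** The inequalities span < v <= 2^span leave one value for v <= 3; for v = 4 they would allow both
    2 and 3. *)
Lemma small_span i : nverts (H i) \in [:: 1; 2; 3]%N ->
  cube_span (H i) = (nverts (H i) - 1)%N.
Proof.
have := span_lt_nverts (H_cube i) (H_conn i).
have := nverts_le_span (H_conn i).
by case: (nverts _) => [|[|[|[|v]]]] //; case: (cube_span _) => [|[|[|k]]].
Qed.

(** By [small_span] every graph of order t is extremal. One of order t + k has span at most s + k,
    so its term is at most a constant times (d q^d)^k times the main term, with k >= 1. *)
Lemma term_bound_geom i : t \in [:: 1; 2; 3]%N -> ~~ extremal i ->
  eventually_le (term i) (fun d => d%:R * q ^+ d * main d).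
Proof.
move=> t3 ni.
have st : (s = t - 1)%N.
  by have [j jt <-] := s_att; rewrite small_span ?jt.
have lt : (t < nverts (H i))%N.
  rewrite ltn_neqAle t_min andbT; apply: contra ni => /eqP it.
  by rewrite /extremal small_span -it // st !eqxx.
have t0 : (0 < t)%N by case: (t) t3.
set k := (nverts (H i) - t)%N.
have k0 : (0 < k)%N by rewrite subn_gt0.
have sk : (cube_span (H i) <= s + k)%N.
  have := span_lt_nverts (H_cube i) (H_conn i); rewrite /k st; lia.
have [N1 hN] := pow_geom_small q01 (@ltr01 R).
exists (beta_coef p (cube_span (H i)) (H i) / c), (maxn N1 (s + k)) => d.
rewrite geq_max => /andP[Nd skd].
have c0 := extremal_gt0; have b0 := beta_coef_gt0 (cube_span (H i)) i.
apply: le_trans (term_le_geom d lt) _.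
rewrite /main -/k; set Q := (2 * q ^+ t) ^+ d.
have Q0 : 0 < Q by rewrite exprn_gt0 // mulr_gt0 // exprn_gt0.
set b := beta_coef _ _ _ in b0 *.
have qd0 : 0 < q ^+ d by rewrite exprn_gt0.
have h1 : (d ^_ cube_span (H i))%:R <= (d ^_ s)%:R * d%:R ^+ k :> R.
  rewrite -natrX -natrM ler_nat; apply: leq_trans (ffact_le_exp d s k).
  by apply: leq_ffact2; rewrite sk.
have -> : b / c * (d%:R * q ^+ d * (c * (d ^_ s)%:R * Q)) =
   b * ((d ^_ s)%:R * (d%:R * q ^+ d)) * Q by field; rewrite gt_eqF.
rewrite ler_pM2r // -[leLHS]mulrA ler_pM2l //.
apply: (@le_trans _ _ ((d ^_ s)%:R * d%:R ^+ k * (q ^+ d) ^+ k)).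
  by rewrite ler_pM2r // exprn_gt0.
rewrite -mulrA -exprMn ler_wpM2l // -[leRHS]expr1 ler_wiXn2l ?hN //.
by rewrite mulr_ge0 // ltW.
Qed.

Lemma expectation_inv : eq_factor_bigO (fun d => 1 / d%:R) lambda main.
Proof.
by apply: expectation_factor => [d|i /term_bound_inv]; rewrite ?divr_ge0.
Qed.

Lemma expectation_geom : t \in [:: 1; 2; 3]%N ->
  s = (t - 1)%N /\ eq_factor_bigO (fun d => d%:R * q ^+ d) lambda main.
Proof.
move=> t3; split; first by have [j jt <-] := s_att; rewrite small_span ?jt.
apply: expectation_factor => [d|i]; last exact: term_bound_geom.
by rewrite mulr_ge0 // exprn_ge0 // ltW.
Qed.

(** As span < v, the number of close copies is O(d^v), so the i-th term is O((d q^d)^v); d q^d is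
    eventually at most 1, and v >= t. *)
Lemma approx_error_bound M :
  eventually_le (approx_error p H M) (fun d => (d%:R * q ^+ d) ^+ t).
Proof.
apply: eventually_leZ.
  by rewrite addr_ge0 // invr_ge0 exprn_ge0 // ltW.
apply: eventually_le_sum => i _.
have [N1 hN] := pow_geom_small q01 (@ltr01 R).
set A := p ^+ nedges (H i) / q ^+ (2 * nedges (H i) + nmissing (H i)).
have A0 : 0 <= A by rewrite divr_ge0 // exprn_ge0 // ltW.
exists (2 * M%:R * A), (maxn N1 1) => d; rewrite geq_max => /andP[Nd d1].
set ti := nverts (H i).
have -> : copy_prob p H d i = A * (q ^+ d) ^+ ti.
  by rewrite /copy_prob /A -exprM mulrAC.
have h1 : (M * d.+1 * 'C(d, cube_span (H i)))%:R <= 2 * M%:R * d%:R ^+ ti :> R.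
  rewrite -natrX -!natrM ler_nat -mulnA mulnAC -mulnA [(M * _)%N]mulnC mulnA leq_mul2r.
  apply/orP; right.
  have lt := span_lt_nverts (H_cube i) (H_conn i).
  apply: (@leq_trans ((2 * d) * d ^ cube_span (H i))).
    by apply: leq_mul; [lia | exact: leq_bin_exp].
  by rewrite -mulnA -expnS leq_mul2l leq_pexp2l.
have qd0 : 0 <= A * (q ^+ d) ^+ ti by rewrite mulr_ge0 // !exprn_ge0 // ltW.
apply: le_trans (ler_wpM2r qd0 h1) _.
have -> : 2 * M%:R * d%:R ^+ ti * (A * (q ^+ d) ^+ ti) =
   2 * M%:R * A * (d%:R * q ^+ d) ^+ ti by rewrite exprMn mulrACA.
apply: ler_wpM2l; first by apply: mulr_ge0 => //; exact: mulr_ge0.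
apply: ler_wiXn2l; [|exact: hN|exact: t_min].
by rewrite mulr_ge0 // exprn_ge0 // ltW.
Qed.

(** If s > 0, the falling factorial is already at least d, even when 2 q^t = 1. If s = 0, then t =
    1, and p < 1/2 makes 2 q = 1 + x with x > 0, so Bernoulli's inequality applies. *)
Lemma main_linear : 1 <= 2 * q ^+ t ->
  exists2 kappa : R, 0 < kappa & forall d, (s <= d)%N -> kappa * d%:R <= main d.
Proof.
move=> q2; have c0 := extremal_gt0.
have [s0|s0] := posnP s; last first.
  exists c => // d sd; rewrite /main -mulrA ler_pM2l //.
  apply: (@le_trans _ _ (d ^_ s)%:R).
    by rewrite ler_nat -[leqLHS]ffactn1; apply: leq_ffact2; rewrite s0.
  by rewrite ler_peMr // exprn_ege1.
have t1 : t = 1%N.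
  have [i it is_] := s_att.
  have := nverts_le_span (H_conn i); have := span_lt_nverts (H_cube i) (H_conn i).
  by rewrite it is_ s0 expn0; lia.
pose x : R := 2 * q - 1.
have x0 : 0 < x by rewrite /x; have h := p_lt_half; lra.
exists (c * x); first exact: mulr_gt0.
move=> d _; rewrite /main s0 ffactn0 mulr1 t1 expr1 -mulrA ler_pM2l //.
have -> : 2 * q = 1 + x by rewrite /x; ring.
clearbody x.
elim: d => [|d IH]; first by rewrite mulr0.
rewrite -[d.+1%:R]natr1 mulrDr mulr1 exprS mulrDl mul1r; apply: lerD => //.
by rewrite ler_peMr ?(ltW x0) // exprn_ege1 // lerDl ltW.
Qed.
End expectation_asymptotics.

Lemma max_order_ge (R : realType) (p : R) (t : nat) : 0 < p < 1 ->
  t%:Z <= max_order p -> 1 <= 2 * (1 - p) ^+ t.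
Proof.
move=> /andP[p0 p1]; have q0 : 0 < 1 - p by rewrite subr_gt0.
have q1 : 1 < 1 / (1 - p) by rewrite ltr_pdivlMr // mul1r; lra.
have l2 : 0 < ln 2 :> R by rewrite ln_gt0 // ltr1n.
have lq : 0 < ln (1 / (1 - p)) by exact: ln_gt0.
have y0 : 0 < 1 / (1 - p) by rewrite divr_gt0.
have lnE : t%:R * ln (1 / (1 - p)) = ln ((1 / (1 - p)) ^+ t) by rewrite lnXn //
  mulr_natl.
rewrite /max_order floor_ge_int ler_pdivlMr ?divr_gt0 // mulrA ler_pdivrMr // [1 * ln
  2]mul1r.
rewrite -[t%:~R]/(t%:R : R) lnE ler_ln ?posrE ?exprn_gt0 //.
by rewrite expr_div_n expr1n ler_pdivrMr ?exprn_gt0.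
Qed.

Theorem theorem5 (R : realType) (p : R) (p_gt0 : 0 < p) (p_lt_half : p < 1 / 2)
  (r : nat) (r_ge1 : (1 <= r)%N)
  (n : 'I_r -> nat) (H : forall i : 'I_r, cgraph (n i))
  (H_cube : forall i, cube_subgraph (H i))
  (H_conn : forall i, gconnected (H i))
  (H_small : forall i, (nverts (H i))%:Z <= max_order p)
  (H_noniso : forall i j, i != j -> ~~ ambient_iso (H i) (H j))
  (t s : nat)
  (t_att : exists i, nverts (H i) = t)
  (t_min : forall i, (t <= nverts (H i))%N)
  (s_att : exists2 i, nverts (H i) = t & cube_span (H i) = s)
  (s_max : forall i, nverts (H i) = t -> (cube_span (H i) <= s)%N) :
  let q : R := 1 - p in
  let Y := fun (d : nat) (F : {set {set vertex d}}) =>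
    (\sum_(i < r) comp_count (H i) F)%:R : R in
  let lambda := fun d : nat => Ex p (Y d) in
  let variance := fun d : nat => Var p (Y d) in
  let c : R :=
    \sum_(i < r | (nverts (H i) == t) && (cube_span (H i) == s)) beta_coef p s (H i) in
  let main := fun d : nat => c * (d ^_ s)%:R * (2 * q ^+ t) ^+ d in
  (* (a) *)
  [/\ eq_factor_bigO (fun d => 1 / d%:R) lambda main,
      t \in [:: 1; 2; 3]%N ->
        s = (t - 1)%N /\
        eq_factor_bigO (fun d => d%:R * q ^+ d) lambda main &
      eq_factor_bigO (fun d => d%:R ^+ t * q ^+ (t * d)) variance lambda] /\
  (* (b) *)
  (forall eps : R, 0 < eps ->
     wvhp p (fun d F => `|Y d F - lambda d| < eps * Num.sqrt (d%:R * lambda d))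
     /\ wvhp p (fun d F => `|Y d F - lambda d| < eps * lambda d)) /\
  (* (c) *)
  (exists2 e : nat -> R, (e =O_\oo (fun d => d%:R ^+ t * q ^+ (t * d))) &
     \forall d \near \oo,
       dTV (fun k => Pr p (fun F => Y d F == k%:R)) (poisson_pmf (lambda d))
       = (e d)%:E) /\
  cvg_in_distribution
    (fun d x => Pr p (fun F => (Y d F - lambda d) / Num.sqrt (variance d) <= x))
    (@normal_cdf R).
Proof.
move=> q Y lambda variance c main.
have p1 : 0 < p < 1 by rewrite p_gt0 /=; lra.
have q01 : 0 < q < 1 by rewrite /q; apply/andP; split; lra.
have [q0 q1] := andP q01.
have [i0 i0t] := t_att.
have t_gt0 : (0 < t)%N by rewrite -i0t (leq_trans _ (span_lt_nverts (H_cube i0) (H_conn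
  i0))).
have q2 : 1 <= 2 * q ^+ t.
  by apply: max_order_ge => //; rewrite -i0t; exact: H_small.
pose M := (\sum_(i < r) nverts (H i))%N.
have leM i : (nverts (H i) <= M)%N by rewrite /M (bigD1 i) //= leq_addr.
pose delta := approx_error p H M.
have [C1 [N1 delta_le]] := approx_error_bound p_gt0 p_lt_half H_cube H_conn t_min M.
have [kappa kappa0 mainL] := main_linear p_gt0 p_lt_half H_cube H_conn s_att q2.
have [N2 hN2] := pow_geom_small q01 (@ltr01 R).
pose N0 := (maxn (maxn N1 N2) (maxn s 1)).
have N0P d : (N0 <= d)%N -> [/\ (N1 <= d)%N, (N2 <= d)%N, (s <= d)%N & (0 < d)%N].
  by rewrite !geq_max => /andP[/andP[-> ->] /andP[-> ->]].
have main_le d : main d <= lambda d.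
  rewrite /lambda (expectation_split p_gt0 p_lt_half H_cube H_conn H_noniso t s) lerDl.
  by apply: sumr_ge0 => i _; exact: term_ge0.
have l_ge d : (N0 <= d)%N -> kappa * d%:R <= lambda d.
  by move=> /N0P[_ _ sd _]; apply: le_trans (main_le d); exact: mainL.
have l0 d : (N0 <= d)%N -> 0 < lambda d.
  move=> Nd; apply: lt_le_trans (l_ge d Nd); have [_ _ _ d0] := N0P d Nd.
  by rewrite mulr_gt0 // ltr0n.
have approx d : (N0 <= d)%N -> forall (A : pred nat) N, (forall k, A k -> (k < N)%N) ->
  `|Pr p (fun F : {set {set vertex d}} => A (\sum_(i < r) comp_count (H i) F)%N) -
    \sum_(k < N | A k) poisson_pmf (lambda d) k| <= delta d.
  move=> Nd; apply: copies_poisson_approx => //; exact: l0.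
have var_le d : (N0 <= d)%N -> `|variance d - lambda d| <= delta d * lambda d.
  by move=> Nd; exact: copies_variance.
(* The constant C1 may be nonpositive, while the limit laws ask for a positive one. *)
pose C := Num.max C1 1.
have C0 : 0 < C by rewrite lt_max ltr01 orbT.
have g0 d : 0 <= d%:R * q ^+ d by rewrite mulr_ge0 // exprn_ge0 // ltW.
have delta_leC d : (N0 <= d)%N -> delta d <= C * (d%:R * q ^+ d) ^+ t.
  move=> /N0P[Nd _ _ _]; apply: le_trans (delta_le d Nd) _.
  by rewrite ler_wpM2r ?exprn_ge0 // le_max lexx.
have delta_le1 d : (N0 <= d)%N -> delta d <= C * (d%:R * q ^+ d).
  move=> Nd; apply: le_trans (delta_leC d Nd) _; rewrite ler_pM2l //.
  have [_ Nd2 _ _] := N0P d Nd.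
  by rewrite -[leRHS]expr1 ler_wiXn2l // hN2.
have rateE d : (d%:R * q ^+ d) ^+ t = d%:R ^+ t * q ^+ (t * d).
  by rewrite exprMn -exprM mulnC.
have N0_gt0 : (0 < N0)%N by have [] := N0P N0 (leqnn _).
split; [split|split; [|split]].
- exact: expectation_inv.
- exact: expectation_geom.
- exists (fun d => (variance d - lambda d) / lambda d); last first.
    exists N0 => // d /= Nd; rewrite mulrDl mul1r divfK ?gt_eqF ?l0 //.
    by rewrite addrC subrK.
  apply: (@eqO_bound _ _ _ C N0) => d Nd.
  rewrite normrM normfV (ger0_norm (ltW (l0 d Nd))) ler_pdivrMr ?l0 //.
  apply: le_trans (var_le d Nd) _; rewrite ler_pM2r ?l0 //.
  by rewrite -rateE ger0_norm ?exprn_ge0 // delta_leC.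
- move=> eps eps0; split.
    exact: (deviation_wvhp q01 kappa0 C0 N0_gt0 l_ge approx delta_le1 eps0).
  exact: (relative_deviation_wvhp p_gt0 p_lt_half q01 kappa0 C0 N0_gt0 l_ge approx
    delta_le1 eps0).
- apply: (dTV_bigO approx); exists C, N0 => d Nd.
  by rewrite -rateE ger0_norm ?exprn_ge0 // delta_leC.
- exact: (standardized_cvg p_gt0 p_lt_half q01 kappa0 C0 N0_gt0 l_ge approx delta_le1
  var_le).
Qed.
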